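(* Let $B=(B^1,\dots,B^d)$ be a $d$-dimensional $G$-Brownian motion on the $G$-expectation space $(\Omega,L_{ip}(\Omega),\hat{\mathbb E})$, and let $T>0$, $n\ge 1$. For each $\varepsilon\ge 0$ let $X_0^\varepsilon\in\mathbb R^n$ and let $b^\varepsilon,h^\varepsilon_{ij},\sigma^\varepsilon_j$ ($i,j=1,\dots,d$) be (random) $\mathbb R^n$-valued functions of $(t,x)\in[0,T]\times\mathbb R^n$ such that $b^\varepsilon(\cdot,x),h^\varepsilon_{ij}(\cdot,x),\sigma^\varepsilon_j(\cdot,x)\in M_G^2([0,T];\mathbb R^n)$ for every $x\in\mathbb R^n$. Assume that for all $\varepsilon\ge 0$, $t\in[0,T]$, $x,x_1,x_2\in\mathbb R^n$: (a) $|b^\varepsilon(t,x)|^2+\sum_{i,j=1}^d|h^\varepsilon_{ij}(t,x)|^2+\sum_{j=1}^d|\sigma^\varepsilon_j(t,x)|^2\le \alpha_1^2(t)+\alpha_2^2(t)|x|^2$; (b) $|b^\varepsilon(t,x_1)-b^\varepsilon(t,x_2)|^2+\sum_{i,j=1}^d|h^\varepsilon_{ij}(t,x_1)-h^\varepsilon_{ij}(t,x_2)|^2+\sum_{j=1}^d|\sigma^\varepsilon_j(t,x_1)-\sigma^\varepsilon_j(t,x_2)|^2\le \alpha^2(t)\,\rho(|x_1-x_2|^2)$, where $\alpha_1\in M_G^2([0,T])$, $\alpha_2:[0,T]\to\mathbb R^+$ and $\alpha:[0,T]\to\mathbb R^+$ are Lebesgue integrable, and $\rho:(0,+\infty)\to(0,+\infty)$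 is a continuous, increasing, concave function with $\rho(0+)=0$ (set $\rho(0):=0$) and $\int_0^1\frac{1}{\rho(r)}\,dr=+\infty$ (with $\alpha_1,\alpha_2,\alpha,\rho$ independent of $\varepsilon$). For each $\varepsilon\ge0$ let $X^\varepsilon\in M_G^2([0,T];\mathbb R^n)$ be the solution of $$X^\varepsilon_t=X^\varepsilon_0+\int_0^t b^\varepsilon(s,X^\varepsilon_s)\,ds+\sum_{i,j=1}^d\int_0^t h^\varepsilon_{ij}(s,X^\varepsilon_s)\,d\langle B^i,B^j\rangle_s+\sum_{j=1}^d\int_0^t\sigma^\varepsilon_j(s,X^\varepsilon_s)\,dB^j_s,\qquad t\in[0,T].$$ Assume further that, as $\varepsilon\to0$, $X_0^\varepsilon\to X_0^0$ and, for all $t\in[0,T]$ and for each $\phi\in\{b,h_{ij},\sigma_j: i,j=1,\dots,d\}$, $$\int_0^t\hat{\mathbb E}\big[|\phi^\varepsilon(s,X^0_s)-\phi^0(s,X^0_s)|^2\big]\,ds\to0 .$$ Then, as $\varepsilon\to0$, $$\forall\, t\in[0,T],\qquad \hat{\mathbb E}\big[|X^\varepsilon_t-X^0_t|^2\big]\to0 .$$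
   Context: Sublinear expectations. A sublinear expectation $\mathbb E$ on a linear space $\mathcal H$ of real functions on a set $\Omega$ (with $\mathcal H$ containing constants and closed under $|\cdot|$ and under composition with functions in $C_{l,Lip}$) is a functional $\mathbb E:\mathcal H\to\mathbb R$ that is monotone, preserves constants, is subadditive and positively homogeneous. $C_{l,Lip}(\mathbb R^k)$ is the space of $\varphi$ with $|\varphi(x)-\varphi(y)|\le C(1+|x|^m+|y|^m)|x-y|$ for some $C>0$, $m\in\mathbb N$. Random vectors $X,Y$ are identically distributed, $X\stackrel d=Y$, if $\mathbb E_1[\varphi(X)]=\mathbb E_2[\varphi(Y)]$ for all $\varphi\in C_{l,Lip}$ (each under its own expectation); $Y$ is independent from $X$ if $\mathbb E[\varphi(X,Y)]=\mathbb E\big[\mathbb E[\varphi(x,Y)]_{x=X}\big]$ for all $\varphi\in C_{l,Lip}$. A random vector $\xi$ is $G$-normal if $a\xi+b\bar\xi\stackrel d=\sqrt{a^2+b^2}\,\xi$ for all $a,b\ge0$, where $\bar\xi\stackrel d=\xi$ is independent from $\xi$. $G$-Brownian motion. $\Omega=C_0^d(\mathbb R^+)$ is the space of continuous $\mathbb R^d$-valued paths starting at $0$, $B_t(\omega)=\omega_t$ the canonical process, $L_{ip}(\Omega_T)=\{\varphi(B_{t_1},\dots,B_{t_m}): m\ge1,\ t_i\in[0,T],\ \varphi\in C_{l,Lip}(\mathbb R^{d\times m})\}$, $L_{ip}(\Omega)=\bigcup_n L_{ip}(\Omega_n)$. Fix a $d$-dimensional $G$-normal $\xi$. The $G$-expectation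 $\hat{\mathbb E}$ on $L_{ip}(\Omega)$ is the sublinear expectation with $\hat{\mathbb E}[\varphi(B_{t_1}-B_{t_0},\dots,B_{t_m}-B_{t_{m-1}})]=\widetilde{\mathbb E}[\varphi(\sqrt{t_1-t_0}\,\xi_1,\dots,\sqrt{t_m-t_{m-1}}\,\xi_m)]$ for $0=t_0<\dots<t_m$, where $\xi_i\stackrel d=\xi$ and $\xi_{i+1}$ is independent from $(\xi_1,\dots,\xi_i)$. Under $\hat{\mathbb E}$, $B$ is called a $G$-Brownian motion. Spaces and integrals. $L_G^p(\Omega_T)$, $p\ge1$, is the completion of $L_{ip}(\Omega_T)$ under $(\hat{\mathbb E}[|X|^p])^{1/p}$; $\hat{\mathbb E}$ extends continuously. $M_G^p([0,T];\mathbb R^n)$ is the completion of the simple processes $\eta_t=\sum_{k=0}^{N-1}\xi_k\mathbf 1_{[t_k,t_{k+1})}(t)$ ($0=t_0<\dots<t_N=T$, $\xi_k\in L_G^p(\Omega_{t_k})$, $\mathbb R^n$-valued) under $\big(\int_0^T\hat{\mathbb E}[|\eta_t|^p]dt\big)^{1/p}$; $M_G^p([0,T])$ is the case $n=1$. For simple processes, $\int_0^T\eta_s\,ds=\sum\xi_k(t_{k+1}-t_k)$, $\int_0^T\eta_s\,dB^j_s=\sum\xi_k(B^j_{t_{k+1}}-B^j_{t_k})$, $\int_0^T\eta_s\,d\langle B^i,B^j\rangle_s=\sum\xi_k(\langle B^i,B^j\rangle_{t_{k+1}}-\langle B^i,B^j\rangle_{t_k})$, all extended by continuity (the $dB^j$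 integral to $M_G^2$, the others to $M_G^1$). Here $\langle B^i,B^j\rangle_t$ is the limit of $\sum_k(B^i_{t_{k+1}}-B^i_{t_k})(B^j_{t_{k+1}}-B^j_{t_k})$ along partitions of $[0,t]$ with mesh tending to $0$ (for $i=j$ it is the quadratic variation $\langle B^i\rangle_t=(B^i_t)^2-2\int_0^tB^i_s\,dB^i_s$). Convention. The paper's standing fact is that hypotheses (a), (b) and membership of the coefficients in $M_G^2$ guarantee, for every $\varepsilon\ge0$, a unique solution $X^\varepsilon\in M_G^2([0,T];\mathbb R^n)$. The value $X^\varepsilon_t$ for individual $t$ is the one given by the right-hand side of the equation.
   Formalization: The formal theorem additionally assumes that α² is Lebesgue integrable on [0,T]; with α only integrable the claim fails, e.g. for classical Brownian motion, d=1, n=2, σ(t,x)=Jx/max(√t,|x|), J a quarter turn, α(t)=t^(-1/2), ρ(r)=r, X_0^ε=(ε,0). *)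

(* Defs.v *)
(* MathComp-Analysis, over an arbitrary real type R. *)
From HB Require Import structures.
From mathcomp Require Import all_boot all_order all_algebra.
From mathcomp Require Import all_classical all_reals all_analysis.

Set Implicit Arguments.
Unset Strict Implicit.
Unset Printing Implicit Defensive.

Import Order.TTheory GRing.Theory Num.Theory.
Import numFieldNormedType.Exports.

Local Open Scope classical_set_scope.
Local Open Scope ring_scope.

(** * Sublinear expectations *)

(* Euclidean norm; the library norm on matrices is the maximum norm. *)
Definition enorm {R : realType} {m n : nat} (x : 'M[R]_(m, n)) : R :=
  Num.sqrt (\sum_i \sum_j x i j ^+ 2).

(* C_{l,Lip}(R^{m x n}). *)
Definition ClLip {R : realType} {m n : nat} (phi : 'M[R]_(m, n) -> R) : Prop :=
  exists (C : R) (q : nat), 0 < C /\ forall x y,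
    `|phi x - phi y| <= C * (1 + enorm x ^+ q + enorm y ^+ q) * enorm (x - y).

Section SublinearExpectation.
Context {R : realType}.

Definition rv_space (O : Type) (H : set (O -> R)) : Prop :=
  [/\ forall c : R, H (fun=> c),
      forall (a : R) X Y, H X -> H Y -> H (fun o => a * X o + Y o),
      forall X, H X -> H (fun o => `|X o|) &
      forall (k : nat) (X : O -> 'rV[R]_k) (phi : 'rV[R]_k -> R),
        (forall i, H (fun o => X o ord0 i)) -> ClLip phi ->
        H (fun o => phi (X o))].

Definition sublinear_expectation (O : Type) (H : set (O -> R))
    (E : (O -> R) -> R) : Prop :=
  [/\ forall X Y, H X -> H Y -> (forall o, X o <= Y o) -> E X <= E Y,
      forall c : R, E (fun=> c) = c,
      forall X Y, H X -> H Y -> E (fun o => X o + Y o) <= E X + E Y &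
      forall (a : R) X, 0 <= a -> H X -> E (fun o => a * X o) = a * E X].

Definition rvector (O : Type) (H : set (O -> R)) (m n : nat)
    (X : O -> 'M[R]_(m, n)) : Prop :=
  forall i j, H (fun o => X o i j).

Definition ident_distr (O1 O2 : Type) (E1 : (O1 -> R) -> R)
    (E2 : (O2 -> R) -> R) (m n : nat)
    (X : O1 -> 'M[R]_(m, n)) (Y : O2 -> 'M[R]_(m, n)) : Prop :=
  forall phi : 'M[R]_(m, n) -> R, ClLip phi ->
    E1 (fun o => phi (X o)) = E2 (fun o => phi (Y o)).

(* [independent_from E Y X]: Y is independent from X (not symmetric).  The pair
   (X, Y) is stacked vertically, so one definition serves finite lists of
   d-dimensional vectors, stored as the rows of a matrix. *)
Definition independent_from (O : Type) (E : (O -> R) -> R) (m1 m2 n : nat)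
    (Y : O -> 'M[R]_(m2, n)) (X : O -> 'M[R]_(m1, n)) : Prop :=
  forall phi : 'M[R]_(m1 + m2, n) -> R, ClLip phi ->
    E (fun o => phi (col_mx (X o) (Y o))) =
    E (fun o => E (fun o' => phi (col_mx (X o) (Y o')))).

Definition G_normal (O : Type) (H : set (O -> R)) (E : (O -> R) -> R)
    (d : nat) (xi : O -> 'rV[R]_d) : Prop :=
  rvector H xi /\
  exists xi' : O -> 'rV[R]_d,
    [/\ rvector H xi', ident_distr E E xi' xi, independent_from E xi' xi &
        forall a b : R, 0 <= a -> 0 <= b ->
          ident_distr E E (fun o => a *: xi o + b *: xi' o)
                          (fun o => Num.sqrt (a ^+ 2 + b ^+ 2) *: xi o)].

End SublinearExpectation.

(** * Canonical path space and G-expectation *)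

(* A path on [0, +oo[ starting at 0 is extended by 0 to the negative reals;
   this is a bijection from C_0^d(R^+) onto [cpath R d]. *)
Record cpath (R : realType) (d : nat) := CPath {
  cpath_fun :> R -> 'rV[R]_d;
  cpath_continuous : continuous cpath_fun;
  cpath_start : forall t, t <= 0 -> cpath_fun t = 0 }.

Section GExpectation.
Context {R : realType} {d : nat}.

(* L_ip(Omega_T). *)
Definition Lip_upto (T : R) : set (cpath R d -> R) :=
  [set X | exists (m : nat) (t : 'I_m -> R) (phi : 'M[R]_(m, d) -> R),
    [/\ (0 < m)%N, forall i, 0 <= t i <= T, ClLip phi &
        X = fun w : cpath R d => phi (\matrix_i w (t i))]].

(* L_ip(Omega). *)
Definition Lip : set (cpath R d -> R) :=
  [set X | exists n : nat, Lip_upto n%:R X].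

(* Here [xis i] is the paper's xi_{i+1}. *)
Definition G_expectation (Ehat : (cpath R d -> R) -> R) : Prop :=
  sublinear_expectation Lip Ehat /\
  exists (O : Type) (H : set (O -> R)) (E : (O -> R) -> R)
         (xi : O -> 'rV[R]_d) (xis : nat -> O -> 'rV[R]_d),
    [/\ rv_space H, sublinear_expectation H E, G_normal H E xi,
        forall i, rvector H (xis i) /\ ident_distr E E (xis i) xi &
        (forall i, independent_from E (xis i.+1)
                     (fun o => \matrix_(l < i.+1) xis l o)) /\
        forall (m : nat) (t : nat -> R) (phi : 'M[R]_(m, d) -> R),
          t 0%N = 0 -> (forall i, (i < m)%N -> t i < t i.+1) -> ClLip phi ->
          Ehat (fun w => phi (\matrix_(i < m) (w (t i.+1) - w (t i)))) =
          E (fun o => phi (\matrix_(i < m)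
                             (Num.sqrt (t i.+1 - t i) *: xis i o)))].

End GExpectation.

(** * The spaces L_G^p and M_G^p *)

(* Elements of the completions L_G^p(Omega; R^n) are represented by Cauchy
   sequences of R^n-valued functions with components in L_ip(Omega); [k] below
   always is the index in such a sequence.  Operations (sums, squared norms,
   positive parts, products with an indicator ...) act termwise.  Every notion
   below is unchanged when a Cauchy sequence is replaced by an equivalent one,
   that is, it only depends on the element of the completion. *)
Definition rseq (R : realType) (d : nat) := nat -> cpath R d -> R.
Definition vseq (R : realType) (d n : nat) := nat -> cpath R d -> 'rV[R]_n.

Section Completion.
Context {R : realType} {d : nat}.
Variable Ehat : (cpath R d -> R) -> R.

(* L_G^p(Omega_T; R^n), for p >= 1. *)
Definition LG (p : nat) (T : R) (n : nat) (X : vseq R d n) : Prop :=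
  (forall k i, Lip_upto T (fun w => X k w ord0 i)) /\
  (forall e : R, 0 < e -> \forall k & l \near \oo,
     Ehat (fun w => enorm (X k w - X l w) ^+ p) < e).

(* The continuous extension of Ehat to the completion. *)
Definition EG (U : rseq R d) : R := limn (fun k => Ehat (U k)).

(* The order of the completion: U <= V iff (U - V)^+ = 0 in L_G^1. *)
Definition LGle (U V : rseq R d) : Prop :=
  Ehat (fun w => Num.max (U k w - V k w) 0) @[k --> \oo] --> (0 : R).

(* Elements of the completion M_G^p([0, T]; R^n) are represented by functions
   t |-> eta_t with values in L_G^p.  This loses nothing: the norm
   (\int_0^T Ehat[|eta_t|^p] dt)^{1/p} is that of the Bochner space
   L^p([0, T]; L_G^p), so a Cauchy sequence of simple processes converges to
   such a function, unique up to a null set of times. *)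
Definition process (n : nat) := R -> vseq R d n.

Definition pdist (p n : nat) (eta zeta : process n) (t : R) : R :=
  EG (fun k w => enorm (eta t k w - zeta t k w) ^+ p).

(* Convergence for the norm of M_G^p([0, T]; R^n).  Measurability is required
   because the library integral of a non-measurable function is only a lower
   integral. *)
Definition MG_cvg (p : nat) (T : R) (n : nat) (etas : nat -> process n)
    (eta : process n) : Prop :=
  (forall l, measurable_fun `[0, T] (pdist p eta (etas l))) /\
  (\int[lebesgue_measure]_(t in `[0%R, T]) (pdist p eta (etas l) t)%:E)%E
    @[l --> \oo] --> 0%E.

Definition partition (N : nat) (t : nat -> R) (T : R) : Prop :=
  [/\ t 0%N = 0, t N = T & forall i, (i < N)%N -> t i < t i.+1].

Record simple_process (n : nat) := SimpleProcess {
  sp_size : nat;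
  sp_time : nat -> R;
  sp_coef : nat -> vseq R d n }.

Definition is_simple (p : nat) (T : R) (n : nat) (s : simple_process n) : Prop :=
  partition (sp_size s) (sp_time s) T /\
  forall i, (i < sp_size s)%N -> LG p (sp_time s i) (sp_coef s i).

Definition sp_process (n : nat) (s : simple_process n) : process n :=
  fun t k w => \sum_(i < sp_size s)
    (if sp_time s i <= t < sp_time s i.+1 then sp_coef s i k w else 0).

(* M_G^p([0, T]; R^n). *)
Definition MG (p : nat) (T : R) (n : nat) (eta : process n) : Prop :=
  (forall t, 0 <= t <= T -> LG p T (eta t)) /\
  exists s : nat -> simple_process n,
    (forall l, is_simple p T (s l)) /\
    MG_cvg p T (fun l => sp_process (s l)) eta.

(** * Integrals *)

Definition sp_integral (n : nat) (A : R -> rseq R d) (s : simple_process n) :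
    vseq R d n :=
  fun k w => \sum_(i < sp_size s)
    (A (sp_time s i.+1) k w - A (sp_time s i) k w) *: sp_coef s i k w.

(* [is_integral p A t eta Z]: Z in L_G^p is the integral of eta over [0, t]
   against A, i.e. (eta, Z) lies in the closure in M_G^p([0, t]) x L_G^p of the
   graph of [sp_integral A].  The simple processes have coefficients in L_G^2;
   they are dense in M_G^p for p = 1, 2, and for them the termwise products in
   [sp_integral] are Cauchy in L_G^p. *)
Definition is_integral (p : nat) (A : R -> rseq R d) (t : R) (n : nat)
    (eta : process n) (Z : vseq R d n) : Prop :=
  LG p t Z /\
  exists s : nat -> simple_process n,
    [/\ forall l, is_simple 2 t (s l),
        MG_cvg p t (fun l => sp_process (s l)) eta &
        EG (fun k w => enorm (sp_integral A (s l) k w - Z k w) ^+ p)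
          @[l --> \oo] --> (0 : R)].

Definition time : R -> rseq R d := fun t _ _ => t.

Definition brownian (j : 'I_d) : R -> rseq R d := fun t _ w => w t ord0 j.

(* [is_bracket i j t Q]: Q is <B^i, B^j>_t; the limit is taken in L_G^2.
   The embedding [_%:M] of scalars in 'rV_1 makes [LG] applicable to Q. *)
Definition is_bracket (i j : 'I_d) (t : R) (Q : rseq R d) : Prop :=
  LG 2 t (fun k w => (Q k w)%:M : 'rV[R]_1) /\
  forall e : R, 0 < e -> exists2 delta : R, 0 < delta &
    forall (N : nat) (u : nat -> R), partition N u t ->
      (forall l, (l < N)%N -> u l.+1 - u l < delta) ->
      EG (fun k w => `|Q k w - \sum_(l < N)
            (w (u l.+1) ord0 i - w (u l) ord0 i) *
            (w (u l.+1) ord0 j - w (u l) ord0 j)| ^+ 2) < e.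

(** * Random fields and the stochastic differential equation *)

Definition rfield (n : nat) := R -> 'rV[R]_n -> vseq R d n.

(* [eval_at f xi eta]: eta is the value f(xi) of the random field f at the
   random point xi.  In the completion there is no evaluation at a path, so the
   substitution is understood as the extension by continuity of x |-> f(x):
   for every e > 0 there is delta > 0 such that, for all deterministic x,
   |eta - f(x)| <= e on {|xi - x| < delta}; the latter is expressed as
   (delta - |xi - x|)^+ (|eta - f(x)| - e)^+ = 0.  This determines eta in L_G^2
   uniquely; eta exists if f(x) has a deterministic modulus of continuity and
   linear growth in x. *)
Definition eval_at (n : nat) (f : 'rV[R]_n -> vseq R d n)
    (xi eta : vseq R d n) : Prop :=
  forall e : R, 0 < e -> exists2 delta : R, 0 < delta &
    forall x : 'rV[R]_n,
      Ehat (fun w => Num.max (delta - enorm (xi k w - x)) 0 *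
                     Num.max (enorm (eta k w - f x k w) - e) 0)
        @[k --> \oo] --> (0 : R).

(* eta is the process f(., X_.), an element of M_G^2([0, T]; R^n). *)
Definition is_composite (T : R) (n : nat) (f : rfield n)
    (X eta : process n) : Prop :=
  MG 2 T eta /\
  forall s, 0 <= s <= T -> eval_at (f s) (X s) (eta s).

(* [QV i j t] stands for <B^i, B^j>_t. *)
Definition is_solution (QV : 'I_d -> 'I_d -> R -> rseq R d) (T : R) (n : nat)
    (x0 : 'rV[R]_n) (b : rfield n) (h : 'I_d -> 'I_d -> rfield n)
    (sigma : 'I_d -> rfield n) (X : process n) : Prop :=
  MG 2 T X /\
  exists (bX : process n) (hX : 'I_d -> 'I_d -> process n)
         (sX : 'I_d -> process n),
    [/\ is_composite T b X bX,
        forall i j, is_composite T (h i j) X (hX i j),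
        forall j, is_composite T (sigma j) X (sX j) &
        forall t, 0 <= t <= T ->
          exists (Ib : vseq R d n) (Ih : 'I_d -> 'I_d -> vseq R d n)
                 (Is : 'I_d -> vseq R d n),
            [/\ is_integral 1 time t bX Ib,
                forall i j, is_integral 1 (QV i j) t (hX i j) (Ih i j),
                forall j, is_integral 2 (brownian j) t (sX j) (Is j) &
                EG (fun k w => enorm (X t k w -
                      (x0 + Ib k w + \sum_i \sum_j Ih i j k w
                          + \sum_j Is j k w))) = 0]].

(* \int_0^t Ehat[|phi^eps(s, X_s) - phi^0(s, X_s)|^2] ds -> 0 as eps -> 0+,
   for all t in [0, T]. *)
Definition coef_cvg (T : R) (n : nat) (phi : R -> rfield n) (X : process n) :
    Prop :=
  exists phiX : R -> process n,
    (forall eps, 0 <= eps -> is_composite T (phi eps) X (phiX eps)) /\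
    forall t, 0 <= t <= T ->
      (\int[lebesgue_measure]_(s in `[0%R, t])
         (pdist 2 (phiX eps) (phiX 0%R) s)%:E)%E
        @[eps --> 0^'+] --> 0%E.

End Completion.

(* Main.v *)
Require Import Defs.
From mathcomp Require Import all_boot all_order all_algebra.
From mathcomp Require Import all_classical all_reals all_analysis.
From mathcomp Require Import ring lra measurable_realfun.

(** Subtract the equations for X^eps and X^0. The integrals against ds, d<B^i,B^j>
    and dB^j obey L^2 bounds: the martingale part by conditioning on the past, the
    brackets because a weak law of large numbers for the squared increments gives
    |<B^i,B^j>_t - <B^i,B^j>_s| <= sigma^2 (t - s) in the order of L_G^2. As
    s |-> E|eta_s - zeta_s|^2 need not be measurable, the bounds use a Borel
    minorant with a comparable integral. Concavity gives
    rho(r) <= rho(u) (1 + 2 r/u), so that evaluation on a finite net of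
    deterministic points yields
    E|f(s,X) - f(s,Y)|^2 <= 9 alpha^2(s) rho(u) whenever E|X - Y|^2 <= u.
    Hence v = E|X^eps - X^0|^2 is dominated by a nondecreasing function satisfying
    v(t) <= c(eps) + K \int_0^t alpha^2 rho(v) with c(eps) -> 0, and Osgood's
    condition on rho forces v(T) -> 0. *)

Set Implicit Arguments.
Unset Strict Implicit.
Unset Printing Implicit Defensive.

Import Order.TTheory GRing.Theory Num.Theory.
Import numFieldNormedType.Exports.

Local Open Scope classical_set_scope.
Local Open Scope ring_scope.

(** * The Euclidean norm and the class C_{l,Lip} *)

(** A random variable is a Cauchy sequence here, so nothing can be evaluated at a path. Every
    estimate is a pointwise inequality between elements of L_ip with nonnegative coefficients, to
    which [Ehat] is applied before a limit in the index k; Young's inequality with a free parameter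
    takes the place of Cauchy-Schwarz under [Ehat]. Two obstacles shape the rest. The integrals
    against ds and d<B> are limits in L_G^1 only, while the conclusion concerns L_G^2: [wclos]
    carries L^2 bounds through L^1 limits. And the simple processes defining an integral depend on
    t, while Osgood's argument needs one integrand for all t: each integrand is therefore also
    approximated by one sequence on [0, T], with which the sequences on [0, t] are compared. The
    constant 9 is 3 (1 + 2): 3 for the square of a sum of three terms, 1 + 2 for the affine bound of
    rho at r = u. The weight in Osgood's inequality is alpha^2, since condition (b) enters through
    squared L^2 norms. *)

Section Enorm.
Context {R : realType}.

Lemma enorm_ge0 m n (x : 'M[R]_(m, n)) : 0 <= enorm x.
Proof. exact: sqrtr_ge0. Qed.

Lemma enorm_sqr m n (x : 'M[R]_(m, n)) :
  enorm x ^+ 2 = \sum_i \sum_j x i j ^+ 2.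
Proof.
by rewrite sqr_sqrtr// sumr_ge0// => i _; rewrite sumr_ge0// => j _; rewrite sqr_ge0.
Qed.

Lemma enorm0 m n : enorm (0 : 'M[R]_(m, n)) = 0.
Proof.
apply/eqP; rewrite -sqrf_eq0 enorm_sqr big1// => i _; rewrite big1// => j _.
by rewrite mxE expr0n.
Qed.

Lemma normr_le_enorm m n (x : 'M[R]_(m, n)) i j : `|x i j| <= enorm x.
Proof.
rewrite -ler_sqr ?nnegrE ?enorm_ge0// enorm_sqr real_normK ?num_real//.
rewrite (bigD1 i)//= (bigD1 j)//= -addrA lerDl addr_ge0//.
  by rewrite sumr_ge0// => k _; rewrite sqr_ge0.
by rewrite sumr_ge0// => k _; rewrite sumr_ge0// => l _; rewrite sqr_ge0.
Qed.

Lemma enormZ m n (a : R) (x : 'M[R]_(m, n)) : enorm (a *: x) = `|a| * enorm x.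
Proof.
apply/eqP; rewrite -(@eqrXn2 _ 2)// ?mulr_ge0 ?enorm_ge0// exprMn !enorm_sqr.
rewrite real_normK ?num_real// mulr_sumr; apply/eqP/eq_bigr => i _.
by rewrite mulr_sumr; apply/eq_bigr => j _; rewrite mxE exprMn.
Qed.

Lemma enormN m n (x : 'M[R]_(m, n)) : enorm (- x) = enorm x.
Proof. by rewrite -scaleN1r enormZ normrN1 mul1r. Qed.

Lemma enormC m n (x y : 'M[R]_(m, n)) : enorm (x - y) = enorm (y - x).
Proof. by rewrite -enormN opprB. Qed.

Lemma enorm_eq0 m n (x : 'M[R]_(m, n)) : enorm x = 0 -> x = 0.
Proof.
move=> x0; apply/matrixP => i j; rewrite mxE; apply/eqP.
by rewrite -normr_le0 -x0 normr_le_enorm.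
Qed.

Lemma young (theta x y : R) : 0 < theta ->
  x * y <= theta / 2 * x ^+ 2 + (2 * theta)^-1 * y ^+ 2.
Proof.
move=> th0; rewrite -subr_ge0.
suff -> : theta / 2 * x ^+ 2 + (2 * theta)^-1 * y ^+ 2 - x * y
  = (2 * theta)^-1 * (theta * x - y) ^+ 2.
  by rewrite mulr_ge0 ?sqr_ge0// invr_ge0 mulr_ge0 ?ltW.
by field; rewrite gt_eqF.
Qed.

Lemma young1 (theta x : R) : 0 < theta -> x <= theta + theta^-1 * x ^+ 2.
Proof.
move=> th0; rewrite -subr_ge0; have -> : theta + theta^-1 * x ^+ 2 - x =
  theta^-1 * ((x - theta / 2) ^+ 2 + 3 / 4 * theta ^+ 2) by field; rewrite gt_eqF.
by rewrite mulr_ge0 ?invr_ge0 ?(ltW th0)// addr_ge0 ?sqr_ge0// mulr_ge0 ?sqr_ge0.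
Qed.

Lemma enormD m n (x y : 'M[R]_(m, n)) : enorm (x + y) <= enorm x + enorm y.
Proof.
have [x0|xn0] := eqVneq (enorm x) 0.
  by rewrite (enorm_eq0 x0) enorm0 !add0r.
have [y0|yn0] := eqVneq (enorm y) 0.
  by rewrite (enorm_eq0 y0) enorm0 !addr0.
have x0 : 0 < enorm x by rewrite lt_def xn0 enorm_ge0.
have y0 : 0 < enorm y by rewrite lt_def yn0 enorm_ge0.
rewrite -ler_sqr ?nnegrE ?addr_ge0 ?enorm_ge0// sqrrD.
(* With this parameter the entrywise Young bounds add up to exactly 2 |x| |y|, so Cauchy-Schwarz is
   obtained on the way. *)
pose t := enorm y / enorm x.
have t0 : 0 < t by rewrite divr_gt0.
rewrite enorm_sqr.
apply: (@le_trans _ _ (enorm x ^+ 2 + (t * enorm x ^+ 2 + t^-1 * enorm y ^+ 2) + enorm y ^+ 2)).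
  rewrite !enorm_sqr !mulr_sumr -!big_split/=; apply: ler_sum => i _.
  rewrite !mulr_sumr -!big_split/=; apply: ler_sum => j _.
  rewrite mxE sqrrD -(mulr_natl (x i j * y i j)) lerD2r lerD2l.
  have := young (x i j) (y i j) t0.
  rewrite -(ler_pM2l (ltr0n R 2)) => /le_trans; apply.
  rewrite le_eqVlt; apply/orP; left; apply/eqP; field.
  by rewrite gt_eqF.
rewrite lerD2r lerD2l le_eqVlt; apply/orP; left; apply/eqP.
by rewrite /t -mulr_natl; field; rewrite xn0 yn0.
Qed.

Lemma enormB m n (x y : 'M[R]_(m, n)) : enorm (x - y) <= enorm x + enorm y.
Proof. by rewrite -(enormN y) enormD. Qed.

Lemma enorm_subl m n (x y : 'M[R]_(m, n)) : enorm x <= enorm y + enorm (x - y).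
Proof. by rewrite -{1}(subrK y x) addrC enormD. Qed.

Lemma enorm_trans m n (y x z : 'M[R]_(m, n)) :
  enorm (x - z) <= enorm (x - y) + enorm (y - z).
Proof. by rewrite -{1}(subrK y x) -addrA enormD. Qed.

Lemma enorm_dist m n (x y : 'M[R]_(m, n)) : `|enorm x - enorm y| <= enorm (x - y).
Proof.
have h1 := enorm_subl x y; have h2 := enorm_subl y x.
by rewrite ler_norml; move: h2; rewrite enormC => h2; lra.
Qed.

Lemma enorm_sum m n (I : Type) (r : seq I) (P : pred I) (F : I -> 'M[R]_(m, n)) :
  enorm (\sum_(i <- r | P i) F i) <= \sum_(i <- r | P i) enorm (F i).
Proof.
elim/big_ind2 : _ => [|x1 x2 y1 y2 h1 h2|//]; first by rewrite enorm0.
exact: le_trans (enormD _ _) (lerD h1 h2).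
Qed.

Lemma enorm_le_sum m n (x : 'M[R]_(m, n)) :
  enorm x <= \sum_i \sum_j `|x i j|.
Proof.
rewrite {1}[x]matrix_sum_delta.
apply: le_trans (enorm_sum _ _ _) _; apply: ler_sum => i _.
apply: le_trans (enorm_sum _ _ _) _; apply: ler_sum => j _.
rewrite enormZ -[leRHS]mulr1 ler_wpM2l//.
rewrite -(@ler_pXn2r _ 2) ?nnegrE ?enorm_ge0// enorm_sqr (bigD1 i)//= (bigD1 j)//= mxE !eqxx.
rewrite big1 ?addr0 => [|k kj]; last by rewrite mxE (negbTE kj) andbF expr0n.
rewrite big1 ?addr0// => k ki; apply: big1 => l _.
by rewrite mxE (negbTE ki) expr0n.
Qed.

Lemma enorm_scalar (a : R) : enorm (a%:M : 'rV[R]_1) = `|a|.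
Proof. by rewrite /enorm !big_ord1 mxE eqxx mulr1n sqrtr_sqr. Qed.

Lemma enorm_sum_sqr m n N (F : 'I_N -> 'M[R]_(m, n)) :
  enorm (\sum_i F i) ^+ 2 <= N%:R * \sum_i enorm (F i) ^+ 2.
Proof.
have h : enorm (\sum_i F i) ^+ 2 <= (\sum_i enorm (F i)) ^+ 2.
  rewrite ler_sqr ?nnegrE ?enorm_ge0 ?enorm_sum// sumr_ge0// => i _.
  exact: enorm_ge0.
apply: le_trans h _.
rewrite expr2 mulr_suml.
apply: (@le_trans _ _ (\sum_(i < N) \sum_(j < N)
   (2^-1 * enorm (F i) ^+ 2 + 2^-1 * enorm (F j) ^+ 2))).
  apply: ler_sum => i _; rewrite mulr_sumr; apply: ler_sum => j _.
  by have := young (enorm (F i)) (enorm (F j)) (ltr01); rewrite mulr1 mul1r.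
set S := \sum_i enorm (F i) ^+ 2.
have -> : \sum_(i < N) \sum_(j < N) (2^-1 * enorm (F i) ^+ 2 + 2^-1 * enorm (F j) ^+ 2)
    = \sum_(i < N) (N%:R * (2^-1 * enorm (F i) ^+ 2) + 2^-1 * S).
  apply: eq_bigr => i _.
  by rewrite big_split/= sumr_const card_ord mulr_natl -mulr_sumr.
rewrite big_split/= sumr_const card_ord -2!mulr_sumr -/S -mulr_natl.
by rewrite le_eqVlt; apply/orP; left; apply/eqP; field.
Qed.

End Enorm.

Section ClLipTheory.
Context {R : realType}.

(* The weight (1 + |x| + |y|)^q is multiplicative in q and monotone in q, which
   makes stability under products and sums immediate. *)
Lemma ClLipP m n (phi : 'M[R]_(m, n) -> R) :
  ClLip phi <-> exists (C : R) (q : nat), 0 <= C /\ forall x y,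
    `|phi x - phi y| <= C * (1 + enorm x + enorm y) ^+ q * enorm (x - y).
Proof.
split=> [[C [q [C0 H]]]|[C [q [C0 H]]]].
  exists (3 * C), q; split=> [|x y]; first by rewrite mulr_ge0 ?ltW.
  apply: le_trans (H x y) _; apply: ler_wpM2r; first exact: enorm_ge0.
  rewrite [3 * C]mulrC -mulrA; apply: ler_wpM2l; first exact: ltW.
  have x0 := enorm_ge0 x; have y0 := enorm_ge0 y.
  have h1 : 1 <= (1 + enorm x + enorm y) ^+ q by rewrite exprn_ege1//; lra.
  have h2 : enorm x ^+ q <= (1 + enorm x + enorm y) ^+ q.
    by apply: lerXn2r; rewrite ?nnegrE; lra.
  have h3 : enorm y ^+ q <= (1 + enorm x + enorm y) ^+ q.
    by apply: lerXn2r; rewrite ?nnegrE; lra.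
  move: h1 h2 h3; move: (_ ^+ q) (enorm x ^+ q) (enorm y ^+ q) => a b c; lra.
exists (C * 3 ^+ q + 1), q; split=> [|x y]; first by rewrite ltr_wpDl// mulr_ge0 ?exprn_ge0.
apply: le_trans (H x y) _; apply: ler_wpM2r; first exact: enorm_ge0.
have x0 := enorm_ge0 x; have y0 := enorm_ge0 y.
have xq : 0 <= enorm x ^+ q by rewrite exprn_ge0.
have yq : 0 <= enorm y ^+ q by rewrite exprn_ge0.
apply: (@le_trans _ _ (C * (3 ^+ q * (1 + enorm x ^+ q + enorm y ^+ q)))); last first.
  rewrite mulrA ler_wpM2r//; last by rewrite lerDl.
  by rewrite -addrA !addr_ge0.
apply: ler_wpM2l => //.
have h a : 0 <= a -> 1 + enorm x + enorm y <= 3 * a ->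
    (1 + enorm x + enorm y) ^+ q <= 3 ^+ q * a ^+ q.
  by move=> a0 h; rewrite -exprMn; apply: lerXn2r; rewrite ?nnegrE//; lra.
have h3 : 0 <= 3 ^+ q :> R by rewrite exprn_ge0.
have [xy|xy] := leP (enorm x) (enorm y).
  have [y1|y1] := leP (enorm y) 1.
    apply: le_trans (h 1 _ _) _ => //; first by rewrite mulr1; lra.
    by rewrite ler_wpM2l// expr1n -addrA lerDl addr_ge0.
  apply: le_trans (h (enorm y) _ _) _ => //; first lra.
  by rewrite ler_wpM2l// lerDr addr_ge0.
have [x1|x1] := leP (enorm x) 1.
  apply: le_trans (h 1 _ _) _ => //; first by rewrite mulr1; lra.
  by rewrite ler_wpM2l// expr1n -addrA lerDl addr_ge0.
apply: le_trans (h (enorm x) _ _) _ => //; first lra.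
by rewrite ler_wpM2l// addrAC lerDr addr_ge0.
Qed.

Lemma ClLip_growth m n (phi : 'M[R]_(m, n) -> R) : ClLip phi ->
  exists (C : R) (q : nat), 0 <= C /\ forall x, `|phi x| <= C * (1 + enorm x) ^+ q.
Proof.
move=> /ClLipP[C [q [C0 H]]]; exists (`|phi 0| + C), q.+1; split=> [|x].
  by rewrite addr_ge0.
have x0 := enorm_ge0 x.
have := H x 0; rewrite enorm0 subr0 addr0 => h.
have h1 : 1 <= (1 + enorm x) ^+ q.+1 by rewrite exprn_ege1//; lra.
have h2 : C * (1 + enorm x) ^+ q * enorm x <= C * (1 + enorm x) ^+ q.+1.
  rewrite exprSr -mulrA ler_wpM2l// ler_wpM2l// ?exprn_ge0//; lra.
have h3 : `|phi 0| <= `|phi 0| * (1 + enorm x) ^+ q.+1 by rewrite ler_peMr.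
rewrite mulrDl; have := ler_normD (phi x - phi 0) (phi 0); rewrite subrK.
lra.
Qed.

Lemma weight_le m n (x y : 'M[R]_(m, n)) p q : (p <= q)%N ->
  (1 + enorm x + enorm y) ^+ p <= (1 + enorm x + enorm y) ^+ q.
Proof.
by move=> pq; apply: ler_weXn2l => //; have := enorm_ge0 x; have := enorm_ge0 y; lra.
Qed.

(** Serves for sums and for maxima, both of which are 1-Lipschitz for the l^1 distance on pairs. *)
Lemma ClLip_comp2 m n (F : R -> R -> R) (phi psi : 'M[R]_(m, n) -> R) :
  (forall a b c e, `|F a b - F c e| <= `|a - c| + `|b - e|) ->
  ClLip phi -> ClLip psi -> ClLip (fun x => F (phi x) (psi x)).
Proof.
move=> HF /ClLipP[C [q [C0 H]]] /ClLipP[D [p [D0 K]]]; apply/ClLipP.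
exists (C + D), (maxn q p); split=> [|x y]; first by rewrite addr_ge0.
apply: le_trans (HF _ _ _ _) _; rewrite !mulrDl; apply: lerD.
  apply: le_trans (H x y) _; rewrite ler_wpM2r ?enorm_ge0// ler_wpM2l//.
  by rewrite weight_le// leq_maxl.
apply: le_trans (K x y) _; rewrite ler_wpM2r ?enorm_ge0// ler_wpM2l//.
by rewrite weight_le// leq_maxr.
Qed.

Lemma ClLipM m n (phi psi : 'M[R]_(m, n) -> R) :
  ClLip phi -> ClLip psi -> ClLip (fun x => phi x * psi x).
Proof.
move=> Hphi Hpsi.
have [C' [q' [C'0 H']]] := ClLip_growth Hphi.
have [D' [p' [D'0 K']]] := ClLip_growth Hpsi.
move: Hphi Hpsi => /ClLipP[C [q [C0 H]]] /ClLipP[D [p [D0 K]]]; apply/ClLipP.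
exists (C' * D + D' * C), (q' + p + (p' + q))%N; split=> [|x y].
  by rewrite addr_ge0// mulr_ge0.
have -> : phi x * psi x - phi y * psi y
  = phi x * (psi x - psi y) + psi y * (phi x - phi y) by ring.
have x0 := enorm_ge0 x; have y0 := enorm_ge0 y.
apply: le_trans (ler_normD _ _) _; rewrite !mulrDl; apply: lerD; rewrite normrM.
  apply: (@le_trans _ _ ((C' * (1 + enorm x + enorm y) ^+ q') *
     (D * (1 + enorm x + enorm y) ^+ p * enorm (x - y)))).
    apply: ler_pM => //; apply: le_trans (H' x) _; rewrite ler_wpM2l//.
    by apply: lerXn2r; rewrite ?nnegrE; lra.
  rewrite mulrA ler_wpM2r ?enorm_ge0// mulrACA -exprD.
  by rewrite ler_wpM2l ?mulr_ge0// weight_le// leq_addr.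
apply: (@le_trans _ _ ((D' * (1 + enorm x + enorm y) ^+ p') *
     (C * (1 + enorm x + enorm y) ^+ q * enorm (x - y)))).
  apply: ler_pM => //; apply: le_trans (K' y) _; rewrite ler_wpM2l//.
  by apply: lerXn2r; rewrite ?nnegrE; lra.
rewrite mulrA ler_wpM2r ?enorm_ge0// mulrACA -exprD.
by rewrite ler_wpM2l ?mulr_ge0// weight_le// leq_addl.
Qed.

Lemma ClLip_lin m n m' n' (f : 'M[R]_(m', n') -> 'M[R]_(m, n)) (K : R)
    (phi : 'M[R]_(m, n) -> R) : 0 <= K ->
  (forall x, enorm (f x) <= K * enorm x) ->
  (forall x y, enorm (f x - f y) <= K * enorm (x - y)) ->
  ClLip phi -> ClLip (fun x => phi (f x)).
Proof.
move=> K0 Hf0 Hf /ClLipP[C [q [C0 H]]]; apply/ClLipP.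
exists (C * (1 + K) ^+ q * K), q; split=> [|x y].
  by rewrite !mulr_ge0// exprn_ge0// addr_ge0.
have x0 := enorm_ge0 x; have y0 := enorm_ge0 y.
have fx0 := enorm_ge0 (f x); have fy0 := enorm_ge0 (f y).
apply: le_trans (H _ _) _.
have -> : C * (1 + K) ^+ q * K * (1 + enorm x + enorm y) ^+ q * enorm (x - y)
  = C * ((1 + K) ^+ q * (1 + enorm x + enorm y) ^+ q) * (K * enorm (x - y)).
  ring.
rewrite -exprMn; apply: ler_pM.
- by rewrite mulr_ge0// exprn_ge0//; lra.
- exact: enorm_ge0.
- apply: ler_wpM2l => //; apply: lerXn2r; rewrite ?nnegrE.
  + lra.
  + by rewrite mulr_ge0//; lra.
  + have := Hf0 x; have := Hf0 y; nra.
- exact: Hf.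
Qed.

Lemma ClLip_cst m n (c : R) : ClLip (fun=> c : R) (m := m) (n := n).
Proof.
apply/ClLipP; exists 0, 0%N; split=> // x y.
by rewrite subrr normr0 !mul0r.
Qed.

Lemma ClLip_entry m n i j : ClLip (fun x : 'M[R]_(m, n) => x i j).
Proof.
apply/ClLipP; exists 1, 0%N; split=> // x y.
by rewrite expr0 !mul1r; have := normr_le_enorm (x - y) i j; rewrite !mxE.
Qed.

Lemma ClLipD m n (phi psi : 'M[R]_(m, n) -> R) :
  ClLip phi -> ClLip psi -> ClLip (fun x => phi x + psi x).
Proof.
apply: (@ClLip_comp2 _ _ +%R) => a b c e.
have -> : a + b - (c + e) = (a - c) + (b - e) by ring.
exact: ler_normD.
Qed.

Lemma ClLip_sum m n (I : Type) (r : seq I) (F : I -> 'M[R]_(m, n) -> R) :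
  (forall i, ClLip (F i)) -> ClLip (fun x => \sum_(i <- r) F i x).
Proof.
move=> H; elim: r => [|i r IH].
  by under eq_fun do rewrite big_nil; exact: ClLip_cst.
by under eq_fun do rewrite big_cons; apply: ClLipD.
Qed.

Lemma ClLip_abs m n (phi : 'M[R]_(m, n) -> R) :
  ClLip phi -> ClLip (fun x => `|phi x|).
Proof.
move=> /ClLipP[C [q [C0 H]]]; apply/ClLipP; exists C, q; split=> // x y.
exact: le_trans (ler_dist_dist _ _) (H x y).
Qed.

Lemma ClLip_enorm_comp m n N (F : 'I_N -> 'M[R]_(m, n) -> R) :
  (forall i, ClLip (F i)) -> ClLip (fun x => enorm (\row_i F i x)).
Proof.
move=> H.
have /choice[C HC] i : exists C, 0 <= C /\ exists q : nat, forall x y,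
    `|F i x - F i y| <= C * (1 + enorm x + enorm y) ^+ q * enorm (x - y).
  by have /ClLipP[C [q [C0 h]]] := H i; exists C; split => //; exists q.
have /choice[q Hq] i := (HC i).2.
have C0 i := (HC i).1.
apply/ClLipP; exists (\sum_i C i), (\max_i q i)%N; split=> [|x y].
  by rewrite sumr_ge0.
apply: le_trans (enorm_dist _ _) _; apply: le_trans (enorm_le_sum _) _.
rewrite big_ord1 !mulr_suml; apply: ler_sum => i _.
rewrite !mxE; apply: le_trans (Hq i x y) _.
rewrite ler_wpM2r ?enorm_ge0// ler_wpM2l// weight_le//.
exact: leq_bigmax.
Qed.

End ClLipTheory.

(** * The space L_ip *)

Section LipTheory.
Context {R : realType} {d : nat}.
Implicit Types (X Y : cpath R d -> R) (T : R).

(** Row extractions, block projections, scalings and matrix products are all additive with entries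
    controlled by the norm; additivity turns this growth bound into a Lipschitz bound. *)
Lemma ClLip_additive m n m' n' (f : 'M[R]_(m', n') -> 'M[R]_(m, n)) (K : R)
    (phi : 'M[R]_(m, n) -> R) : 0 <= K ->
  {morph f : x y / x - y} ->
  (forall x i j, `|f x i j| <= K * enorm x) ->
  ClLip phi -> ClLip (fun x => phi (f x)).
Proof.
move=> K0 fB fK; pose K' := \sum_(i < m) \sum_(j < n) K.
have h x : enorm (f x) <= K' * enorm x.
  apply: le_trans (enorm_le_sum _) _; rewrite mulr_suml; apply: ler_sum => i _.
  by rewrite mulr_suml; apply: ler_sum => j _; exact: fK.
apply: (@ClLip_lin _ _ _ _ _ f K') => //.
  by rewrite sumr_ge0// => i _; rewrite sumr_ge0.
by move=> x y; rewrite -fB.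
Qed.

Lemma ClLip_mulmx m n p (L : 'M[R]_(p, m)) (phi : 'M[R]_(p, n) -> R) :
  ClLip phi -> ClLip (fun x : 'M[R]_(m, n) => phi (L *m x)).
Proof.
apply: (@ClLip_additive _ _ _ _ _ (\sum_i \sum_j `|L i j|)).
- by rewrite sumr_ge0// => i _; rewrite sumr_ge0.
- by move=> x y; rewrite mulmxBr.
move=> x i j; rewrite mxE (bigD1 i)//= mulrDl.
rewrite -[leLHS]addr0; apply: lerD; last first.
  rewrite mulr_ge0 ?enorm_ge0// sumr_ge0// => k _.
  by rewrite sumr_ge0.
rewrite mulr_suml; apply: le_trans (ler_norm_sum _ _ _) _; apply: ler_sum => k _.
by rewrite normrM ler_wpM2l// normr_le_enorm.
Qed.

Lemma ClLip_scale m n (a : R) (phi : 'M[R]_(m, n) -> R) :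
  ClLip phi -> ClLip (fun x : 'M[R]_(m, n) => phi (a *: x)).
Proof.
apply: (@ClLip_additive _ _ _ _ _ `|a|) => //.
  by move=> x y; rewrite scalerBr.
by move=> x i j; rewrite mxE normrM ler_wpM2l// normr_le_enorm.
Qed.

(** The list of times is a parameter, so that several functionals can be stated to be cylindrical
    over the same list. *)
Definition Lip_on m (t : 'I_m -> R) X : Prop :=
  exists2 phi : 'M[R]_(m, d) -> R,
    ClLip phi & X = fun w : cpath R d => phi (\matrix_i w (t i)).

Definition tcat m1 m2 (t1 : 'I_m1 -> R) (t2 : 'I_m2 -> R) (i : 'I_(m1 + m2)) : R :=
  match fintype.split i with inl a => t1 a | inr b => t2 b end.

Lemma Lip_on_catl m1 m2 (t1 : 'I_m1 -> R) (t2 : 'I_m2 -> R) X :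
  Lip_on t1 X -> Lip_on (tcat t1 t2) X.
Proof.
move=> [phi hphi ->]; exists (fun x => phi (usubmx x)).
  apply: (@ClLip_additive _ _ _ _ _ 1) hphi => // [x y|x i j].
    by apply/matrixP => i j; rewrite !mxE.
  by rewrite mul1r mxE normr_le_enorm.
apply/funext => w; congr phi; apply/matrixP => i j.
by rewrite !mxE /tcat (unsplitK (inl i)).
Qed.

Lemma Lip_on_catr m1 m2 (t1 : 'I_m1 -> R) (t2 : 'I_m2 -> R) X :
  Lip_on t2 X -> Lip_on (tcat t1 t2) X.
Proof.
move=> [phi hphi ->]; exists (fun x => phi (dsubmx x)).
  apply: (@ClLip_additive _ _ _ _ _ 1) hphi => // [x y|x i j].
    by apply/matrixP => i j; rewrite !mxE.
  by rewrite mul1r mxE normr_le_enorm.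
apply/funext => w; congr phi; apply/matrixP => i j.
by rewrite !mxE /tcat (unsplitK (inr i)).
Qed.

Lemma Lip_uptoP T X : Lip_upto T X <-> exists (m : nat) (t : 'I_m -> R),
  [/\ (0 < m)%N, forall i, 0 <= t i <= T & Lip_on t X].
Proof.
split=> [[m [t [phi [? ? ? ?]]]]|[m [t [m0 tT [phi ? ?]]]]].
  by exists m, t; split => //; exists phi.
by exists m, t, phi.
Qed.

Lemma tcat_itv T m1 m2 (t1 : 'I_m1 -> R) (t2 : 'I_m2 -> R) :
  (forall i, 0 <= t1 i <= T) -> (forall i, 0 <= t2 i <= T) ->
  forall i, 0 <= tcat t1 t2 i <= T.
Proof. by move=> h1 h2 i; rewrite /tcat; case: fintype.split. Qed.

(** Two functionals depend on different times; over the concatenated list [tcat] both become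
    functions of one matrix, and stability of [ClLip] under [F] applies. *)
Lemma Lip_op2 T (F : R -> R -> R) X Y :
  (forall m (phi psi : 'M[R]_(m, d) -> R), ClLip phi -> ClLip psi ->
     ClLip (fun x => F (phi x) (psi x))) ->
  Lip_upto T X -> Lip_upto T Y -> Lip_upto T (fun w => F (X w) (Y w)).
Proof.
move=> HF /Lip_uptoP[m1 [t1 [m10 t1T hX]]] /Lip_uptoP[m2 [t2 [m20 t2T hY]]].
apply/Lip_uptoP; exists (m1 + m2)%N, (tcat t1 t2); split.
- by rewrite addn_gt0 m10.
- exact: tcat_itv.
have [phi hphi ->] := Lip_on_catl t2 hX.
have [psi hpsi ->] := Lip_on_catr t1 hY.
by exists (fun x => F (phi x) (psi x)) => //; exact: HF.
Qed.

Lemma LipD T X Y : Lip_upto T X -> Lip_upto T Y -> Lip_upto T (fun w => X w + Y w).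
Proof. by apply: Lip_op2 => m phi psi; exact: ClLipD. Qed.

Lemma LipM T X Y : Lip_upto T X -> Lip_upto T Y -> Lip_upto T (fun w => X w * Y w).
Proof. by apply: Lip_op2 => m phi psi; exact: ClLipM. Qed.

Lemma Lip_cst T (c : R) : 0 <= T -> Lip_upto T (fun _ : cpath R d => c).
Proof.
move=> T0; apply/Lip_uptoP; exists 1%N, (fun=> 0); split => //.
  by move=> _; rewrite lexx.
by exists (fun=> c) => //; exact: ClLip_cst.
Qed.

Lemma Lip_le S T X : S <= T -> Lip_upto S X -> Lip_upto T X.
Proof.
move=> ST /Lip_uptoP[m [t [m0 tS hX]]]; apply/Lip_uptoP; exists m, t; split => // i.
by have /andP[-> /le_trans->] := tS i.
Qed.

Lemma Lip_upto_ge0 T X : Lip_upto T X -> 0 <= T.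
Proof.
move=> [m [t [phi [m0 h _ _]]]]; have /andP[t0 tT] := h (Ordinal m0).
exact: le_trans tT.
Qed.

Lemma LipN T X : Lip_upto T X -> Lip_upto T (fun w => - X w).
Proof.
move=> HX.
have -> : (fun w => - X w) = (fun w => -1 * X w).
  by apply/funext => w; rewrite mulN1r.
by apply: LipM => //; apply: Lip_cst; exact: Lip_upto_ge0 HX.
Qed.

Lemma LipB T X Y : Lip_upto T X -> Lip_upto T Y -> Lip_upto T (fun w => X w - Y w).
Proof. by move=> hX hY; apply: LipD => //; exact: LipN. Qed.

Lemma Lip_abs T X : Lip_upto T X -> Lip_upto T (fun w => `|X w|).
Proof.
move=> /Lip_uptoP[m [t [m0 tT [phi hphi ->]]]]; apply/Lip_uptoP; exists m, t; split => //.
by exists (fun x => `|phi x|) => //; exact: ClLip_abs.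
Qed.

Lemma Lip_max T X Y : Lip_upto T X -> Lip_upto T Y ->
  Lip_upto T (fun w => Num.max (X w) (Y w)).
Proof.
apply: Lip_op2 => m phi psi; apply: ClLip_comp2 => a b c e.
have h1 := ler_norm (a - c); have h2 := ler_norm (b - e).
have h3 : - (a - c) <= `|a - c| by rewrite -normrN ler_norm.
have h4 : - (b - e) <= `|b - e| by rewrite -normrN ler_norm.
have h5 := normr_ge0 (a - c); have h6 := normr_ge0 (b - e).
rewrite ler_norml.
by case: (leP a b) => ?; case: (leP c e) => ?; apply/andP; split; lra.
Qed.

Lemma LipX T X n : Lip_upto T X -> Lip_upto T (fun w => X w ^+ n).
Proof.
move=> hX; elim: n => [|n IH].
  by under eq_fun do rewrite expr0; apply: Lip_cst; exact: Lip_upto_ge0 hX.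
by under eq_fun do rewrite exprS; exact: LipM.
Qed.

Lemma Lip_sum T (I : Type) (r : seq I) (F : I -> cpath R d -> R) : 0 <= T ->
  (forall i, Lip_upto T (F i)) -> Lip_upto T (fun w => \sum_(i <- r) F i w).
Proof.
move=> T0 H; elim: r => [|i r IH].
  by under eq_fun do rewrite big_nil; exact: Lip_cst.
by under eq_fun do rewrite big_cons; exact: LipD.
Qed.

Lemma Lip_path T t j : 0 <= t <= T -> Lip_upto T (fun w : cpath R d => w t ord0 j).
Proof.
move=> tT; apply/Lip_uptoP; exists 1%N, (fun=> t); split => //.
exists (fun x => x ord0 j); first exact: ClLip_entry.
by apply/funext => w; rewrite mxE.
Qed.

Lemma Lip_common T n (X : 'I_n -> cpath R d -> R) : 0 <= T ->
  (forall i, Lip_upto T (X i)) -> exists (m : nat) (t : 'I_m -> R),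
  [/\ (0 < m)%N, forall i, 0 <= t i <= T & forall i, Lip_on t (X i)].
Proof.
move=> T0 H.
suff /(_ n) : forall k, exists (m : nat) (t : 'I_m -> R),
  [/\ (0 < m)%N, forall i, 0 <= t i <= T & forall i : 'I_n, (i < k)%N -> Lip_on t (X i)].
  by move=> [m [t [? ? h]]]; exists m, t; split => // i; exact: h.
elim=> [|k [m [t [m0 tT h]]]].
  by exists 1%N, (fun=> 0); split => // _; rewrite lexx.
have [kn|nk] := ltnP k n; last first.
  exists m, t; split => // i _; apply: h; exact: leq_trans (ltn_ord i) nk.
have /Lip_uptoP[m' [t' [m'0 t'T h']]] := H (Ordinal kn).
exists (m + m')%N, (tcat t t'); split.
- by rewrite addn_gt0 m0.
- exact: tcat_itv.
move=> i; rewrite ltnS leq_eqVlt => /orP[/eqP ik|ik].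
  by apply: Lip_on_catr; have -> : i = Ordinal kn by exact/val_inj.
by apply: Lip_on_catl; exact: h.
Qed.

Definition vLip T n (V : cpath R d -> 'rV[R]_n) : Prop :=
  forall i, Lip_upto T (fun w => V w ord0 i).

(** The square root is not reached by the binary operations above, so all components are first
    written over a common list of times and the norm is then taken inside [ClLip]. *)
Lemma Lip_enorm T n (V : cpath R d -> 'rV[R]_n) : 0 <= T -> vLip T V ->
  Lip_upto T (fun w => enorm (V w)).
Proof.
move=> T0 hV; have [m [t [m0 tT h]]] := Lip_common T0 hV.
have /choice[phi hphi] i : exists phi : 'M[R]_(m, d) -> R,
    ClLip phi /\ (fun w => V w ord0 i) = fun w : cpath R d => phi (\matrix_i w (t i)).
  by have [phi ? ?] := h i; exists phi.
apply/Lip_uptoP; exists m, t; split => //.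
exists (fun x => enorm (\row_i phi i x)); first by apply: ClLip_enorm_comp => i; exact: (hphi i).1.
apply/funext => w; congr enorm; apply/rowP => i; rewrite mxE.
by have /(congr1 (@^~ w)) := (hphi i).2.
Qed.

Lemma vLipD T n (V W : cpath R d -> 'rV[R]_n) : vLip T V -> vLip T W ->
  vLip T (fun w => V w + W w).
Proof. by move=> hV hW i; under eq_fun do rewrite mxE; exact: LipD. Qed.

Lemma vLipN T n (V : cpath R d -> 'rV[R]_n) : vLip T V -> vLip T (fun w => - V w).
Proof. by move=> hV i; under eq_fun do rewrite mxE; exact: LipN. Qed.

Lemma vLipB T n (V W : cpath R d -> 'rV[R]_n) : vLip T V -> vLip T W ->
  vLip T (fun w => V w - W w).
Proof. by move=> hV hW; apply: vLipD => //; exact: vLipN. Qed.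

Lemma vLipZ T n (X : cpath R d -> R) (V : cpath R d -> 'rV[R]_n) :
  Lip_upto T X -> vLip T V -> vLip T (fun w => X w *: V w).
Proof. by move=> hX hV i; under eq_fun do rewrite mxE; exact: LipM. Qed.

Lemma vLip_cst T n (x : 'rV[R]_n) : 0 <= T -> vLip T (fun _ : cpath R d => x).
Proof. by move=> T0 i; exact: Lip_cst. Qed.

Lemma vLip_sum T n (I : Type) (r : seq I) (F : I -> cpath R d -> 'rV[R]_n) : 0 <= T ->
  (forall i, vLip T (F i)) -> vLip T (fun w => \sum_(i <- r) F i w).
Proof. by move=> T0 H j; under eq_fun do rewrite summxE; apply: Lip_sum => // i; exact: H. Qed.

Lemma vLip_path T t : 0 <= t <= T -> vLip T (fun w : cpath R d => w t).
Proof. by move=> tT j; exact: Lip_path. Qed.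

Lemma vLip_le S T n (V : cpath R d -> 'rV[R]_n) : S <= T -> vLip S V -> vLip T V.
Proof. by move=> ST hV i; exact: Lip_le (hV i). Qed.

End LipTheory.

(** Membership in L_ip by the shape of the functional. The atoms must be in the context at a fixed
    index, which explains the instantiated hypotheses stated before each call. *)
Ltac lip := repeat (first [ assumption | done
  | match goal with
    | |- Lip_upto _ (fun=> ?c) => apply: Lip_cst
    | |- Lip_upto _ (fun w => _ + _) => apply: LipD
    | |- Lip_upto _ (fun w => - _) => apply: LipN
    | |- Lip_upto _ (fun w => _ * _) => apply: LipM
    | |- Lip_upto _ (fun w => _ ^+ _) => apply: LipX
    | |- Lip_upto _ (fun w => `|_|) => apply: Lip_abs
    | |- Lip_upto _ (fun w => Num.max _ _) => apply: Lip_max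
    | |- Lip_upto _ (fun w => enorm _) => apply: Lip_enorm
    | |- Lip_upto _ (fun w => \sum_(_ <- _) _) => apply: Lip_sum => [|? /=]
    | |- vLip _ (fun=> _) => apply: vLip_cst
    | |- vLip _ (fun w => _ + _) => apply: vLipD
    | |- vLip _ (fun w => - _) => apply: vLipN
    | |- vLip _ (fun w => _ *: _) => apply: vLipZ
    | |- vLip _ (fun w => \sum_(_ <- _) _) => apply: vLip_sum => [|? /=]
    | |- vLip _ (fun w => _ _) => solve [eauto]
    | |- Lip_upto _ (fun w => _ ord0 _) => solve [eauto]
    end]).

(** * Increments of G-Brownian motion *)

(** The nodes are the given points together with 0 and s, sorted without repetition. For s = 0 a
    single node remains and the partition has no cell. *)
Lemma partition_exists (R : realType) (s : R) (l : seq R) : 0 <= s ->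
  (forall x, x \in l -> 0 <= x <= s) -> exists (M : nat) (u : nat -> R),
    Defs.partition M u s /\ forall x, x \in l -> exists2 j, (j <= M)%N & u j = x.
Proof.
move=> s0 hl; pose g := sort <=%R (undup (0 :: s :: l)).
have g_lt : sorted <%R g by rewrite sort_lt_sorted undup_uniq.
have g_mem x : (x \in g) = (x \in 0 :: s :: l) by rewrite mem_sort mem_undup.
have g_itv x : x \in g -> 0 <= x <= s.
  rewrite g_mem !inE => /orP[/eqP->|/orP[/eqP->|/hl//]]; first by rewrite lexx.
  by rewrite lexx andbT.
have g0 : 0 \in g by rewrite g_mem !inE eqxx.
have gs : s \in g by rewrite g_mem !inE eqxx orbT.
have szg : (0 < size g)%N by case: (g) g0.
have gltn i j : (i < j)%N -> (j < size g)%N -> g`_i < g`_j.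
  by move=> ij jg; rewrite (lt_sorted_ltn_nth _ g_lt) ?inE// (ltn_trans ij).
have idx x : x \in g -> (index x g <= (size g).-1)%N.
  by rewrite -index_mem => h; rewrite -ltnS prednK.
exists (size g).-1, (fun i => g`_i); split; last first.
  move=> x xl; have xg : x \in g by rewrite g_mem !inE xl !orbT.
  by exists (index x g); [exact: idx|rewrite nth_index].
split.
- apply/eqP; rewrite eq_le; apply/andP; split; last first.
    by have /andP[] := g_itv _ (mem_nth 0 szg).
  rewrite -[leRHS](nth_index 0 g0).
  case: (posnP (index 0 g)) => [->//|h]; apply/ltW/gltn => //.
  by rewrite index_mem.
- apply/eqP; rewrite eq_le; apply/andP; split.
    by have /andP[] := g_itv _ (mem_nth 0 (eq_leq (prednK szg))).
  rewrite -[leLHS](nth_index 0 gs).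
  have := idx _ gs; rewrite leq_eqVlt => /orP[/eqP->//|h].
  by apply/ltW/gltn => //; rewrite prednK.
- by move=> i ig; apply: gltn => //; rewrite -ltn_predRL.
Qed.

Lemma partition_le (R : realType) M (u : nat -> R) T i j : Defs.partition M u T ->
  (i <= j)%N -> (j <= M)%N -> u i <= u j.
Proof.
move=> [_ _ h]; elim: j => [|j IH]; first by rewrite leqn0 => /eqP->.
rewrite leq_eqVlt => /orP[/eqP->//|ij] jM.
by apply: le_trans (ltW (h j jM)); apply: IH => //; exact: ltnW.
Qed.

Lemma partition_itv (R : realType) M (u : nat -> R) T i : Defs.partition M u T ->
  (i <= M)%N -> 0 <= u i <= T.
Proof.
move=> p iM; have [u0 uM _] := p.
have := partition_le p (leq0n _) iM; have := partition_le p iM (leqnn M).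
by rewrite u0 uM => -> ->.
Qed.

(** * Elementary rules for a sublinear expectation on L_ip *)

Section Sublinear.
Context {R : realType} {d : nat} (Ehat : (cpath R d -> R) -> R).
Hypothesis HE : sublinear_expectation Lip Ehat.
Implicit Types (X Y Z : cpath R d -> R) (T : R).

Lemma Lip_upto_Lip T X : Lip_upto T X -> Lip X.
Proof.
move=> hX; exists (Num.bound T); apply: Lip_le hX.
have [T0|T0] := ltP T 0; first exact/ltW/(lt_le_trans T0).
exact/ltW/archi_boundP.
Qed.

Lemma E_le T X Y : Lip_upto T X -> Lip_upto T Y -> (forall w, X w <= Y w) ->
  Ehat X <= Ehat Y.
Proof.
by move=> /Lip_upto_Lip hX /Lip_upto_Lip hY; have [h _ _ _] := HE; exact: h.
Qed.

Lemma E_cst c : Ehat (fun=> c) = c.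
Proof. by have [_ h _ _] := HE. Qed.

Lemma E_D T X Y : Lip_upto T X -> Lip_upto T Y ->
  Ehat (fun w => X w + Y w) <= Ehat X + Ehat Y.
Proof.
by move=> /Lip_upto_Lip hX /Lip_upto_Lip hY; have [_ _ h _] := HE; exact: h.
Qed.

Lemma E_Z T a X : 0 <= a -> Lip_upto T X -> Ehat (fun w => a * X w) = a * Ehat X.
Proof. by move=> a0 /Lip_upto_Lip hX; have [_ _ _ h] := HE; exact: h. Qed.

Lemma E_ge0 T X : Lip_upto T X -> (forall w, 0 <= X w) -> 0 <= Ehat X.
Proof.
move=> hX X0; rewrite -(E_cst 0); apply: (@E_le T) => //.
by apply: Lip_cst; exact: Lip_upto_ge0 hX.
Qed.

Lemma E_le_D T X Y Z : Lip_upto T X -> Lip_upto T Y -> Lip_upto T Z ->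
  (forall w, X w <= Y w + Z w) -> Ehat X <= Ehat Y + Ehat Z.
Proof.
move=> hX hY hZ h; apply: le_trans (E_D hY hZ); apply: (@E_le T) => //.
exact: LipD.
Qed.

Lemma E_le_comb T X Y Z a b : 0 <= a -> 0 <= b ->
  Lip_upto T X -> Lip_upto T Y -> Lip_upto T Z ->
  (forall w, X w <= a * Y w + b * Z w) -> Ehat X <= a * Ehat Y + b * Ehat Z.
Proof.
move=> a0 b0 hX hY hZ h; have T0 := Lip_upto_ge0 hX.
rewrite -(E_Z a0 hY) -(E_Z b0 hZ).
by apply: (@E_le_D T) => //; apply: LipM => //; exact: Lip_cst.
Qed.

Lemma E_sum T n (F : 'I_n -> cpath R d -> R) : 0 <= T ->
  (forall i, Lip_upto T (F i)) ->
  Ehat (fun w => \sum_(i < n) F i w) <= \sum_(i < n) Ehat (F i).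
Proof.
move=> T0 hF; elim: n F hF => [|n IH] F hF.
  by under eq_fun do rewrite big_ord0; rewrite E_cst big_ord0.
under eq_fun do rewrite big_ord_recr; rewrite big_ord_recr/=.
apply: le_trans (lerD (IH _ _) (lexx _)) => //.
apply: (@E_D T) => //; exact: Lip_sum.
Qed.

End Sublinear.

Section Increments.
Context {R : realType} {d : nat} (Ehat : (cpath R d -> R) -> R).
Hypothesis HE : sublinear_expectation Lip Ehat.
Variables (O : Type) (H : set (O -> R)) (E : (O -> R) -> R).
Variables (xi : O -> 'rV[R]_d) (xis : nat -> O -> 'rV[R]_d).
Hypothesis HH : rv_space H.
Hypothesis HE0 : sublinear_expectation H E.
Hypothesis Hxi : G_normal H E xi.
Hypothesis Hxis : forall i, rvector H (xis i) /\ ident_distr E E (xis i) xi.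
Hypothesis Hind : forall i, independent_from E (xis i.+1)
                     (fun o => \matrix_(l < i.+1) xis l o).
Hypothesis Hinc : forall (m : nat) (t : nat -> R) (phi : 'M[R]_(m, d) -> R),
  t 0%N = 0 -> (forall i, (i < m)%N -> t i < t i.+1) -> ClLip phi ->
  Ehat (fun w => phi (\matrix_(i < m) (w (t i.+1) - w (t i)))) =
  E (fun o => phi (\matrix_(i < m) (Num.sqrt (t i.+1 - t i) *: xis i o))).

Let H_ClLip psi (X : O -> 'rV[R]_d) : rvector H X -> ClLip psi ->
  H (fun o => psi (X o)).
Proof. by move=> hX hpsi; have [_ _ _ h] := HH; apply: h => // i; exact: hX. Qed.

Lemma row_morphB m n i : {morph (fun x : 'M[R]_(m, n) => row i x) : x y / x - y}.
Proof. by move=> x y; apply/rowP => j; rewrite !mxE. Qed.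

Lemma E_incr s t (zeta : cpath R d -> R) (psi : 'rV[R]_d -> R) :
  0 <= s -> s < t -> Lip_upto s zeta -> (forall w, 0 <= zeta w) -> ClLip psi ->
  Ehat (fun w => zeta w * psi (w t - w s)) =
  Ehat (fun w => zeta w * E (fun o => psi (Num.sqrt (t - s) *: xi o))).
Proof.
move=> s0 st /Lip_uptoP[m [tt [m0 ts [phi hphi zetaE]]]] zeta0 hpsi.
set c := E _.
have cE i : E (fun o => psi (Num.sqrt (t - s) *: xis i o)) = c.
  exact: (Hxis i).2 (ClLip_scale (Num.sqrt (t - s)) hpsi).
(* Independence is given with respect to at least one earlier vector, so an empty past is treated
   apart: at s = 0 all paths vanish and [zeta] is a constant. *)
have [s_eq0|sn0] := eqVneq s 0.
  have zE w : zeta w = `|phi 0|.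
    rewrite -(ger0_norm (zeta0 w)) zetaE; congr (`|phi _|).
    apply/matrixP => i j; rewrite mxE cpath_start ?mxE//.
    by rewrite -s_eq0; have /andP[] := ts i.
  have -> : zeta = (fun=> `|phi 0|) by apply/funext => w; exact: zE.
  rewrite (E_cst HE) (E_Z HE (T := t))//; last first.
    have t0 : 0 <= t by apply: le_trans (ltW st).
    apply/Lip_uptoP; exists 2%N, (fun i : 'I_2 => if i == ord0 then s else t); split => //.
      by move=> i; case: ifP; rewrite ?s0 ?(ltW st) ?t0 ?lexx.
    exists (fun x : 'M[R]_(2, d) => psi (row ord_max x - row ord0 x)).
      apply: (@ClLip_additive _ _ _ _ _ (fun x : 'M[R]_(2, d) => row ord_max x - row ord0 x) 2) => //.
        by move=> x y; apply/rowP => j; rewrite !mxE; ring.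
      move=> x i j; rewrite !mxE; apply: le_trans (ler_normB _ _) _.
      have := normr_le_enorm x ord_max j; have := normr_le_enorm x ord0 j; lra.
    by apply/funext => w; congr psi; apply/rowP => j; rewrite !mxE.
  congr (_ * _).
  pose v1 := fun i : nat => if i is i'.+1 then t + i'%:R else s.
  have := @Hinc 1 v1 (fun x => psi (row ord0 x)) s_eq0 _ _.
  have -> : (fun w : cpath R d => psi (row ord0 (\matrix_(i < 1) (w (v1 i.+1) - w (v1 i)))))
     = (fun w : cpath R d => psi (w t - w s)).
    apply/funext => w; congr psi; apply/rowP => j; rewrite !mxE /v1/= addr0//.
  move=> ->.
  - rewrite -(cE 0%N); congr E; apply/funext => o; congr psi.
    by apply/rowP => j; rewrite !mxE /v1/= addr0.
  - by case=> //= _; rewrite addr0.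
  - apply: (@ClLip_additive _ _ _ _ _ _ 1) => //; first exact: row_morphB.
    by move=> x i j; rewrite mul1r mxE; exact: normr_le_enorm.
have [M [u [pu hu]]] := @partition_exists _ s [seq tt i | i <- enum 'I_m] s0
  (fun x => ltac:(by move=> /mapP[i _ ->])).
have [u0 uM ult] := pu.
case: M => [|M'] in pu hu uM ult *; first by move: sn0; rewrite -uM u0 eqxx.
set M := M'.+1 in pu hu uM ult *.
have /choice[f hf] i : exists j, (j <= M)%N /\ u j = tt i.
  by have [|j ? ?] := hu (tt i); [apply: map_f; rewrite mem_enum|exists j].
(* Row i adds the first [f i] increments, which gives back the path at time [tt i] because it starts
   at 0. *)
pose L : 'M[R]_(m, M) := \matrix_(i, l) (l < f i)%N%:R.
pose incr w : 'M[R]_(M, d) := \matrix_(l < M) ((w : cpath R d) (u l.+1) - w (u l)).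
(* The absolute value changes nothing along paths, where [zeta] is nonnegative, but makes the
   function nonnegative at every matrix, as needed under [E]. *)
pose phi' (y : 'M[R]_(M, d)) := `|phi (L *m y)|.
have hphi' : ClLip phi' by apply/ClLip_abs/ClLip_mulmx.
have zE w : zeta w = phi' (incr w).
  rewrite -(ger0_norm (zeta0 w)) zetaE; congr (`|phi _|).
  apply/matrixP => i j; rewrite !mxE.
  under eq_bigr do rewrite !mxE.
  have [fM <-] := hf i.
  under eq_bigr do rewrite mulr_natl mulrb.
  rewrite -big_mkcond/= -(big_ord_widen _ (fun l => w (u l.+1) ord0 j - w (u l) ord0 j) fM).
  rewrite -(big_mkord xpredT (fun l => w (u l.+1) ord0 j - w (u l) ord0 j)).
  by rewrite telescope_sumr// u0 (cpath_start w (lexx 0)) mxE subr0.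
pose D : 'M[R]_M := diag_mx (\row_l Num.sqrt (u l.+1 - u l)).
have DE o : \matrix_(i < M) (Num.sqrt (u i.+1 - u i) *: xis i o)
    = D *m \matrix_(l < M) xis l o.
  by apply/matrixP => i j; rewrite mul_diag_mx !mxE.
have -> : Ehat (fun w => zeta w * c) = E (fun o => phi' (D *m \matrix_(l < M) xis l o) * c).
  under eq_fun do rewrite zE.
  rewrite (@Hinc M u (fun y => phi' y * c))//; last by apply: ClLipM => //; exact: ClLip_cst.
  by congr E; apply/funext => o; rewrite DE.
(* The grid of [0, s] followed by t, which is the value at index M + 1; what comes after is
   irrelevant. *)
pose v i := if (i <= M)%N then u i else t + (i - M.+1)%:R.
pose W (x : 'M[R]_(M.+1, d)) : 'M[R]_(M, d) := \matrix_(l, j) x (widen_ord (leqnSn M) l) j.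
have := @Hinc M.+1 v (fun x => phi' (W x) * psi (row ord_max x)).
have -> : (fun w : cpath R d => phi' (W (\matrix_(i < M.+1) (w (v i.+1) - w (v i)))) *
     psi (row ord_max (\matrix_(i < M.+1) (w (v i.+1) - w (v i)))))
   = (fun w : cpath R d => zeta w * psi (w t - w s)).
  apply/funext => w; rewrite zE; congr (phi' _ * psi _).
    by apply/matrixP => i j; rewrite !mxE /v /= ltn_ord ltnW.
  by apply/rowP => j; rewrite !mxE /v /= ltnn leqnn subnn addr0 uM.
move=> ->; first last.
- apply: ClLipM.
    apply: (@ClLip_additive _ _ _ _ _ W 1) => //.
      by move=> x y; apply/matrixP => i j; rewrite !mxE.
    by move=> x i j; rewrite mul1r mxE; exact: normr_le_enorm.
  apply: (@ClLip_additive _ _ _ _ _ _ 1) => //; first exact: row_morphB.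
  by move=> x i j; rewrite mul1r mxE; exact: normr_le_enorm.
- move=> i; rewrite ltnS leq_eqVlt => /orP[/eqP->|iM].
    by rewrite /v ltnn leqnn uM subnn addr0.
  by rewrite /v iM ltnW//; exact: ult.
- by rewrite /v leq0n.
pose Psi (z : 'M[R]_(M + 1, d)) :=
  phi' (D *m usubmx z) * psi (Num.sqrt (t - s) *: dsubmx z).
have hPsi : ClLip Psi.
  apply: ClLipM.
    apply: (@ClLip_additive _ _ _ _ _ _ 1 (fun x => phi' (D *m x))) => //.
    - by move=> x y; apply/matrixP => i j; rewrite !mxE.
    - by move=> x i j; rewrite mul1r mxE; exact: normr_le_enorm.
    - exact: ClLip_mulmx.
  apply: (@ClLip_additive _ _ _ _ _ _ 1 (fun x => psi (Num.sqrt (t - s) *: x))) => //.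
  - by move=> x y; apply/matrixP => i j; rewrite !mxE.
  - by move=> x i j; rewrite mul1r mxE; exact: normr_le_enorm.
  - exact: ClLip_scale.
transitivity (E (fun o => Psi (col_mx (\matrix_(l < M) xis l o) (xis M o)))).
  congr E; apply/funext => o; rewrite /Psi col_mxKu col_mxKd; congr (phi' _ * psi _).
    by apply/matrixP => i j; rewrite mul_diag_mx !mxE /v /= ltn_ord ltnW.
  by apply/rowP => j; rewrite !mxE /v /= ltnn leqnn subnn addr0 uM.
rewrite (Hind hPsi); congr E; apply/funext => o.
rewrite /Psi; under eq_fun do rewrite col_mxKu col_mxKd.
have [_ _ _ EZ] := HE0; rewrite EZ ?cE//.
  exact: normr_ge0.
exact: (@H_ClLip (fun x => psi (Num.sqrt (t - s) *: x)) (xis M) (Hxis M).1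
  (ClLip_scale _ hpsi)).
Qed.

End Increments.

(** * The mean of a G-normal vector *)

Section GNormal.
Context {R : realType} {d : nat}.
Variables (O : Type) (H : set (O -> R)) (E : (O -> R) -> R).
Variable xi : O -> 'rV[R]_d.
Hypothesis HH : rv_space H.
Hypothesis HE0 : sublinear_expectation H E.

(** Both inequalities are subadditivity, the second one after writing X as (X + c) - c. *)
Lemma sublinear_addc X c : H X -> E (fun o => X o + c) = E X + c.
Proof.
have [h1 h2 _ _] := HH; have [_ Ec ED _] := HE0 => hX.
have hc a Y : H Y -> H (fun o => Y o + a).
  move=> hY; have := h2 1 Y (fun=> a) hY (h1 a).
  by under eq_fun do rewrite mul1r.
apply/eqP; rewrite eq_le -{2}(Ec c) ED//=.
rewrite -lerBrDr -[leRHS]/(E (fun o => X o + c) + - c) -(Ec (- c)).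
apply: le_trans (ED _ _ (hc _ _ hX) (h1 _)).
by under [in leRHS]eq_fun do rewrite addrK.
Qed.

(** Let e be the value. Independence gives 2 e for the sum of two copies, G-normality with both
    weights 1 gives sqrt 2 times e, so e = 0. As [a] may have either sign, the upper and the lower
    mean both vanish. *)
Lemma G_normal_mean0 j a : G_normal H E xi -> E (fun o => a * xi o ord0 j) = 0.
Proof.
move=> [hxi [xi' [hxi' id ind nrm]]].
have [h1 h2 _ h4] := HH; have [_ Ec ED EZ] := HE0.
have hlin (X : O -> 'rV[R]_d) (c : R) : rvector H X -> H (fun o => c * X o ord0 j).
  move=> hX; have := h2 c _ _ (hX ord0 j) (h1 0).
  by under eq_fun do rewrite addr0.
set e := E _.
have hphi0 (b : R) : ClLip (fun x : 'rV[R]_d => b * x ord0 j).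
  by apply: ClLipM; [exact: ClLip_cst|exact: ClLip_entry].
have id_e : E (fun o => a * xi' o ord0 j) = e by exact: (id (fun x => a * x ord0 j) (hphi0 a)).
have h2e : E (fun o => a * xi o ord0 j + a * xi' o ord0 j) = e + e.
  pose phi (z : 'M[R]_(1 + 1, d)) := a * usubmx z ord0 j + a * dsubmx z ord0 j.
  have hphi : ClLip phi.
    apply: ClLipD.
      apply: (@ClLip_additive _ _ _ _ _ (fun z => usubmx z) 1 (fun x => a * x ord0 j)) => //.
        by move=> x y; apply/matrixP => i k; rewrite !mxE.
      by move=> x i k; rewrite mul1r mxE; exact: normr_le_enorm.
    apply: (@ClLip_additive _ _ _ _ _ (fun z => dsubmx z) 1 (fun x => a * x ord0 j)) => //.
      by move=> x y; apply/matrixP => i k; rewrite !mxE.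
    by move=> x i k; rewrite mul1r mxE; exact: normr_le_enorm.
  have := ind phi hphi; rewrite /phi.
  under eq_fun do rewrite col_mxKu col_mxKd.
  move=> ->.
  under eq_fun => o.
    under eq_fun do rewrite col_mxKu col_mxKd addrC.
    rewrite (sublinear_addc _ (hlin _ _ hxi')) id_e addrC.
    over.
  by rewrite (sublinear_addc _ (hlin _ _ hxi)).
have := nrm 1 1 ler01 ler01 _ (hphi0 a).
under eq_fun do rewrite !scale1r mxE mulrDr.
rewrite h2e; under eq_fun do rewrite mxE mulrCA.
rewrite EZ ?sqrtr_ge0//; last exact: hlin.
rewrite expr1n -/e => he.
have : e * (2 - Num.sqrt (1 + 1)) = 0 by rewrite mulrBr -[X in _ - X]mulrC -he; ring.
move/eqP; rewrite mulf_eq0 => /orP[/eqP//|/eqP h].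
exfalso; have : Num.sqrt (1 + 1 : R) ^+ 2 = 1 + 1 by rewrite sqr_sqrtr.
have -> : Num.sqrt (1 + 1 : R) = 2 by lra.
by lra.
Qed.

End GNormal.

(** * Conditional moments of Brownian increments *)

Section GIncrements.
Context {R : realType} {d : nat}.

Lemma ClLip_sqr_enorm n (b : R) : ClLip (fun x : 'rV[R]_n => enorm x ^+ 2 + b).
Proof.
apply: ClLipD; last exact: ClLip_cst.
have -> : (fun x : 'rV[R]_n => enorm x ^+ 2) = (fun x => \sum_i \sum_j x i j * x i j).
  by apply/funext => x; rewrite enorm_sqr; apply: eq_bigr => i _; apply: eq_bigr => j _; rewrite expr2.
apply: ClLip_sum => i; apply: ClLip_sum => j.
by apply: ClLipM; exact: ClLip_entry.
Qed.

Lemma ClLip_sqr m n (phi : 'M[R]_(m, n) -> R) : ClLip phi -> ClLip (fun x => phi x ^+ 2).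
Proof. by move=> h; under eq_fun do rewrite expr2; exact: ClLipM. Qed.

(** [s2] and [kap] will be the upper second moment of |xi| and the upper second moment of |xi|^2 -
    [s2]. In the first bound [zeta] has any sign, since the mean carries no uncertainty; in the next
    two it is nonnegative, since |xi|^2 is controlled from above only. *)
Definition increments_spec (Ehat : (cpath R d -> R) -> R) (s2 kap : R) : Prop :=
  [/\ 0 <= s2 /\ 0 <= kap,
    forall s t zeta j, 0 <= s -> s < t -> Lip_upto s zeta ->
      Ehat (fun w => zeta w * (w t ord0 j - w s ord0 j)) <= 0,
    forall s t zeta, 0 <= s -> s < t -> Lip_upto s zeta -> (forall w, 0 <= zeta w) ->
      Ehat (fun w => zeta w * enorm (w t - w s) ^+ 2) <= s2 * (t - s) * Ehat zeta,
    forall s t zeta, 0 <= s -> s < t -> Lip_upto s zeta -> (forall w, 0 <= zeta w) ->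
      Ehat (fun w => zeta w * (enorm (w t - w s) ^+ 2 - s2 * (t - s))) <= 0 &
    forall s t, 0 <= s -> s < t ->
      Ehat (fun w => (enorm (w t - w s) ^+ 2 - s2 * (t - s)) ^+ 2) <= kap * (t - s) ^+ 2].

Lemma G_increments (Ehat : (cpath R d -> R) -> R) : G_expectation Ehat ->
  exists s2 kap, increments_spec Ehat s2 kap.
Proof.
move=> [HE [Om [H [E [xi [xis [HH HE0 Hxi Hxis [Hind Hinc]]]]]]]].
have incr := E_incr HE HH HE0 Hxis Hind Hinc.
have [Emon Ec ED EZ] := HE0.
have hxi psi : ClLip psi -> H (fun o => psi (xi o)).
  by move=> hpsi; have [_ _ _ h] := HH; apply: h => // i; exact: Hxi.1.
pose s2 := E (fun o => enorm (xi o) ^+ 2).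
pose kap := E (fun o => (enorm (xi o) ^+ 2 - s2) ^+ 2).
have cl2 : ClLip (fun x : 'rV[R]_d => enorm x ^+ 2).
  by have := @ClLip_sqr_enorm d 0; under eq_fun do rewrite addr0.
have sZ a x : 0 <= a -> enorm (Num.sqrt a *: (x : 'rV[R]_d)) ^+ 2 = a * enorm x ^+ 2.
  by move=> a0; rewrite enormZ exprMn ger0_norm ?sqrtr_ge0// sqr_sqrtr.
have [h1 _ _ _] := HH.
exists s2, kap; split.
- split; rewrite -(Ec 0); apply: Emon => //.
  + exact: (hxi _ cl2).
  + by move=> o; exact: sqr_ge0.
  + apply: (hxi (fun x => (enorm x ^+ 2 - s2) ^+ 2)).
    exact/ClLip_sqr/ClLip_sqr_enorm.
  + by move=> o; exact: sqr_ge0.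
- move=> s t zeta j s0 st hz.
  have t0 : 0 <= t by exact: le_trans (ltW st).
  have hz' := Lip_le (ltW st) hz.
  have hwt : Lip_upto t (fun w : cpath R d => w t ord0 j) by apply: Lip_path; rewrite t0 lexx.
  have hws : Lip_upto t (fun w : cpath R d => w s ord0 j) by apply: Lip_path; rewrite s0 ltW.
  have key (a : R) (z : cpath R d -> R) : Lip_upto s z -> (forall w, 0 <= z w) ->
      Ehat (fun w => z w * (a * (w t ord0 j - w s ord0 j))) = 0.
    move=> hzz z0.
    have hcl : ClLip (fun x : 'rV[R]_d => a * x ord0 j).
      by apply: ClLipM; [exact: ClLip_cst|exact: ClLip_entry].
    have e1 : Ehat (fun w => z w * (a * (w t - w s) ord0 j)) =
      Ehat (fun w => z w * E (fun o => a * (Num.sqrt (t - s) *: xi o) ord0 j)).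
      exact: (incr s t z _ s0 st hzz z0 hcl).
    transitivity (Ehat (fun w => z w * (a * (w t - w s) ord0 j))).
      by congr Ehat; apply/funext => w; rewrite !mxE.
    rewrite {}e1.
    under eq_fun => w.
      under eq_fun do rewrite mxE mulrA.
      rewrite (G_normal_mean0 HH HE0 _ _ Hxi) mulr0.
      over.
    by rewrite (E_cst HE).
  (* Split into positive and negative parts, with the sign of the latter moved to the increment; by
     [key] each of the two products has expectation 0. *)
  apply: (@le_trans _ _ (Ehat (fun w => Num.max (zeta w) 0 * (1 * (w t ord0 j - w s ord0 j)))
    + Ehat (fun w => Num.max (- zeta w) 0 * (-1 * (w t ord0 j - w s ord0 j))))).
    apply: (E_le_D HE (T := t)); [lip|lip|lip|] => w.
    rewrite le_eqVlt; apply/orP; left; apply/eqP.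
    case: (leP (zeta w) 0) => h; case: (leP (- zeta w) 0) => h'; try ring.
      by have -> : zeta w = 0; [lra|ring].
    by exfalso; lra.
  rewrite !key ?addr0//; [lip|by move=> w; rewrite le_max lexx orbT|lip|
    by move=> w; rewrite le_max lexx orbT].
- move=> s t z s0 st hz z0.
  rewrite (incr s t z _ s0 st hz z0 cl2).
  under eq_fun => w.
    under eq_fun do rewrite sZ ?subr_ge0 ?(ltW st)//.
    rewrite EZ ?subr_ge0 ?(ltW st)//; last exact: (hxi _ cl2).
    rewrite -/s2 mulrC [(t - s) * _]mulrC.
    over.
  rewrite (E_Z HE _ hz)//; rewrite mulr_ge0 ?subr_ge0 ?(ltW st)//.
  by rewrite -(Ec 0); apply: Emon => //; [exact: (hxi _ cl2)|move=> o; exact: sqr_ge0].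
- move=> s t z s0 st hz z0.
  have := incr s t z _ s0 st hz z0 (@ClLip_sqr_enorm d (- (s2 * (t - s)))).
  move=> ->.
  under eq_fun => w.
    under eq_fun do rewrite sZ ?subr_ge0 ?(ltW st)//.
    rewrite (sublinear_addc HH HE0); last first.
      by apply: (hxi (fun x => (t - s) * enorm x ^+ 2)); apply: ClLipM => //; exact: ClLip_cst.
    rewrite EZ ?subr_ge0 ?(ltW st)//; last exact: (hxi _ cl2).
    rewrite -/s2 [(t - s) * s2]mulrC subrr mulr0.
    over.
  by rewrite (E_cst HE).
- move=> s t s0 st.
  have e1 := incr s t (fun=> 1) _ s0 st (Lip_cst _ s0) (fun=> ler01)
     (ClLip_sqr (@ClLip_sqr_enorm d (- (s2 * (t - s))))).
  have -> : Ehat (fun w => (enorm (w t - w s) ^+ 2 - s2 * (t - s)) ^+ 2) =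
    Ehat (fun w => 1 * (enorm (w t - w s) ^+ 2 + - (s2 * (t - s))) ^+ 2).
    by congr Ehat; apply/funext => w; rewrite mul1r.
  rewrite {}e1.
  under eq_fun => w.
    under eq_fun => o.
      rewrite sZ ?subr_ge0 ?(ltW st)//.
      have -> : ((t - s) * enorm (xi o) ^+ 2 - s2 * (t - s)) ^+ 2
        = (t - s) ^+ 2 * (enorm (xi o) ^+ 2 - s2) ^+ 2 by ring.
      over.
    rewrite EZ ?sqr_ge0//; last first.
      by apply: (hxi (fun x => (enorm x ^+ 2 - s2) ^+ 2)); exact/ClLip_sqr/ClLip_sqr_enorm.
    rewrite -/kap mul1r mulrC.
    over.
  by rewrite (E_cst HE).
Qed.

End GIncrements.

(** * The completions L_G^p *)

Section LGTheory.
Context {R : realType} {d : nat} (Ehat : (cpath R d -> R) -> R).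
Hypothesis HE : sublinear_expectation Lip Ehat.
Variables (T : R) (T0 : 0 <= T).
Implicit Types (X Y Z : cpath R d -> R).

Fixpoint comb_ok (s : seq (R * (cpath R d -> R))) : Prop :=
  if s is x :: s' then (0 <= x.1 /\ Lip_upto T x.2) /\ comb_ok s' else True.

Lemma E_comb X s : Lip_upto T X -> comb_ok s ->
  (forall w, X w <= \sum_(x <- s) x.1 * x.2 w) ->
  Ehat X <= \sum_(x <- s) x.1 * Ehat x.2.
Proof.
have lips s' : comb_ok s' -> Lip_upto T (fun w => \sum_(x <- s') x.1 * x.2 w).
  elim: s' => [_|x s' IH /= [[_ hx]] /IH hs'].
    by under eq_fun do rewrite big_nil; exact: Lip_cst.
  under eq_fun do rewrite big_cons; apply: LipD => //.
  by apply: LipM => //; exact: Lip_cst.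
move=> hX hs h; apply: (@le_trans _ _ (Ehat (fun w => \sum_(x <- s) x.1 * x.2 w))).
  by apply: (E_le HE hX) => //; exact: lips.
elim: s hs {h} => [_|x s IH /= [[x0 hx] hs]].
  by under eq_fun do rewrite big_nil; rewrite E_cst// big_nil.
under eq_fun do rewrite big_cons; rewrite big_cons.
have hx' : Lip_upto T (fun w => x.1 * x.2 w) by apply: LipM => //; exact: Lip_cst.
apply: le_trans (E_D HE hx' (lips _ hs)) _.
by rewrite (E_Z HE x0 hx) lerD2l; exact: IH.
Qed.

Lemma near2P (P : nat -> nat -> Prop) : (\forall k & l \near \oo, P k l) <->
  exists N, forall k l, (N <= k)%N -> (N <= l)%N -> P k l.
Proof.
split.
  move=> [[A B] /= [[N1 _ h1] [N2 _ h2]] h]; exists (maxn N1 N2) => k l.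
  rewrite !geq_max => /andP[k1 k2] /andP[l1 l2].
  by apply: (h (k, l)); split; [exact: h1|exact: h2].
move=> [N h]; exists ([set k | (N <= k)%N], [set k | (N <= k)%N]) => /=.
  by split; exists N.
by move=> [k l] [/= hk hl]; exact: h.
Qed.

Lemma cvgn_cauchy (u : R^nat) : (forall e, 0 < e -> exists N, forall k l,
    (N <= k)%N -> (N <= l)%N -> u k <= u l + e) -> cvgn u.
Proof.
move=> h; apply: cauchy_cvg; apply/cauchyP => e e0.
have [N hN] := h (e / 2) (divr_gt0 e0 (ltr0n R 2)); exists (u N).
exists N => // k /= Nk; rewrite /ball/= ltr_norml.
by have := hN _ _ Nk (leqnn N); have := hN _ _ (leqnn N) Nk; lra.
Qed.

Definition Lv n (V : vseq R d n) := forall k, vLip T (V k).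

Lemma LG_Lv p n (V : vseq R d n) : LG Ehat p T V -> Lv V.
Proof. by move=> [h _] k i. Qed.

Lemma LG_cauchy p n (V : vseq R d n) e : LG Ehat p T V -> 0 < e ->
  exists N, forall k l, (N <= k)%N -> (N <= l)%N ->
    Ehat (fun w => enorm (V k w - V l w) ^+ p) < e.
Proof. by move=> [_ h] /h/near2P. Qed.

Lemma E1_le2 n (V : cpath R d -> 'rV[R]_n) (theta : R) : 0 < theta -> vLip T V ->
  Ehat (fun w => enorm (V w)) <= theta + theta^-1 * Ehat (fun w => enorm (V w) ^+ 2).
Proof.
move=> th0 hV.
have := @E_comb (fun w => enorm (V w)) [:: (theta, fun=> 1); (theta^-1, fun w => enorm (V w) ^+ 2)].
rewrite !big_cons !big_nil/= addr0 E_cst// mulr1; apply.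
- lip.
- by repeat split; rewrite ?invr_ge0 ?(ltW th0)//; lip.
by move=> w; rewrite !big_cons big_nil/= addr0 mulr1; exact: young1.
Qed.

Lemma enorm2_theta n (x y : 'rV[R]_n) (theta : R) : 0 < theta ->
  enorm x ^+ 2 <= (1 + theta) * enorm y ^+ 2 + (1 + theta^-1) * enorm (x - y) ^+ 2.
Proof.
move=> th0; apply: (@le_trans _ _ ((enorm y + enorm (x - y)) ^+ 2)).
  by rewrite ler_sqr ?nnegrE ?addr_ge0 ?enorm_ge0// enorm_subl.
set a := enorm y; set b := enorm (x - y).
rewrite -subr_ge0; have -> : (1 + theta) * a ^+ 2 + (1 + theta^-1) * b ^+ 2 - (a + b) ^+ 2
  = theta^-1 * (theta * a - b) ^+ 2 by field; rewrite gt_eqF.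
by rewrite mulr_ge0 ?sqr_ge0// invr_ge0 ltW.
Qed.

Lemma E2_theta n (V W : cpath R d -> 'rV[R]_n) (theta : R) : 0 < theta -> vLip T V -> vLip T W ->
  Ehat (fun w => enorm (V w) ^+ 2) <= (1 + theta) * Ehat (fun w => enorm (W w) ^+ 2)
    + (1 + theta^-1) * Ehat (fun w => enorm (V w - W w) ^+ 2).
Proof.
move=> th0 hV hW; have th0' := ltW th0.
apply: (E_le_comb HE (T := T)); [by rewrite addr_ge0|by rewrite addr_ge0// invr_ge0|lip|lip|lip|].
by move=> w; exact: enorm2_theta.
Qed.

Lemma E2_bound n (V : vseq R d n) : LG Ehat 2 T V ->
  exists B, 0 <= B /\ \forall k \near \oo, Ehat (fun w => enorm (V k w) ^+ 2) <= B.
Proof.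
move=> hV; have [N hN] := LG_cauchy hV ltr01; have hL := LG_Lv hV.
exists (2 * Ehat (fun w => enorm (V N w) ^+ 2) + 2); split.
  by rewrite addr_ge0// mulr_ge0//; apply: (E_ge0 HE (T := T)); [lip|move=> w; exact: sqr_ge0].
exists N => // k /= Nk.
have := E2_theta ltr01 (hL k) (hL N); have := hN _ _ Nk (leqnn N).
rewrite invr1; lra.
Qed.

(** Makes the limit in [EG] a genuine one. For p = 1 this is the triangle inequality; for p = 2 the
    square is expanded with a weight theta that is small against a bound for the second moments. *)
Lemma LG_is_cvg p n (V : vseq R d n) : (p == 1)%N || (p == 2)%N -> LG Ehat p T V ->
  cvgn (fun k => Ehat (fun w => enorm (V k w) ^+ p)).
Proof.
move=> p12 hV; have hL := LG_Lv hV; apply: cvgn_cauchy => e e0.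
case/orP: p12 => /eqP p12; subst p.
  have [N hN] := LG_cauchy hV e0; exists N => k l Nk Nl.
  have := hN _ _ Nk Nl => hkl.
  apply: le_trans (_ : _ <= Ehat (fun w => enorm (V l w)) + Ehat (fun w => enorm (V k w - V l w))) _.
    apply: (E_le_D HE (T := T)); [lip|lip|lip|] => w; rewrite expr1; exact: enorm_subl.
  by rewrite lerD2l ltW.
have [B [B0 [N1 _ hB]]] := E2_bound hV.
pose theta := e / 2 / (B + 1).
have th0 : 0 < theta by rewrite !divr_gt0//; lra.
pose e' := e / 2 / (1 + theta^-1).
have thi0 : 0 < theta^-1 by rewrite invr_gt0.
have e'0 : 0 < e' by rewrite !divr_gt0// addr_gt0.
have [N hN] := LG_cauchy hV e'0; exists (maxn N1 N) => k l.
rewrite !geq_max => /andP[N1k Nk] /andP[N1l Nl].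
apply: le_trans (E2_theta th0 (hL k) (hL l)) _.
have h1 := hB _ N1l; have h2 := ltW (hN _ _ Nk Nl).
set x := Ehat _ in h1 *; set y := Ehat _ in h2 *.
have h3 : theta * x <= e / 2.
  apply: (@le_trans _ _ (theta * (B + 1))); first by rewrite ler_wpM2l ?(ltW th0)//; lra.
  by rewrite /theta divfK ?gt_eqF//; lra.
have h4 : (1 + theta^-1) * y <= e / 2.
  apply: (@le_trans _ _ ((1 + theta^-1) * e')); first by rewrite ler_wpM2l// addr_ge0// ltW.
  by rewrite /e' mulrC divfK// gt_eqF// addr_gt0.
lra.
Qed.

Lemma EG_lt_near p n (V : vseq R d n) c : (p == 1)%N || (p == 2)%N -> LG Ehat p T V ->
  EG Ehat (fun k w => enorm (V k w) ^+ p) < c ->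
  \forall k \near \oo, Ehat (fun w => enorm (V k w) ^+ p) < c.
Proof. by move=> p12 hV h; exact: (cvgr_lt _ (LG_is_cvg p12 hV)). Qed.

Lemma EG_gt_near p n (V : vseq R d n) c : (p == 1)%N || (p == 2)%N -> LG Ehat p T V ->
  c < EG Ehat (fun k w => enorm (V k w) ^+ p) ->
  \forall k \near \oo, c < Ehat (fun w => enorm (V k w) ^+ p).
Proof. by move=> p12 hV h; exact: (cvgr_gt _ (LG_is_cvg p12 hV)). Qed.

Lemma EG_le_near p n (V : vseq R d n) c : (p == 1)%N || (p == 2)%N -> LG Ehat p T V ->
  (\forall k \near \oo, Ehat (fun w => enorm (V k w) ^+ p) <= c) ->
  EG Ehat (fun k w => enorm (V k w) ^+ p) <= c.
Proof. by move=> p12 hV h; apply: limr_le => //; exact: LG_is_cvg. Qed.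

Lemma EG_ge0 p n (V : vseq R d n) : (p == 1)%N || (p == 2)%N -> LG Ehat p T V ->
  0 <= EG Ehat (fun k w => enorm (V k w) ^+ p).
Proof.
move=> p12 hV; apply: limr_ge; first exact: LG_is_cvg.
have hL := LG_Lv hV; apply: nearW => k.
by apply: (E_ge0 HE (T := T)); [lip|move=> w; rewrite exprn_ge0// enorm_ge0].
Qed.

(** The exponents are independent so that first powers can be bounded by squares, as in [pdist_le2];
    the constant [a] is the free term of Young's inequality. *)
Lemma EG_le_comb p q r n1 n2 n3 (V : vseq R d n1) (W : vseq R d n2) (U : vseq R d n3) a b c :
  (p == 1)%N || (p == 2)%N -> (q == 1)%N || (q == 2)%N -> (r == 1)%N || (r == 2)%N ->
  LG Ehat p T V -> LG Ehat q T W -> LG Ehat r T U -> 0 <= a -> 0 <= b -> 0 <= c ->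
  (forall k w, enorm (V k w) ^+ p <= a + b * enorm (W k w) ^+ q + c * enorm (U k w) ^+ r) ->
  EG Ehat (fun k w => enorm (V k w) ^+ p) <=
    a + b * EG Ehat (fun k w => enorm (W k w) ^+ q) + c * EG Ehat (fun k w => enorm (U k w) ^+ r).
Proof.
move=> hp hq hr hV hW hU a0 b0 c0 h.
have cV := LG_is_cvg hp hV; have cW := LG_is_cvg hq hW; have cU := LG_is_cvg hr hU.
have hc : (a + b * Ehat (fun w => enorm (W k w) ^+ q) + c * Ehat (fun w => enorm (U k w) ^+ r))
    @[k --> \oo] --> a + b * EG Ehat (fun k w => enorm (W k w) ^+ q)
      + c * EG Ehat (fun k w => enorm (U k w) ^+ r).
  apply: cvgD; first (apply: cvgD; [exact: cvg_cst|]).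
    by apply: cvgM; [exact: cvg_cst|exact: cW].
  by apply: cvgM; [exact: cvg_cst|exact: cU].
rewrite -(cvg_lim _ hc)//; apply: ler_lim => //; first by apply/cvg_ex; eexists; exact: hc.
apply: nearW => k; have hVL := LG_Lv hV; have hWL := LG_Lv hW; have hUL := LG_Lv hU.
have := @E_comb (fun w => enorm (V k w) ^+ p) [:: (a, fun=> 1);
  (b, fun w => enorm (W k w) ^+ q); (c, fun w => enorm (U k w) ^+ r)].
rewrite !big_cons big_nil/= E_cst// mulr1 addr0 addrA; apply.
- lip.
- by repeat split => //; lip.
- by move=> w; rewrite !big_cons big_nil/= addr0 mulr1 addrA.
Qed.

Lemma LG_cst p n (x : 'rV[R]_n) : (0 < p)%N -> LG Ehat p T (fun _ _ => x).
Proof.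
move=> p0; split=> [k i|e e0]; first exact: Lip_cst.
by apply/near2P; exists 0%N => k l _ _; rewrite subrr enorm0 expr0n gtn_eqF// E_cst.
Qed.

Lemma LG_opp p n (V : vseq R d n) : LG Ehat p T V -> LG Ehat p T (fun k w => - V k w).
Proof.
move=> hV; have hL := LG_Lv hV; split=> [k|e e0]; first exact: vLipN.
have [N hN] := LG_cauchy hV e0; apply/near2P; exists N => k l hk hl.
by under eq_fun do rewrite -opprD enormN; exact: hN.
Qed.

Lemma LG_add p n (V W : vseq R d n) : (p == 1)%N || (p == 2)%N ->
  LG Ehat p T V -> LG Ehat p T W -> LG Ehat p T (fun k w => V k w + W k w).
Proof.
move=> p12 hV hW; have hVL := LG_Lv hV; have hWL := LG_Lv hW.
split=> [k|e e0]; first by apply: vLipD.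
have e4 : 0 < e / 4 by rewrite divr_gt0.
have [N hN] := LG_cauchy hV e4; have [M hM] := LG_cauchy hW e4.
apply/near2P; exists (maxn N M) => k l; rewrite !geq_max => /andP[Nk Mk] /andP[Nl Ml].
have h1 := hN _ _ Nk Nl; have h2 := hM _ _ Mk Ml.
apply: (@le_lt_trans _ _ (2 * Ehat (fun w => enorm (V k w - V l w) ^+ p)
    + 2 * Ehat (fun w => enorm (W k w - W l w) ^+ p))); last by lra.
apply: (E_le_comb HE (T := T)) => //; [lip|lip|lip|] => w.
have -> : V k w + W k w - (V l w + W l w) = (V k w - V l w) + (W k w - W l w).
  by rewrite opprD addrACA.
set x := V k w - V l w; set y := W k w - W l w.
have x0 := enorm_ge0 x; have y0 := enorm_ge0 y; have xy0 := enorm_ge0 (x + y).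
have h := enormD x y.
case/orP: p12 => /eqP->; first by rewrite !expr1; lra.
have h' : enorm (x + y) ^+ 2 <= (enorm x + enorm y) ^+ 2.
  by rewrite ler_sqr// nnegrE addr_ge0.
by apply: le_trans h' _; have := sqr_ge0 (enorm x - enorm y); lra.
Qed.

Lemma LG_sub p n (V W : vseq R d n) : (p == 1)%N || (p == 2)%N ->
  LG Ehat p T V -> LG Ehat p T W -> LG Ehat p T (fun k w => V k w - W k w).
Proof. by move=> p12 hV hW; apply: LG_add => //; exact: LG_opp. Qed.

Lemma LG_sum p n (I : Type) (r : seq I) (V : I -> vseq R d n) : (p == 1)%N || (p == 2)%N ->
  (forall i, LG Ehat p T (V i)) -> LG Ehat p T (fun k w => \sum_(i <- r) V i k w).
Proof.
move=> p12 hV; elim: r => [|i r IH].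
  under eq_fun do under eq_fun do rewrite big_nil.
  by apply: LG_cst; case/orP: p12 => /eqP->.
under eq_fun do under eq_fun do rewrite big_cons.
exact: LG_add.
Qed.

Lemma LG21 n (V : vseq R d n) : LG Ehat 2 T V -> LG Ehat 1 T V.
Proof.
move=> hV; have hL := LG_Lv hV; split=> [k|e e0]; first exact: hL.
have e2 : 0 < e / 2 by rewrite divr_gt0.
have ee : 0 < (e / 2) ^+ 2 by rewrite exprn_gt0.
have [N hN] := LG_cauchy hV ee; apply/near2P; exists N => k l hk hl.
have h := hN _ _ hk hl.
under eq_fun do rewrite expr1.
apply: le_lt_trans (E1_le2 e2 (vLipB (hL k) (hL l))) _.
have : (e / 2)^-1 * Ehat (fun w => enorm (V k w - V l w) ^+ 2) < e / 2.
  rewrite mulrC ltr_pdivrMr// -expr2//.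
lra.
Qed.

(* [wclos D K]: D lies in the L^1-closure of the L^2-ball of squared radius K.
   The ds- and d<B>-integrals are limits in L^1 only; this is the form in which
   L^2 bounds pass to them, and [wclos_EG] recovers the L^2 bound for D in L^2. *)
Definition wclos n (D : vseq R d n) (K : R) : Prop :=
  forall e, 0 < e -> exists P : vseq R d n, Lv P /\ \forall k \near \oo,
    Ehat (fun w => enorm (D k w - P k w)) < e /\ Ehat (fun w => enorm (P k w) ^+ 2) < K + e.

(** Closeness of Y to P in L^1 says nothing about squares unless the other factor is controlled. One
    factor |Y_k| is therefore replaced by |Y_l| with l fixed: |Y_k|^2 is at most |Y_k| |Y_k - Y_l| +
    |Y_k - P_k| |Y_l| + |P_k| |Y_l|. The first term is small in L^2, the second after truncating
    |Y_l| at M, and the third is at most half the sum of the squares, so that half of the left side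
    is absorbed. *)
Lemma wclos_EG n (Y : vseq R d n) K : 0 <= K -> LG Ehat 2 T Y -> wclos Y K ->
  EG Ehat (fun k w => enorm (Y k w) ^+ 2) <= K.
Proof.
move=> K0 hY hK; have hL := LG_Lv hY; have p22 : (2 == 1)%N || (2 == 2)%N by [].
set y := EG _ _; have y0 : 0 <= y by exact: EG_ge0.
apply/ler_addgt0Pr => e0 e00.
(* The errors below add up to at most 6 [eta], and absorbing y / 2 on the left doubles them. *)
pose eta := e0 / 14; have eta0 : 0 < eta by rewrite divr_gt0.
pose theta := 2 * eta / (y + eta).
have th0 : 0 < theta by rewrite divr_gt0//; lra.
have yE : \forall k \near \oo, y - eta < Ehat (fun w => enorm (Y k w) ^+ 2) /\
   Ehat (fun w => enorm (Y k w) ^+ 2) < y + eta.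
  near=> k; split; near: k.
  - by apply: (EG_gt_near p22 hY); rewrite -/y; lra.
  - by apply: (EG_lt_near p22 hY); rewrite -/y; lra.
have d0 : 0 < 2 * theta * eta by apply: mulr_gt0 => //; apply: mulr_gt0.
have [N hN] := LG_cauchy hY d0.
have [N1 _ hN1] := yE.
(* Order of choices: l is frozen first, and [Y l], an element of L_ip, has a finite fourth moment;
   the level [M] depends on that moment, the precision [e] on [M], and k comes last. *)
pose l := maxn N N1.
have [_ yl] : _ /\ Ehat (fun w => enorm (Y l w) ^+ 2) < y + eta := hN1 l (leq_maxr _ _).
pose b4 := Ehat (fun w => enorm (Y l w) ^+ 4).
have b40 : 0 <= b4.
  by apply: (E_ge0 HE (T := T)); [lip|move=> w; rewrite exprn_ge0// enorm_ge0].
pose M := 1 + (y + eta + K + eta + b4) / eta.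
have M0 : 0 < M by rewrite addr_gt0// divr_gt0//; lra.
pose e := Num.min eta (eta / M).
have e_gt0 : 0 < e by rewrite lt_min eta0 divr_gt0.
have [P [hP hPk]] := hK e e_gt0.
have [k [[yk1 yk2] [[dk pk] Nk]]] : exists k, (y - eta < Ehat (fun w => enorm (Y k w) ^+ 2) /\
   Ehat (fun w => enorm (Y k w) ^+ 2) < y + eta) /\ ((Ehat (fun w => enorm (Y k w - P k w)) < e
    /\ Ehat (fun w => enorm (P k w) ^+ 2) < K + e) /\ (N <= k)%N).
  have [k0 _ hk0] : \forall k \near \oo, (y - eta < Ehat (fun w => enorm (Y k w) ^+ 2) /\
   Ehat (fun w => enorm (Y k w) ^+ 2) < y + eta) /\ ((Ehat (fun w => enorm (Y k w - P k w)) < e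
    /\ Ehat (fun w => enorm (P k w) ^+ 2) < K + e) /\ (N <= k)%N).
    near=> k; split; first by near: k.
    by split; [near: k|near: k; exists N].
  by exists k0; exact: hk0 (leqnn k0).
have dkl := hN _ _ Nk (leq_maxl N N1).
have hYk := hL k; have hYl := hL l; have hPk' := hP k.
have thi : 0 < theta^-1 by rewrite invr_gt0.
have Mi : 0 < M^-1 by rewrite invr_gt0.
pose s : seq (R * (cpath R d -> R)) := [::
   (theta / 2 + M^-1, fun w => enorm (Y k w) ^+ 2);
   (theta^-1 / 2, fun w => enorm (Y k w - Y l w) ^+ 2);
   (M, fun w => enorm (Y k w - P k w));
   (M^-1 + 2^-1, fun w => enorm (P k w) ^+ 2);
   (M^-1 / 2, fun w => enorm (Y l w) ^+ 4);
   (2^-1, fun w => enorm (Y l w) ^+ 2)].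
have main : Ehat (fun w => enorm (Y k w) ^+ 2) <= \sum_(x <- s) x.1 * Ehat x.2.
apply: E_comb.
- lip.
- by rewrite /=; repeat split; first [solve [lip] | lra].
- move=> w; rewrite !big_cons big_nil/=.
  set a := enorm (Y k w); set b := enorm (Y l w); set q := enorm (P k w).
  set d1 := enorm (Y k w - P k w); set d2 := enorm (Y k w - Y l w).
  have a0 : 0 <= a by exact: enorm_ge0.
  have b0 : 0 <= b by exact: enorm_ge0.
  have q0 : 0 <= q by exact: enorm_ge0.
  have d10 : 0 <= d1 by exact: enorm_ge0.
  have hd1 : a <= q + d1 by exact: enorm_subl.
  have hd1' : d1 <= a + q by exact: enormB.
  have hd2 : a <= b + d2 by exact: enorm_subl.
  have h1 : a ^+ 2 <= a * d2 + d1 * b + q * b by nra.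
  have h2 : a * d2 <= theta / 2 * a ^+ 2 + theta^-1 / 2 * d2 ^+ 2.
    by have := young a d2 th0; rewrite invfM [2^-1 * _]mulrC.
  have h3 : b <= M + M^-1 * b ^+ 2 by exact: young1.
  have h4 : d1 * b <= M * d1 + M^-1 * (d1 * b ^+ 2) by nra.
  have h5 : d1 * b ^+ 2 <= a ^+ 2 + q ^+ 2 + b ^+ 4 / 2.
    have : (b ^+ 4) = (b ^+ 2) ^+ 2 by rewrite -exprM.
    move=> ->; have := sqr_ge0 (d1 - b ^+ 2); have := sqr_ge0 (a - q); nra.
  have h6 : M^-1 * (d1 * b ^+ 2) <= M^-1 * (a ^+ 2 + q ^+ 2 + b ^+ 4 / 2).
    by rewrite ler_wpM2l ?(ltW Mi).
  have h7 := sqr_ge0 (q - b).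
  lra.
rewrite !big_cons big_nil/= in main.
have h1 : theta / 2 * Ehat (fun w => enorm (Y k w) ^+ 2) <= eta.
  apply: (@le_trans _ _ (theta / 2 * (y + eta))).
    by rewrite ler_wpM2l ?(ltW yk2)//; lra.
  rewrite /theta; have -> : 2 * eta / (y + eta) / 2 * (y + eta) = eta; last by [].
  by field; rewrite gt_eqF//; lra.
have h2 : theta^-1 / 2 * Ehat (fun w => enorm (Y k w - Y l w) ^+ 2) <= eta.
  apply: (@le_trans _ _ (theta^-1 / 2 * (2 * theta * eta))).
    by rewrite ler_wpM2l ?(ltW dkl)//; lra.
  have -> : theta^-1 / 2 * (2 * theta * eta) = eta; last by [].
  by field; rewrite gt_eqF.
have eM : M * e <= eta.
  apply: (@le_trans _ _ (M * (eta / M))); first by rewrite ler_wpM2l ?(ltW M0)// ge_min lexx orbT.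
  by rewrite mulrC divfK// gt_eqF.
have e_eta : e <= eta by rewrite ge_min lexx.
have h3 : M * Ehat (fun w => enorm (Y k w - P k w)) <= eta.
  by apply: le_trans eM; rewrite ler_wpM2l ?(ltW M0)// ltW.
have h4 : M^-1 * (Ehat (fun w => enorm (Y k w) ^+ 2) + Ehat (fun w => enorm (P k w) ^+ 2) + b4) <= eta.
  rewrite mulrC ler_pdivrMr// /M mulrDr [eta * (_ / eta)]mulrC divfK ?gt_eqF//; lra.
have b4' : 0 <= M^-1 * b4 by rewrite mulr_ge0// ltW.
rewrite -/b4 in main.
have e0E : e0 = 14 * eta by rewrite /eta; field.
lra.
Unshelve. all: by end_near. Qed.

End LGTheory.

(** * Stability of L^2 bounds under sums and L^1 limits *)

Section WeakClosure.
Context {R : realType} {d : nat} (Ehat : (cpath R d -> R) -> R).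
Hypothesis HE : sublinear_expectation Lip Ehat.
Variables (T : R) (T0 : 0 <= T).
Local Notation Lv := (Lv T).
Local Notation wclos := (wclos Ehat T).

Lemma near_forall_fin (I : finType) (P : I -> nat -> Prop) :
  (forall i, \forall k \near \oo, P i k) -> \forall k \near \oo, forall i, P i k.
Proof. by move=> h; exact: (filter_forall _ h). Qed.

Lemma wclos_cst n (x : 'rV[R]_n) : wclos (fun _ _ => x) (enorm x ^+ 2).
Proof.
move=> e e0; exists (fun _ _ => x); split; first by move=> k; exact: vLip_cst.
by apply: nearW => k; rewrite subrr enorm0 !(E_cst HE) ltrDl.
Qed.

Lemma wclos_trans n (D D' : vseq R d n) K : Lv D -> Lv D' ->
  (forall e, 0 < e -> \forall k \near \oo, Ehat (fun w => enorm (D' k w - D k w)) < e) ->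
  wclos D K -> wclos D' K.
Proof.
move=> hD hD' h hK e e0; have e2 : 0 < e / 2 by rewrite divr_gt0.
have [P [hP hk]] := hK _ e2; exists P; split => //.
near=> k; have [h1 h2] : Ehat (fun w => enorm (D k w - P k w)) < e / 2 /\
   Ehat (fun w => enorm (P k w) ^+ 2) < K + e / 2 by near: k.
have h3 : Ehat (fun w => enorm (D' k w - D k w)) < e / 2 by near: k; exact: h.
have hDk := hD k; have hDk' := hD' k; have hPk := hP k.
split; last lra.
apply: (@le_lt_trans _ _ (Ehat (fun w => enorm (D' k w - D k w)) + Ehat (fun w => enorm (D k w - P k w)))); last lra.
apply: (E_le_D HE (T := T)); [lip|lip|lip|] => w; exact: enorm_trans.
Unshelve. all: by end_near. Qed.

Lemma wclos_sum n N (D : 'I_N -> vseq R d n) (K : 'I_N -> R) :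
  (forall i, Lv (D i)) -> (forall i, wclos (D i) (K i)) ->
  wclos (fun k w => \sum_i D i k w) (N%:R * \sum_i K i).
Proof.
(* With N + 1 in place of N both N e' and N^2 e' stay below e, also for N = 0. *)
move=> hD hK e e0; pose e' := e / (N.+1%:R ^+ 2).
have N1 : 0 < N.+1%:R ^+ 2 :> R by rewrite exprn_gt0.
have e'0 : 0 < e' by rewrite divr_gt0.
have eE : e = N.+1%:R ^+ 2 * e' by rewrite /e' mulrC divfK// gt_eqF.
have /choice[P hP] i := hK i e' e'0.
exists (fun k w => \sum_i P i k w); split.
  by move=> k; apply: vLip_sum => // i; exact: (hP i).1.
have hall := near_forall_fin (fun i => (hP i).2).
near=> k.
have hk : forall i, Ehat (fun w => enorm (D i k w - P i k w)) < e' /\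
   Ehat (fun w => enorm (P i k w) ^+ 2) < K i + e' by near: k.
have hDk i := hD i k; have hPk i := (hP i).1 k.
have Nlt : N%:R <= N%:R ^+ 2 :> R by rewrite -natrX ler_nat; case: (N) => // m; rewrite -{1}[m.+1]expn1 leq_pexp2l.
have Nlt2 : N%:R ^+ 2 * e' < e.
  by rewrite eE ltr_pM2r// -!natrX ltr_nat ltn_sqr.
split.
  apply: (@le_lt_trans _ _ (\sum_i Ehat (fun w => enorm (D i k w - P i k w)))).
    apply: le_trans (E_sum HE T0 (F := fun i w => enorm (D i k w - P i k w)) _); last by move=> i; lip.
    apply: (E_le HE (T := T)).
    - by apply: Lip_enorm => //; apply: vLipB; apply: vLip_sum.
    - by apply: Lip_sum => // i; lip.
    by move=> w; rewrite -sumrB; exact: enorm_sum.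
  apply: (@le_lt_trans _ _ (\sum_(i < N) e')).
    by apply: ler_sum => i _; exact: ltW (hk i).1.
  rewrite sumr_const card_ord -(mulr_natl e' N); apply: le_lt_trans Nlt2.
  by rewrite ler_wpM2r// ltW.
apply: (@le_lt_trans _ _ (N%:R * \sum_i Ehat (fun w => enorm (P i k w) ^+ 2))).
  have hs : Lip_upto T (fun w => \sum_i enorm (P i k w) ^+ 2) by apply: Lip_sum => // i; lip.
  apply: (@le_trans _ _ (N%:R * Ehat (fun w => \sum_i enorm (P i k w) ^+ 2))); last first.
    by rewrite ler_wpM2l//; apply: (E_sum HE T0) => i; lip.
  rewrite -(E_Z HE _ hs)//; apply: (E_le HE (T := T)).
  - by apply: LipX; apply: Lip_enorm => //; apply: vLip_sum.
  - by apply: LipM => //; exact: Lip_cst.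
  - by move=> w; exact: enorm_sum_sqr.
apply: (@le_lt_trans _ _ (N%:R * \sum_(i < N) (K i + e'))).
  by rewrite ler_wpM2l//; apply: ler_sum => i _; exact: ltW (hk i).2.
rewrite big_split/= sumr_const card_ord mulrDr ltrD2l -(mulr_natl e' N) mulrA -expr2.
exact: Nlt2.
Unshelve. all: by end_near. Qed.

Lemma wclosD n (D D' : vseq R d n) K K' : Lv D -> Lv D' -> wclos D K -> wclos D' K' ->
  wclos (fun k w => D k w + D' k w) (2 * (K + K')).
Proof.
move=> hD hD' hK hK'.
have := @wclos_sum n 2 (fun i => if i == ord0 then D else D') (fun i => if i == ord0 then K else K').
rewrite big_ord_recr big_ord1/= => h.
have -> : (fun k w => D k w + D' k w) =
  (fun k w => \sum_(i < 2) (if i == ord0 then D else D') k w).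
  by apply/funext => k; apply/funext => w; rewrite big_ord_recr big_ord1.
by apply: h => i; case: ifP.
Qed.

(** A quantitative form of Cauchy-Schwarz: Young's inequality with weight e / (B + 1) on the bounded
    factor. The threshold depends on B and e only, hence is uniform along sequences. *)
Lemma E_prod_small (B e : R) : 0 <= B -> 0 < e -> exists2 dl, 0 < dl &
  forall X Y, Lip_upto T X -> Lip_upto T Y -> Ehat (fun w => X w ^+ 2) <= B ->
    Ehat (fun w => Y w ^+ 2) < dl -> Ehat (fun w => X w * Y w) < e.
Proof.
move=> B0 e0; pose th := e / (B + 1).
have th0 : 0 < th by rewrite divr_gt0//; lra.
exists (th * e) => [|X Y hX hY hB hd]; first exact: mulr_gt0.
apply: (@le_lt_trans _ _ (th / 2 * Ehat (fun w => X w ^+ 2) + (2 * th)^-1 * Ehat (fun w => Y w ^+ 2))).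
  have t1 : 0 <= th / 2 by rewrite divr_ge0 ?(ltW th0).
  have t2 : 0 <= (2 * th)^-1 by rewrite invr_ge0 mulr_ge0 ?(ltW th0).
  by apply: (E_le_comb HE (T := T)) => //; [lip|lip|lip|] => w; exact: young.
have h1 : th / 2 * Ehat (fun w => X w ^+ 2) <= e / 2.
  apply: (@le_trans _ _ (th / 2 * (B + 1))).
    by rewrite ler_wpM2l ?divr_ge0 ?(ltW th0)//; lra.
  by rewrite mulrAC /th divfK// gt_eqF//; lra.
have h2 : (2 * th)^-1 * Ehat (fun w => Y w ^+ 2) < e / 2.
  apply: (@lt_le_trans _ _ ((2 * th)^-1 * (th * e))).
    by rewrite ltr_pM2l// invr_gt0 mulr_gt0.
  by have -> : (2 * th)^-1 * (th * e) = e / 2 by field; rewrite gt_eqF.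
lra.
Qed.

End WeakClosure.

Section WeightedCauchySchwarz.
Context {R : realType}.

(** Twice the difference of the two sides is the double sum of p_i p_j (x_i - x_j)^2. *)
Lemma sum_sqr_weighted N (p x : 'I_N -> R) : (forall i, 0 <= p i) ->
  (\sum_i p i * x i) ^+ 2 <= (\sum_i p i) * \sum_i p i * x i ^+ 2.
Proof.
move=> p0; rewrite expr2 mulr_suml.
apply: (@le_trans _ _ (\sum_(i < N) \sum_(j < N)
   (2^-1 * (p i * x i ^+ 2 * p j) + 2^-1 * (p i * (p j * x j ^+ 2))))).
  apply: ler_sum => i _; rewrite mulr_sumr; apply: ler_sum => j _.
  rewrite -subr_ge0.
  have -> : 2^-1 * (p i * x i ^+ 2 * p j) + 2^-1 * (p i * (p j * x j ^+ 2)) - p i * x i * (p j * x j)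
    = 2^-1 * (p i * p j) * (x i - x j) ^+ 2 by field.
  by apply: mulr_ge0; rewrite ?sqr_ge0//; apply: mulr_ge0 => //; apply: mulr_ge0.
set S := \sum_i p i; set Q := \sum_i p i * x i ^+ 2.
under eq_bigr => i _ do rewrite big_split/= -!mulr_sumr -/S -/Q.
rewrite big_split/= -!mulr_sumr -!mulr_suml -/S -/Q.
by rewrite le_eqVlt; apply/orP; left; apply/eqP; field.
Qed.

(* The truncation of x to [-c, c], written with [Num.max] only, under which
   L_ip is stable. *)
Definition clip (c x : R) : R := Num.max (- Num.max (- x) (- c)) (- c).

Lemma clipP (c x : R) : 0 <= c ->
  `|clip c x| <= c /\ `|x - clip c x| <= Num.max (`|x| - c) 0.
Proof.
move=> c0; rewrite /clip.
have hx := ler_norm x; have hx' : - x <= `|x| by rewrite -normrN ler_norm.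
have m1 : `|x| - c <= Num.max (`|x| - c) 0 by rewrite le_max lexx.
have m2 : 0 <= Num.max (`|x| - c) 0 by rewrite le_max lexx orbT.
rewrite !ler_norml; move: m1 m2; set m := Num.max (`|x| - c) 0 => m1 m2.
case: (leP (- x) (- c)) => h1; last rewrite opprK.
  case: (leP (- - c) (- c)) => h2; split; apply/andP; split; lra.
by case: (leP x (- c)) => h2; split; apply/andP; split; lra.
Qed.

End WeightedCauchySchwarz.

(** * Integrators *)

Section Integrators.
Context {R : realType} {d : nat} (Ehat : (cpath R d -> R) -> R).
Hypothesis HE : sublinear_expectation Lip Ehat.
Variables (T : R) (T0 : 0 <= T).
Local Notation Lv := (Lv T).

Definition isum n (A : R -> rseq R d) M (u : nat -> R) (zeta : nat -> vseq R d n) :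
    vseq R d n :=
  fun k w => \sum_(i < M) (A (u i.+1) k w - A (u i) k w) *: zeta i k w.

Definition rsum n p M (u : nat -> R) (zeta : nat -> vseq R d n) k : R :=
  \sum_(i < M) (u i.+1 - u i) * Ehat (fun w => enorm (zeta i k w) ^+ p).

(** What the integrals against ds, d<B> and dB have in common on step processes. The errors e are
    there because A_t is itself a Cauchy sequence. The last clause bounds only an L^1-close [P] in
    L^2, since the products of two L_G^2 sequences are Cauchy in L_G^1 only. *)
Definition integrator (p : nat) (A : R -> rseq R d) (C : R) : Prop :=
  [/\ (p == 1)%N || (p == 2)%N, 0 <= C &
    forall n M u t (zeta : nat -> vseq R d n), 0 <= t <= T ->
    Defs.partition M u t -> (forall i, (i < M)%N -> LG Ehat 2 (u i) (zeta i)) ->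
    [/\ LG Ehat p T (isum A M u zeta),
      forall e, 0 < e -> \forall k \near \oo,
        Ehat (fun w => enorm (isum A M u zeta k w) ^+ p) <= C * rsum p M u zeta k + e &
      exists P : vseq R d n, Lv P /\ forall e, 0 < e -> \forall k \near \oo,
        Ehat (fun w => enorm (isum A M u zeta k w - P k w)) < e /\
        Ehat (fun w => enorm (P k w) ^+ 2) <= C * rsum 2 M u zeta k + e]].

Lemma LG_mono p s t n (V : vseq R d n) : s <= t -> LG Ehat p s V -> LG Ehat p t V.
Proof. by move=> st [h1 h2]; split => // k i; exact: Lip_le (h1 k i). Qed.

Section Brownian.
Variables (s2 kap : R).
Hypothesis Hinc : increments_spec Ehat s2 kap.

(** Ito's inequality, one cell at a time: when a cell is added, the cross term has nonpositive
    expectation given the past, and the new square costs at most [s2] times the length of the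
    cell. *)
Lemma E_brownian_sum n (j : 'I_d) M (u : nat -> R) t (V : nat -> cpath R d -> 'rV[R]_n) :
  Defs.partition M u t -> (forall i, (i < M)%N -> vLip (u i) (V i)) ->
  Ehat (fun w => enorm (\sum_(i < M) (w (u i.+1) ord0 j - w (u i) ord0 j) *: V i w) ^+ 2)
    <= s2 * \sum_(i < M) (u i.+1 - u i) * Ehat (fun w => enorm (V i w) ^+ 2).
Proof.
move=> pu hV; have [[s20 _] hA hB _ _] := Hinc; have [u0 _ ult] := pu.
have hu i : (i <= M)%N -> 0 <= u i by move=> /(partition_itv pu)/andP[].
(* The induction carries along that the partial sum is known at time u_m, without which the next
   increment could not be integrated given the past. *)
suff : forall m, (m <= M)%N ->
  vLip (u m) (fun w => \sum_(i < m) (w (u i.+1) ord0 j - w (u i) ord0 j) *: V i w) /\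
  Ehat (fun w => enorm (\sum_(i < m) (w (u i.+1) ord0 j - w (u i) ord0 j) *: V i w) ^+ 2)
    <= s2 * \sum_(i < m) (u i.+1 - u i) * Ehat (fun w => enorm (V i w) ^+ 2).
  by move=> /(_ M (leqnn M))[].
elim=> [|m IH] mM.
  split; first by under eq_fun do rewrite big_ord0; apply: vLip_cst; exact: hu.
  under eq_fun do rewrite big_ord0 enorm0 expr0n.
  by rewrite big_ord0 mulr0 (E_cst HE).
have [hS hE] := IH (ltnW mM).
have um : 0 <= u m by exact: hu (ltnW mM).
have um1 : 0 <= u m.+1 by exact: hu.
have umm : u m <= u m.+1 by exact/ltW/ult.
have hVm := hV m mM.
have hx : Lip_upto (u m.+1) (fun w : cpath R d => w (u m.+1) ord0 j - w (u m) ord0 j).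
  by apply: LipB; apply: Lip_path; rewrite ?lexx ?um1 ?um ?umm.
have hS' := vLip_le umm hS; have hVm' := vLip_le umm hVm.
split.
  by under eq_fun do rewrite big_ord_recr/=; apply: vLipD => //; apply: vLipZ.
under eq_fun do rewrite big_ord_recr/=; rewrite big_ord_recr/= mulrDr.
set S := (fun w : cpath R d => \sum_(i < m) (w (u i.+1) ord0 j - w (u i) ord0 j) *: V i w) in hS hS' hE *.
(* The factor of the Brownian increment in the cross term of |S + x V|^2. *)
pose z := fun w => 2 * \sum_(l < n) S w ord0 l * V m w ord0 l.
have hz : Lip_upto (u m) z.
  apply: LipM; first exact: Lip_cst.
  by apply: Lip_sum => // l; apply: LipM; [exact: hS|exact: hVm].
have hd : Lip_upto (u m.+1) (fun w : cpath R d => enorm (w (u m.+1) - w (u m))).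
  apply: Lip_enorm => //; apply: vLipB; apply: vLip_path; rewrite ?lexx ?um1 ?um ?umm//.
have h2 := hB _ _ (fun w => enorm (V m w) ^+ 2) um (ult _ mM)
  (LipX 2 (Lip_enorm um hVm)) (fun w => sqr_ge0 _).
have h1 := hA _ _ z j um (ult _ mM) hz.
apply: (@le_trans _ _ ((Ehat (fun w => enorm (S w) ^+ 2)
   + Ehat (fun w => z w * (w (u m.+1) ord0 j - w (u m) ord0 j)))
   + Ehat (fun w => enorm (V m w) ^+ 2 * enorm (w (u m.+1) - w (u m)) ^+ 2))); last first.
  rewrite mulrA; lra.
have hz' := Lip_le umm hz.
apply: le_trans (_ : _ <= Ehat (fun w => enorm (S w) ^+ 2 + z w * (w (u m.+1) ord0 j - w (u m) ord0 j))
   + Ehat (fun w => enorm (V m w) ^+ 2 * enorm (w (u m.+1) - w (u m)) ^+ 2)) _; last first.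
  by rewrite lerD2r; apply: (E_D HE (T := u m.+1)); lip.
have hSV : Lip_upto (u m.+1) (fun w =>
   enorm (S w + (w (u m.+1) ord0 j - w (u m) ord0 j) *: V m w) ^+ 2).
  by apply: LipX; apply: Lip_enorm => //; apply: vLipD => //; apply: vLipZ.
apply: (E_le_D HE (T := u m.+1)) => //; [lip|lip|] => w.
set x := w (u m.+1) ord0 j - w (u m) ord0 j.
have hx2 : x ^+ 2 <= enorm (w (u m.+1) - w (u m)) ^+ 2.
  rewrite -[x ^+ 2]real_normK ?num_real// ler_sqr ?nnegrE ?enorm_ge0//.
  by have := normr_le_enorm (w (u m.+1) - w (u m)) ord0 j; rewrite !mxE.
apply: (@le_trans _ _ (enorm (S w) ^+ 2 + z w * x + enorm (V m w) ^+ 2 * x ^+ 2)).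
  rewrite le_eqVlt; apply/orP; left; apply/eqP.
  rewrite !enorm_sqr /z !big_ord1 mulrAC mulr_sumr mulr_suml -!big_split/=.
  by apply: eq_bigr => l _; rewrite !mxE; ring.
by rewrite lerD2l ler_wpM2l ?sqr_ge0.
Qed.

Lemma brownian_integrator (j : 'I_d) : integrator 2 (brownian j) s2.
Proof.
have [[s20 _] _ _ _ _] := Hinc.
split => // n M u t zeta /andP[t0 tT] pu hz.
have uT i : (i <= M)%N -> 0 <= u i <= T.
  by move=> /(partition_itv pu)/andP[-> /le_trans->].
have hzL i k : (i < M)%N -> vLip (u i) (zeta i k).
  by move=> iM; exact: LG_Lv (hz i iM) k.
have hI : Lv (isum (brownian j) M u zeta).
  move=> k l; under eq_fun do rewrite summxE.
  apply: Lip_sum => // i; under eq_fun do rewrite mxE.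
  apply: LipM.
    by apply: LipB; apply: Lip_path; apply: uT => //; exact: ltnW.
  by have /andP[_ h] := uT i (ltnW (ltn_ord i)); exact: Lip_le h (hzL _ _ (ltn_ord i) l).
have hb k : Ehat (fun w => enorm (isum (brownian j) M u zeta k w) ^+ 2) <= s2 * rsum 2 M u zeta k.
  by apply: (E_brownian_sum j (V := fun i => zeta i k) pu) => i iM; exact: hzL.
split.
- split; first exact: hI.
  move=> e e0.
  have e'0 : 0 < e / (s2 * t + 1) by rewrite divr_gt0// ltr_wpDl// mulr_ge0.
  have /choice[f hf] (i : 'I_M) := LG_cauchy (hz i (ltn_ord i)) e'0.
  apply/near2P; exists (\max_i f i)%N => k l hk hl.
  have -> : (fun w => enorm (isum (brownian j) M u zeta k w - isum (brownian j) M u zeta l w) ^+ 2)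
    = (fun w => enorm (\sum_(i < M) (w (u i.+1) ord0 j - w (u i) ord0 j) *: (zeta i k w - zeta i l w)) ^+ 2).
    apply/funext => w; congr (enorm _ ^+ 2); rewrite -sumrB; apply: eq_bigr => i _.
    by rewrite scalerBr.
  apply: le_lt_trans (E_brownian_sum j (V := fun i w => zeta i k w - zeta i l w) pu _) _.
    by move=> i iM; apply: vLipB; exact: hzL.
  apply: (@le_lt_trans _ _ (s2 * \sum_(i < M) (u i.+1 - u i) * (e / (s2 * t + 1)))).
    rewrite ler_wpM2l//; apply: ler_sum => i _; have [_ _ ult] := pu.
    rewrite ler_wpM2l// ?subr_ge0 ?(ltW (ult _ _))//.
    apply/ltW/hf; apply: leq_trans (_ : (\max_i f i <= _)%N) => //; exact: leq_bigmax.
  rewrite -mulr_suml -(big_mkord xpredT (fun i => u i.+1 - u i)) telescope_sumr//.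
  have [-> -> _] := pu; rewrite subr0 mulrA [e / _]mulrC mulrA gtr_pMl// ltr_pdivrMr ?mul1r ?ltrDl//.
  by rewrite ltr_wpDl// mulr_ge0.
- by move=> e e0; apply: nearW => k; apply: le_trans (hb k) _; rewrite lerDl ltW.
- exists (isum (brownian j) M u zeta); split => // e e0; apply: nearW => k; split.
    by under eq_fun do rewrite subrr enorm0; rewrite (E_cst HE).
  by apply: le_trans (hb k) _; rewrite lerDl ltW.
Qed.

End Brownian.

Lemma LG_scale n (a : rseq R d) (V : vseq R d n) :
  LG Ehat 2 T (fun k w => (a k w)%:M : 'rV[R]_1) -> LG Ehat 2 T V ->
  LG Ehat 1 T (fun k w => a k w *: V k w).
Proof.
move=> ha hV; have haL k : Lip_upto T (a k).
  have := LG_Lv ha k ord0.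
  by congr (Lip_upto _); apply/funext => w; rewrite mxE eqxx mulr1n.
have hVL := LG_Lv hV; split=> [k|e e0]; first exact: vLipZ.
have [Ba [Ba0 [Na _ hBa]]] := E2_bound HE T0 ha.
have [Bv [Bv0 [Nv _ hBv]]] := E2_bound HE T0 hV.
have e2 : 0 < e / 2 by rewrite divr_gt0.
have [da da0 hda] := E_prod_small HE T Ba0 e2.
have [dv dv0 hdv] := E_prod_small HE T Bv0 e2.
have [N hN] := LG_cauchy ha dv0; have [N' hN'] := LG_cauchy hV da0.
apply/near2P; exists (maxn (maxn Na Nv) (maxn N N')) => k l.
rewrite !geq_max => /andP[/andP[ak vk] /andP[nk n'k]] /andP[/andP[al vl] /andP[nl n'l]].
have hak := haL k; have hal := haL l; have hvk := hVL k; have hvl := hVL l.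
have h1 : Ehat (fun w => `|a k w| * enorm (V k w - V l w)) < e / 2.
  apply: hda; [lip|lip| |exact: hN'].
  by have := hBa _ ak; under eq_fun do rewrite enorm_scalar.
have h2 : Ehat (fun w => enorm (V l w) * `|a k w - a l w|) < e / 2.
  apply: hdv; [lip|lip|exact: hBv|].
  by have := hN _ _ nk nl; under eq_fun do rewrite -raddfB enorm_scalar.
apply: (@le_lt_trans _ _ (Ehat (fun w => `|a k w| * enorm (V k w - V l w)) +
   Ehat (fun w => enorm (V l w) * `|a k w - a l w|))); last lra.
apply: (E_le_D HE (T := T)); [lip|lip|lip|] => w; rewrite expr1.
have -> : a k w *: V k w - a l w *: V l w = a k w *: (V k w - V l w) + (a k w - a l w) *: V l w.
  by rewrite scalerBr scalerBl addrA subrK.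
by apply: le_trans (enormD _ _) _; rewrite !enormZ [enorm (V l w) * _]mulrC.
Qed.

(* The Lipschitz property |A_t - A_s| <= C (t - s) in the order of the completion. *)
Definition Lip_integrator (A : R -> rseq R d) (C : R) : Prop :=
  [/\ 0 <= C, forall t, 0 <= t <= T -> LG Ehat 2 T (fun k w => (A t k w)%:M : 'rV[R]_1) &
    forall s t, 0 <= s -> s < t -> t <= T ->
      Ehat (fun w => Num.max (`|A t k w - A s k w| - C * (t - s)) 0 ^+ 2) @[k --> \oo] --> (0 : R)].

(** [P] is the sum with the increments of A clipped at C times the cell length. The clipped-off
    excess tends to 0 in L^2, and its product with a process bounded in L^2 does so in L^1. Clipping
    gives |P| at most C times the Riemann sum of |zeta|, whence the factor C in L^1 and, by weighted
    Cauchy-Schwarz, C^2 T for the squares; their sum serves for both. *)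
Lemma Lip_integrator_integrator A C : Lip_integrator A C ->
  integrator 1 A (C + C ^+ 2 * T).
Proof.
move=> [C0 hA hAC]; split => //; first by rewrite addr_ge0// mulr_ge0// sqr_ge0.
move=> n M u t zeta /andP[t0 tT] pu hz; have [u0 uM ult] := pu.
have uT i : (i <= M)%N -> 0 <= u i <= T.
  by move=> /(partition_itv pu)/andP[-> /le_trans->].
have du0 i : (i < M)%N -> 0 <= u i.+1 - u i by move=> /ult; rewrite subr_ge0 => /ltW.
have hz' i : (i < M)%N -> LG Ehat 2 T (zeta i).
  by move=> iM; have /andP[_ h] := uT i (ltnW iM); exact: LG_mono h (hz i iM).
have hzL i k : (i < M)%N -> vLip T (zeta i k) by move=> iM; exact: LG_Lv (hz' i iM) k.
have hAL s k : 0 <= s <= T -> Lip_upto T (A s k).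
  move=> sT; have := LG_Lv (hA s sT) k ord0.
  by congr (Lip_upto _); apply/funext => w; rewrite mxE eqxx mulr1n.
pose a i k w := A (u i.+1) k w - A (u i) k w.
have ha i k : (i < M)%N -> Lip_upto T (a i k).
  by move=> iM; apply: LipB; apply: hAL; apply: uT => //; exact: ltnW.
have haLG i : (i < M)%N -> LG Ehat 2 T (fun k w => (a i k w)%:M : 'rV[R]_1).
  move=> iM; have := LG_sub HE T0 (p := 2) isT (hA _ (uT _ iM)) (hA _ (uT _ (ltnW iM))).
  by congr (LG _ _ _); apply/funext => k; apply/funext => w; rewrite /a raddfB.
have hI : Lv (isum A M u zeta).
  move=> k l; under eq_fun do rewrite summxE.
  apply: Lip_sum => // i; under eq_fun do rewrite mxE.
  by apply: LipM; [exact: ha|exact: hzL].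
pose c i := C * (u i.+1 - u i).
have c0 i : (i < M)%N -> 0 <= c i by move=> iM; rewrite mulr_ge0// du0.
pose P : vseq R d n := fun k w => \sum_(i < M) clip (c i) (a i k w) *: zeta i k w.
have hclip i k : (i < M)%N -> Lip_upto T (fun w => clip (c i) (a i k w)).
  by move=> iM; have hi := ha i k iM; rewrite /clip; lip.
have hP : Lv P.
  move=> k l; under eq_fun do rewrite summxE.
  apply: Lip_sum => // i; under eq_fun do rewrite mxE.
  by apply: LipM; [exact: hclip|exact: hzL].
have hIP e : 0 < e -> \forall k \near \oo, Ehat (fun w => enorm (isum A M u zeta k w - P k w)) < e.
  move=> e0; have e'0 : 0 < e / M.+1%:R by rewrite divr_gt0.
  have /near_forall_fin h (i : 'I_M) : \forall k \near \oo,
     Ehat (fun w => enorm (zeta i k w) * Num.max (`|a i k w| - c i) 0) < e / M.+1%:R.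
    have iM := ltn_ord i.
    have [B [B0 hB]] := E2_bound HE T0 (hz' i iM).
    have [dl dl0 hdl] := E_prod_small HE T B0 e'0.
    near=> k; have hzk := hzL i k iM; have hak := ha i k iM; apply: hdl; [lip|lip|near: k; exact: hB|].
    near: k; have /andP[ui0 _] := uT i (ltnW iM); have /andP[_ uiT] := uT i.+1 iM.
    exact: (cvgr_lt _ (hAC _ _ ui0 (ult _ iM) uiT)).
  near=> k; have hk : forall i : 'I_M,
     Ehat (fun w => enorm (zeta i k w) * Num.max (`|a i k w| - c i) 0) < e / M.+1%:R by near: k.
  apply: (@le_lt_trans _ _ (\sum_(i < M) Ehat (fun w => enorm (zeta i k w) * Num.max (`|a i k w| - c i) 0))).
    have hterm (i : 'I_M) : Lip_upto T (fun w => enorm (zeta i k w) * Num.max (`|a i k w| - c i) 0).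
      have hzk := hzL i k (ltn_ord i); have hak := ha i k (ltn_ord i); lip.
    apply: le_trans (E_sum HE T0 hterm).
    apply: (E_le HE (T := T)); [apply: Lip_enorm => //; exact: vLipB|exact: Lip_sum|] => w.
    rewrite -sumrB; apply: le_trans (enorm_sum _ _ _) _; apply: ler_sum => i _.
    rewrite -scalerBl enormZ mulrC ler_wpM2l ?enorm_ge0//.
    exact: (clipP (a i k w) (c0 i (ltn_ord i))).2.
  apply: (@le_lt_trans _ _ (\sum_(i < M) e / M.+1%:R)).
    by apply: ler_sum => i _; exact: ltW.
  rewrite sumr_const card_ord -(mulr_natl (e / _) M) mulrCA gtr_pMr// ltr_pdivrMr// mul1r ltr_nat.
  exact: ltnSn.
have PN k w : enorm (P k w) <= \sum_(i < M) c i * enorm (zeta i k w).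
  apply: le_trans (enorm_sum _ _ _) _; apply: ler_sum => i _.
  rewrite enormZ ler_wpM2r ?enorm_ge0//; exact: (clipP (a i k w) (c0 i (ltn_ord i))).1.
have hcz q k : Lip_upto T (fun w => \sum_(i < M) (u i.+1 - u i) * enorm (zeta i k w) ^+ q).
  apply: Lip_sum => // i; have hzk := hzL i k (ltn_ord i); lip.
have sumE q k : Ehat (fun w => \sum_(i < M) (u i.+1 - u i) * enorm (zeta i k w) ^+ q) <= rsum q M u zeta k.
  have hterm (i : 'I_M) : Lip_upto T (fun w => (u i.+1 - u i) * enorm (zeta i k w) ^+ q).
    have hzk := hzL i k (ltn_ord i); lip.
  apply: le_trans (E_sum HE T0 hterm) _; apply: ler_sum => i _.
  have hzk := hzL i k (ltn_ord i).
  by rewrite (E_Z HE (T := T)) ?du0//; lip.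
have r0 q k : 0 <= rsum q M u zeta k.
  apply: sumr_ge0 => i _; rewrite mulr_ge0 ?du0//.
  have hzk := hzL i k (ltn_ord i).
  by apply: (E_ge0 HE (T := T)); [lip|move=> w; rewrite exprn_ge0// enorm_ge0].
split.
- apply: (LG_sum HE T0 (p := 1)) => // i.
  exact: (LG_scale (a := a i) (haLG i (ltn_ord i)) (hz' i (ltn_ord i))).
- move=> e e0; near=> k.
  apply: (@le_trans _ _ (Ehat (fun w => C * \sum_(i < M) (u i.+1 - u i) * enorm (zeta i k w) ^+ 1)
     + Ehat (fun w => enorm (isum A M u zeta k w - P k w)))).
    have hIk := hI k; have hPk := hP k; have hk := hcz 1%N k.
    apply: (E_le_D HE (T := T)); [lip|lip|lip|] => w; rewrite expr1.
    apply: le_trans (enorm_subl _ (P k w)) _; rewrite lerD2r.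
    apply: le_trans (PN k w) _; rewrite mulr_sumr; apply: ler_sum => i _.
    by rewrite /c expr1 mulrA.
  rewrite (E_Z HE _ (hcz _ _))//; apply: lerD; last by apply: ltW; near: k; exact: hIP.
  apply: le_trans (ler_wpM2l C0 (sumE _ _)) _; rewrite ler_wpM2r// lerDl mulr_ge0//.
  exact: sqr_ge0.
- exists P; split => // e e0; near=> k; split; first by near: k; exact: hIP.
  apply: (@le_trans _ _ (Ehat (fun w => (C ^+ 2 * T) * \sum_(i < M) (u i.+1 - u i) * enorm (zeta i k w) ^+ 2))).
    have hPk := hP k; have hk := hcz 2%N k.
    apply: (E_le HE (T := T)); [lip|lip|] => w.
    apply: (@le_trans _ _ ((\sum_(i < M) c i * enorm (zeta i k w)) ^+ 2)).
      rewrite ler_sqr ?nnegrE ?enorm_ge0//; apply: sumr_ge0 => i _.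
      by rewrite mulr_ge0 ?enorm_ge0// c0.
    have -> : \sum_(i < M) c i * enorm (zeta i k w) = C * \sum_(i < M) (u i.+1 - u i) * enorm (zeta i k w).
      by rewrite mulr_sumr; apply: eq_bigr => i _; rewrite /c mulrA.
    rewrite exprMn -mulrA ler_wpM2l ?sqr_ge0//.
    apply: le_trans (@sum_sqr_weighted _ M (fun i => u i.+1 - u i) (fun i => enorm (zeta i k w)) _) _.
      by move=> i; exact: du0.
    rewrite ler_wpM2r//.
      by apply: sumr_ge0 => i _; rewrite mulr_ge0 ?sqr_ge0// du0.
    by rewrite -(big_mkord xpredT (fun i => u i.+1 - u i)) telescope_sumr// u0 uM subr0.
  have C2T : 0 <= C ^+ 2 * T by rewrite mulr_ge0 ?sqr_ge0.
  rewrite (E_Z HE C2T (hcz _ _)); apply: le_trans (ler_wpM2l C2T (sumE _ _)) _.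
  rewrite mulrDl -[leLHS]add0r -addrA; apply: lerD; first by rewrite mulr_ge0.
  by rewrite lerDl ltW.
Unshelve. all: by end_near. Qed.

End Integrators.

(** A fine grid of [0, t] whose beginning is a grid of [0, s]: the sums approximating the bracket at
    t and at s then differ by the increments inside [s, t] only. For s = 0 the first part has no
    cell, as partitions increase strictly. *)
Lemma split_partition (R : realType) (s t dl : R) : 0 <= s -> s < t -> 0 < dl ->
  exists N1 N (u : nat -> R), [/\ (N1 <= N)%N, Defs.partition N1 u s, Defs.partition N u t &
    forall l, (l < N)%N -> u l.+1 - u l < dl].
Proof.
move=> s0 st dl0.
pose n1 := if s == 0 then 0%N else (Num.bound (s / dl)).+1.
pose n2 := (Num.bound ((t - s) / dl)).+1.
have ts0 : 0 < t - s by rewrite subr_gt0.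
have bnd (x : R) : 0 <= x -> x / (Num.bound (x / dl)).+1%:R < dl.
  move=> x0; rewrite ltr_pdivrMr// mulrC -ltr_pdivrMr//.
  by apply: lt_trans (archi_boundP _) _; [rewrite divr_ge0// ltW|rewrite ltr_nat].
pose u l := if (l <= n1)%N then s * (l%:R / n1%:R) else s + (t - s) * ((l - n1)%:R / n2%:R).
have u1 l : (l < n1)%N -> u l.+1 - u l = s / n1%:R.
  by move=> ln1; rewrite /u ln1 (ltnW ln1) -mulrBr -mulrBl -natrB// subSnn mul1r.
have un1 : u n1 = s.
  rewrite /u leqnn /n1; case: eqVneq => [->|sn0]; first by rewrite mul0r.
  by rewrite divff ?mulr1// pnatr_eq0.
have u2' l : (n1 <= l)%N -> u l = s + (t - s) * ((l - n1)%:R / n2%:R).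
  rewrite leq_eqVlt => /orP[/eqP<-|nl]; first by rewrite un1 subnn mul0r mulr0 addr0.
  by rewrite /u leqNgt nl.
have u2 l : (n1 <= l)%N -> u l.+1 - u l = (t - s) / n2%:R.
  move=> nl; rewrite !u2' ?(leq_trans nl)// opprD addrACA subrr add0r -mulrBr -mulrBl.
  by rewrite subSn// -natrB// subSnn mul1r.
have u0 : u 0%N = 0 by rewrite /u leq0n mul0r mulr0.
have n1s l : (l < n1)%N -> 0 < s / n1%:R < dl.
  rewrite /n1; case: eqVneq => [->//|sn0] _; rewrite bnd// andbT divr_gt0//.
  by rewrite lt_def sn0.
have n2s : 0 < (t - s) / n2%:R < dl by rewrite bnd ?(ltW ts0)// andbT divr_gt0.
have step l : 0 < u l.+1 - u l < dl.
  by case: (ltnP l n1) => h; [rewrite u1//; exact: n1s h|rewrite u2].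
exists n1, (n1 + n2)%N, u; split.
- exact: leq_addr.
- by split => // l _; have /andP[+ _] := step l; rewrite subr_gt0.
- split => // [|l _]; last by have /andP[+ _] := step l; rewrite subr_gt0.
  by rewrite u2' ?leq_addr// addKn divff ?pnatr_eq0// mulr1 addrC subrK.
- by move=> l _; have /andP[] := step l.
Qed.

(** * Time and bracket as Lipschitz integrators *)

Section Bracket.
Context {R : realType} {d : nat} (Ehat : (cpath R d -> R) -> R).
Hypothesis HE : sublinear_expectation Lip Ehat.
Variables (T : R) (T0 : 0 <= T).
Variables (s2 kap : R).
Hypothesis Hinc : increments_spec Ehat s2 kap.

Lemma LG_seq_cst p n (V : cpath R d -> 'rV[R]_n) : (0 < p)%N -> vLip T V ->
  LG Ehat p T (fun=> V).
Proof.
move=> p0 hV; split=> [k i|e e0]; first exact: hV.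
apply/near2P; exists 0%N => k l _ _; under eq_fun do rewrite subrr enorm0 expr0n gtn_eqF//.
by rewrite (E_cst HE).
Qed.

Lemma time_Lip_integrator : Lip_integrator Ehat T time 1.
Proof.
split => // [t _|s t _ st _]; first exact: (LG_cst HE T0 (p := 2) (t%:M : 'rV[R]_1)).
under eq_fun do under eq_fun do rewrite /time mul1r gtr0_norm ?subr_gt0// subrr maxxx expr0n.
by under eq_fun do rewrite (E_cst HE); exact: cvg_cst.
Qed.

(* Weak law of large numbers: the excess of the squared increments over their
   largest mean is an upper martingale with small conditional variances. *)
Lemma E_sqr_increments N (u : nat -> R) t N1 M : Defs.partition N u t ->
  (N1 <= M)%N -> (M <= N)%N ->
  Ehat (fun w => Num.max (\sum_(N1 <= l < M)
      (enorm (w (u l.+1) - w (u l)) ^+ 2 - s2 * (u l.+1 - u l))) 0 ^+ 2) <=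
    kap * \sum_(N1 <= l < M) (u l.+1 - u l) ^+ 2.
Proof.
move=> pu; have [_ _ _ hC hD] := Hinc.
have [u0 _ ult] := pu.
have hu i : (i <= N)%N -> 0 <= u i by move=> /(partition_itv pu)/andP[].
pose y l (w : cpath R d) := enorm (w (u l.+1) - w (u l)) ^+ 2 - s2 * (u l.+1 - u l).
have hy l S : (l < N)%N -> u l.+1 <= S -> Lip_upto S (y l).
  move=> lN lS; have ul := hu _ (ltnW lN); have ul1 := hu _ lN.
  have S0 : 0 <= S by exact: le_trans lS.
  have ulS : u l <= S by apply: le_trans lS; exact/ltW/ult.
  have hw : vLip S (fun w : cpath R d => w (u l.+1) - w (u l)).
    by apply: vLipB; apply: vLip_path; rewrite ?ul ?ul1 ?lS ?ulS.
  by rewrite /y; lip.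
have hsum m S : (m <= N)%N -> u m <= S -> 0 <= S -> (N1 <= m)%N ->
    Lip_upto S (fun w => \sum_(N1 <= l < m) y l w).
  move=> mN umS S0 Nm.
  under eq_fun do rewrite (@big_nat_widenl _ _ _ N1 0)// big_mkord.
  under eq_fun do rewrite big_mkcond/=.
  apply: Lip_sum => // i; case: (N1 <= i)%N; last exact: Lip_cst.
  have iN := leq_trans (ltn_ord i) mN.
  by apply: hy => //; apply: le_trans umS; apply: (partition_le pu).
elim: M => [|M IH] N1M MN.
  rewrite big_geq// mulr0; under eq_fun do rewrite big_geq//.
  by rewrite maxxx expr0n (E_cst HE).
move: N1M; rewrite leq_eqVlt => /orP[/eqP->|]; last rewrite ltnS => N1M.
  rewrite big_geq// mulr0; under eq_fun do rewrite big_geq//.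
  by rewrite maxxx expr0n (E_cst HE).
have {}IH := IH N1M (ltnW MN).
under eq_fun do rewrite big_nat_recr//=; rewrite big_nat_recr//=.
have uM := hu _ (ltnW MN); have uM1 := hu _ MN; have uMM : u M <= u M.+1 by exact/ltW/ult.
(* From ((a + b)^+)^2 <= (a^+)^2 + 2 a^+ b + b^2 with a the past sum and b the new excess; 2 a^+ is
   nonnegative and known at time u_M, so the cross term has nonpositive expectation. *)
pose z w := 2 * Num.max (\sum_(N1 <= l < M) y l w) 0.
have hS := hsum M (u M) (ltnW MN) (lexx _) uM N1M.
have hS' := hsum M (u M.+1) (ltnW MN) uMM uM1 N1M.
have hyM := hy M _ MN (lexx _).
have hz : Lip_upto (u M) z by rewrite /z; lip.
have hz' := Lip_le uMM hz.
have h1 := hC _ _ z uM (ult _ MN) hz (fun w => _).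
have {}h1 : Ehat (fun w => z w * y M w) <= 0.
  by apply: h1 => w; rewrite /z mulr_ge0// le_max lexx orbT.
have h2 := hD _ _ uM (ult _ MN).
apply: (@le_trans _ _ ((Ehat (fun w => Num.max (\sum_(N1 <= l < M) y l w) 0 ^+ 2)
   + Ehat (fun w => z w * y M w)) + Ehat (fun w => y M w ^+ 2))); last first.
  rewrite mulrDr; apply: lerD; last exact: h2.
  by rewrite -[leRHS]addr0; apply: lerD.
apply: le_trans (_ : _ <= Ehat (fun w => Num.max (\sum_(N1 <= l < M) y l w) 0 ^+ 2 + z w * y M w)
   + Ehat (fun w => y M w ^+ 2)) _; last first.
  by rewrite lerD2r; apply: (E_D HE (T := u M.+1)); lip.
have hX : Lip_upto (u M.+1) (fun w => Num.max (\sum_(N1 <= l < M) y l w + y M w) 0 ^+ 2) by lip.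
apply: (E_le_D HE (T := u M.+1)) => //; [lip|lip|] => w; rewrite /z.
rewrite -!/(y _ _); set a := \sum_(_ <= _ < _) _; set b := y M w.
case: (leP a 0) => ha; case: (leP (a + b) 0) => hab; rewrite ?expr0n/=; nra.
Qed.

(** On a common grid the sums for t and s differ by products of coordinate increments, each at most
    the squared norm of the increment. What exceeds [s2] (t - s) is thus bounded by two
    approximation errors and the excess [Y], which is small by [E_sqr_increments]. *)
Lemma bracket_Lip_integrator (i j : 'I_d) (Q : R -> rseq R d) :
  (forall t, 0 <= t -> is_bracket Ehat i j t (Q t)) -> Lip_integrator Ehat T Q s2.
Proof.
move=> hQ; have [[s20 kap0] _ _ _ _] := Hinc.
have hLG t : 0 <= t <= T -> LG Ehat 2 T (fun k w => (Q t k w)%:M : 'rV[R]_1).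
  by move=> /andP[t0 tT]; have [h _] := hQ t t0; exact: LG_mono tT h.
have hL t k : 0 <= t <= T -> Lip_upto T (Q t k).
  move=> tT; have := LG_Lv (hLG t tT) k ord0.
  by congr (Lip_upto _); apply/funext => w; rewrite mxE eqxx mulr1n.
split => // s t s0 st tT.
have t0 : 0 <= t by exact: le_trans (ltW st).
have sT : s <= T by exact: le_trans (ltW st) tT.
have hge0 k : 0 <= Ehat (fun w => Num.max (`|Q t k w - Q s k w| - s2 * (t - s)) 0 ^+ 2).
  have h1 := hL t k; have h2 := hL s k; rewrite t0 tT in h1; rewrite s0 sT in h2.
  have {}h1 := h1 isT; have {}h2 := h2 isT.
  by apply: (E_ge0 HE (T := T)); [lip|move=> w; exact: sqr_ge0].
apply/cvgrPdist_lt => e e0.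
(* Three squares, each of weight 3 and at most e / 12 in expectation, stay below e. *)
have e9 : 0 < e / 12 by rewrite divr_gt0.
have [_ /(_ _ e9)[dt dt0 hdt]] := hQ t t0.
have [_ /(_ _ e9)[ds ds0 hds]] := hQ s s0.
(* The sum of the squared cell lengths is at most mesh times t, so this mesh brings the variance
   term [kap] times that sum below e / 12. *)
pose dk := e / 12 / (kap * t + 1).
have kt : 0 < kap * t + 1 by rewrite ltr_wpDl// mulr_ge0.
have dk0 : 0 < dk by rewrite divr_gt0.
pose dl := Num.min dt (Num.min ds dk).
have dl0 : 0 < dl by rewrite !lt_min dt0 ds0 dk0.
have [N1 [N [u [N1N pu1 pu hmesh]]]] := split_partition s0 st dl0.
have mesh_t l : (l < N)%N -> u l.+1 - u l < dt.
  by move=> /hmesh; rewrite !lt_min => /andP[].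
have mesh_s l : (l < N1)%N -> u l.+1 - u l < ds.
  by move=> l1; have := hmesh _ (leq_trans l1 N1N); rewrite !lt_min => /and3P[].
have mesh_k l : (l < N)%N -> u l.+1 - u l < dk.
  by move=> /hmesh; rewrite !lt_min => /and3P[].
have [u0 uN ult] := pu; have [_ uN1 _] := pu1.
have uT l : (l <= N)%N -> 0 <= u l <= T.
  by move=> /(partition_itv pu)/andP[-> /le_trans->].
pose x l (w : cpath R d) := (w (u l.+1) ord0 i - w (u l) ord0 i) * (w (u l.+1) ord0 j - w (u l) ord0 j).
have hx l : (l < N)%N -> Lip_upto T (x l).
  by move=> lN; apply: LipM; apply: LipB; apply: Lip_path; apply: uT => //; exact: ltnW.
pose S m w := \sum_(l < m) x l w.
have hS m : (m <= N)%N -> Lip_upto T (S m).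
  by move=> mN; apply: Lip_sum => // l; apply: hx; exact: leq_trans mN.
have near_Q r m (rT : 0 <= r <= T) : (m <= N)%N ->
    EG Ehat (fun k w => `|Q r k w - S m w| ^+ 2) < e / 12 ->
    \forall k \near \oo, Ehat (fun w => (Q r k w - S m w) ^+ 2) < e / 12.
  move=> mN hEG.
  have hSm : LG Ehat 2 T (fun k w => (S m w)%:M : 'rV[R]_1).
    apply: LG_seq_cst => // l; have := hS m mN; congr (Lip_upto _).
    by apply/funext => w; rewrite (ord1 l) mxE eqxx mulr1n.
  have hD := LG_sub HE T0 (p := 2) isT (hLG r rT) hSm.
  have hE' k : (fun w => enorm ((Q r k w)%:M - (S m w)%:M : 'rV[R]_1) ^+ 2)
     = (fun w => (Q r k w - S m w) ^+ 2).
    by apply/funext => w; rewrite -raddfB enorm_scalar real_normK ?num_real.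
  have := EG_lt_near HE T0 (p := 2) (c := e / 12) isT hD.
  have -> : EG Ehat (fun k w => enorm ((Q r k w)%:M - (S m w)%:M : 'rV[R]_1) ^+ 2)
    = EG Ehat (fun k w => `|Q r k w - S m w| ^+ 2).
    by congr EG; apply/funext => k; apply/funext => w; rewrite -raddfB enorm_scalar.
  move=> /(_ hEG); apply: filterS => k; by rewrite hE'.
have tT' : 0 <= t <= T by rewrite t0.
have sT' : 0 <= s <= T by rewrite s0.
have ht := near_Q t N tT' (leqnn N) (hdt N u pu mesh_t).
have hs := near_Q s N1 sT' N1N (hds N1 u pu1 mesh_s).
near=> k.
have htk : Ehat (fun w => (Q t k w - S N w) ^+ 2) < e / 12 by near: k.
have hsk : Ehat (fun w => (Q s k w - S N1 w) ^+ 2) < e / 12 by near: k.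
rewrite sub0r normrN ger0_norm//.
pose Y w := Num.max (\sum_(N1 <= l < N) (enorm ((w : cpath R d) (u l.+1) - w (u l)) ^+ 2 - s2 * (u l.+1 - u l))) 0.
have hYE : Ehat (fun w => Y w ^+ 2) <= e / 12.
  apply: le_trans (E_sqr_increments pu N1N (leqnn N)) _.
  apply: (@le_trans _ _ (kap * (dk * t))).
    rewrite ler_wpM2l// (@big_nat_widenl _ _ _ N1 0)// big_mkord.
    apply: (@le_trans _ _ (\sum_(l < N) dk * (u l.+1 - u l))).
      rewrite big_mkcond/=; apply: ler_sum => l _.
      have ul : 0 <= u l.+1 - u l by rewrite subr_ge0; exact/ltW/ult.
      case: ifP => _; last by rewrite mulr_ge0// ltW.
      by rewrite expr2 ler_wpM2r// ltW// mesh_k.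
    by rewrite -mulr_sumr -(big_mkord xpredT (fun l => u l.+1 - u l)) telescope_sumr// u0 uN subr0.
  rewrite /dk; have -> : kap * (e / 12 / (kap * t + 1) * t) = e / 12 * (kap * t / (kap * t + 1)) by ring.
  rewrite ger_pMr// ler_pdivrMr// mul1r; lra.
have hYL : Lip_upto T Y.
  rewrite /Y; apply: Lip_max; last exact: Lip_cst.
  under eq_fun do rewrite (@big_nat_widenl _ _ _ N1 0)// big_mkord big_mkcond/=.
  apply: Lip_sum => // l; case: (N1 <= l)%N; last exact: Lip_cst.
  have hw : vLip T (fun w : cpath R d => w (u l.+1) - w (u l)).
    by apply: vLipB; apply: vLip_path; apply: uT => //; exact: ltnW.
  lip.
have hQt := hL t k tT'; have hQs := hL s k sT'; have hSN := hS N (leqnn N); have hSN1 := hS N1 N1N.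
pose sq : seq (R * (cpath R d -> R)) := [:: (3, fun w => (Q t k w - S N w) ^+ 2);
  (3, fun w => (Q s k w - S N1 w) ^+ 2); (3, fun w => Y w ^+ 2)].
have main : Ehat (fun w => Num.max (`|Q t k w - Q s k w| - s2 * (t - s)) 0 ^+ 2) <=
   \sum_(x <- sq) x.1 * Ehat x.2.
  apply: (E_comb HE T0).
  - lip.
  - by rewrite /=; repeat split; solve [lip].
  move=> w; rewrite !big_cons big_nil/=.
  have Y0 : 0 <= Y w by rewrite le_max lexx orbT.
  have hSd : `|S N w - S N1 w| <= Y w + s2 * (t - s).
    rewrite /S -(big_mkord xpredT (x^~ w)) -(big_mkord xpredT (x^~ w)) (big_cat_nat (leq0n _) N1N)/= addrAC subrr add0r.
    apply: le_trans (ler_norm_sum _ _ _) _.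
    have -> : t - s = \sum_(N1 <= l < N) (u l.+1 - u l) by rewrite telescope_sumr// uN uN1.
    rewrite mulr_sumr -lerBlDr; apply: le_trans (_ : _ <= \sum_(N1 <= l < N) (enorm (w (u l.+1) - w (u l)) ^+ 2 - s2 * (u l.+1 - u l))) _; last by rewrite le_max lexx.
    rewrite -sumrB; apply: ler_sum => l _; rewrite lerD2r /x normrM expr2.
    have hi := normr_le_enorm (w (u l.+1) - w (u l)) ord0 i.
    have hj := normr_le_enorm (w (u l.+1) - w (u l)) ord0 j.
    by move: hi hj; rewrite !mxE => hi hj; apply: ler_pM.
  set a := Q t k w - S N w; set b := Q s k w - S N1 w.
  have hm : Num.max (`|Q t k w - Q s k w| - s2 * (t - s)) 0 <= `|a| + `|b| + Y w.
    rewrite ge_max; apply/andP; split; last by rewrite !addr_ge0.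
    have -> : Q t k w - Q s k w = a - b + (S N w - S N1 w) by rewrite /a /b; ring.
    have := ler_normD (a - b) (S N w - S N1 w); have := ler_normB a b; lra.
  have hm0 : 0 <= Num.max (`|Q t k w - Q s k w| - s2 * (t - s)) 0 by rewrite le_max lexx orbT.
  apply: (@le_trans _ _ ((`|a| + `|b| + Y w) ^+ 2)).
    by rewrite ler_sqr// nnegrE !addr_ge0.
  rewrite -(@real_normK _ a) ?num_real// -(@real_normK _ b) ?num_real//.
  have := sqr_ge0 (`|a| - `|b|); have := sqr_ge0 (`|a| - Y w); have := sqr_ge0 (`|b| - Y w); nra.
apply: le_lt_trans main _; rewrite !big_cons big_nil/=; lra.
Unshelve. all: by end_near. Qed.

End Bracket.

(** * Simple processes and time integrals *)

Section SimpleProcesses.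
Context {R : realType} {d : nat} (Ehat : (cpath R d -> R) -> R).
Hypothesis HE : sublinear_expectation Lip Ehat.

Lemma partition_lt M (u : nat -> R) t i j : Defs.partition M u t ->
  (i <= M)%N -> (j <= M)%N -> (u i < u j) = (i < j)%N.
Proof.
move=> pu iM jM; case: (ltnP i j) => ij.
  have [_ _ h] := pu; apply: lt_le_trans (h i (leq_trans ij jM)) _.
  exact: (partition_le pu).
by apply/negbTE; rewrite -leNgt; exact: (partition_le pu).
Qed.

(** Nodes beyond t are ignored, so that a simple process on [0, T] can be compared on [0, t] with
    one that lives there. *)
Definition refines n M (u : nat -> R) t (s : @simple_process R d n) : Prop :=
  forall i, (i <= sp_size s)%N -> sp_time s i <= t -> exists2 j, (j <= M)%N & u j = sp_time s i.

Section Grid.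
Variables (n p : nat) (S t : R) (s : @simple_process R d n) (M : nat) (u : nat -> R).
Hypothesis p12 : (p == 1)%N || (p == 2)%N.
Hypothesis hs : is_simple Ehat p S s.
Hypothesis pu : Defs.partition M u t.
Hypothesis href : refines M u t s.

Lemma refines_le i j r : (i < M)%N -> (j <= sp_size s)%N -> u i <= r -> r < u i.+1 ->
  (sp_time s j <= r) = (sp_time s j <= u i).
Proof.
move=> iM js ur ru; apply/idP/idP => h; last exact: le_trans ur.
have /andP[_ ut] := partition_itv pu iM.
have [m mM um] := href js (le_trans (ltW (le_lt_trans h ru)) ut).
rewrite -um; apply: (partition_le pu); last exact: ltnW.
by rewrite -ltnS -(partition_lt pu)// um (le_lt_trans h).
Qed.

Lemma sp_process_cell i r : (i < M)%N -> u i <= r -> r < u i.+1 ->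
  sp_process s r = sp_process s (u i).
Proof.
move=> iM ur ru; apply/funext => k; apply/funext => w; apply: eq_bigr => j _.
rewrite (@refines_le i j r)// 1?ltnW//.
by rewrite 2!ltNge (@refines_le i j.+1 r).
Qed.

Lemma LG_sp_process r : 0 <= r -> LG Ehat p r (sp_process s r).
Proof.
move=> r0; apply: (LG_sum HE r0) => // j.
case: (boolP (sp_time s j <= r < sp_time s j.+1)) => [/andP[jr _]|_].
  exact: LG_mono jr (hs.2 j (ltn_ord j)).
apply: LG_cst => //; by case/orP: p12 => /eqP->.
Qed.

(** Within a cell of [s] the increments of A over the finer grid telescope. On a common grid the
    integrals of different simple processes can then be subtracted term by term. *)
Lemma sp_integral_isum (A : R -> rseq R d) : S = t ->
  sp_integral A s = isum A M u (fun i => sp_process s (u i)).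
Proof.
move=> St; apply/funext => k; apply/funext => w; rewrite /sp_integral /isum /sp_process.
under [RHS]eq_bigr do rewrite scaler_sumr.
rewrite exchange_big/=; apply: eq_bigr => j _.
have [[s0 sS slt] _] := hs.
have sle i : (i <= sp_size s)%N -> sp_time s i <= t.
  by move=> iN; rewrite -St; have /andP[] := partition_itv hs.1 iN.
have [a aM ua] := href (ltnW (ltn_ord j)) (sle _ (ltnW (ltn_ord j))).
have [b bM ub] := href (ltn_ord j) (sle _ (ltn_ord j)).
have ab : (a < b)%N by rewrite -(partition_lt pu)// ua ub; exact: slt.
rewrite -ua -ub.
transitivity ((\sum_(i < M | (a <= i < b)%N) (A (u i.+1) k w - A (u i) k w)) *: sp_coef s j k w).
  congr (_ *: _).
  rewrite -(big_mkord (fun i => (a <= i < b)%N) (fun i => A (u i.+1) k w - A (u i) k w)).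
  rewrite -(telescope_sumr (fun i => A (u i) k w) (ltnW ab)).
  rewrite (@big_nat_widen _ _ _ a b M)// (@big_nat_widenl _ _ _ a 0)//.
  by apply: eq_bigl => i; rewrite andbC.
rewrite scaler_suml big_mkcond/=; apply: eq_bigr => i _.
rewrite leNgt (partition_lt pu (ltnW (ltn_ord i)) aM) -leqNgt (partition_lt pu (ltnW (ltn_ord i)) bM).
by case: ifP => _; rewrite ?scaler0.
Qed.

End Grid.

(** Four processes, two for each integrand: one on [0, t] coming from its integral, one on [0, T]
    coming from its membership in M_G^2. *)
Lemma common_grid n1 (s1 s2 s3 s4 : @simple_process R d n1) t : 0 <= t ->
  (forall s, [\/ s = s1, s = s2, s = s3 | s = s4] -> exists S, Defs.partition (sp_size s) (sp_time s) S) ->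
  exists M u, Defs.partition M u t /\
    forall s, [\/ s = s1, s = s2, s = s3 | s = s4] -> refines M u t s.
Proof.
move=> t0 hs; pose tm (s : @simple_process R d n1) := [seq sp_time s i | i <- iota 0 (sp_size s).+1].
pose l := [seq x <- tm s1 ++ tm s2 ++ tm s3 ++ tm s4 | 0 <= x <= t].
have [M [u [pu hu]]] : exists (M : nat) (u : nat -> R),
    Defs.partition M u t /\ forall x, x \in l -> exists2 j, (j <= M)%N & u j = x.
  by apply: partition_exists => // x; rewrite mem_filter => /andP[].
exists M, u; split => // s hs' i iN it; apply: hu; rewrite mem_filter it andbT.
have [S pS] := hs s hs'; have /andP[h0 _] := partition_itv pS iN; rewrite h0 andTb.
have him : sp_time s i \in tm s by apply: map_f; rewrite mem_iota.
by rewrite !mem_cat; case: hs' => sE; rewrite sE in him *; rewrite him ?orbT.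
Qed.

End SimpleProcesses.

(** * Lebesgue integrals of step functions *)

Section StepIntegral.
Context {R : realType}.
Local Notation mu := (@lebesgue_measure R).

Lemma lebesgue_measure_bounds (a b : R) : a <= b ->
  mu [set` `[a, b[] = (b - a)%:E.
Proof.
rewrite lebesgue_measure_itv/= lte_fin le_eqVlt => /orP[/eqP->|->].
  by rewrite ltxx subrr.
by rewrite EFinB.
Qed.

Lemma step_integral_aux (f : R -> R) M (u : nat -> R) t : Defs.partition M u t ->
  (forall i r, (i < M)%N -> u i <= r -> r < u i.+1 -> f r = f (u i)) ->
  (forall r, 0 <= r <= t -> 0 <= f r) -> forall m, (m <= M)%N ->
  measurable_fun `[0, u m[ f /\
  (\int[mu]_(r in `[0%R, u m[) (f r)%:E)%E = (\sum_(i < m) (u i.+1 - u i) * f (u i))%:E.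
Proof.
move=> pu fE f0; elim=> [|m IH] mM.
  have [u0 _ _] := pu; rewrite u0 set_itvco0 big_ord0 integral_set0; split => //.
  exact: measurable_fun_set0.
have [mf If] := IH (ltnW mM).
have um : u m <= u m.+1 by exact: (partition_le pu).
have /andP[um0 _] := partition_itv pu (ltnW mM).
have E : [set` `[0, u m.+1[] = [set` `[0, u m[] `|` [set` `[u m, u m.+1[].
  by rewrite -itv_bndbnd_setU// bnd_simp.
have mf' : measurable_fun `[u m, u m.+1[ f.
  apply: (@eq_measurable_fun _ _ _ _ _ (cst (f (u m)))) => // r.
  by rewrite inE/= in_itv/= => /andP[h1 h2]; rewrite (fE m r).
have mfU : measurable_fun ([set` `[0, u m[] `|` [set` `[u m, u m.+1[]) f.
  by apply/measurable_funU => //; exact: measurable_itv.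
rewrite E; split => //.
rewrite ge0_integral_setU//=; last first.
- apply/disj_setPS => r [/=]; rewrite !in_itv/= => /andP[_ h1] /andP[h2 _].
  by have := lt_le_trans h1 h2; rewrite ltxx.
- move=> r [] /=; rewrite !in_itv/= => /andP[h1 h2]; rewrite lee_fin f0//.
    have /andP[_ h3] := partition_itv pu (ltnW mM).
    by rewrite h1 (le_trans (ltW h2)).
  have /andP[_ h3] := partition_itv pu mM.
  by rewrite (le_trans um0 h1) (le_trans (ltW h2)).
- exact/measurable_EFinP.
rewrite If big_ord_recr/= EFinD; congr (_ + _)%E.
rewrite (@eq_integral _ _ _ _ _ (cst (f (u m))%:E)); last first.
  by move=> r; rewrite inE/= in_itv/= => /andP[h1 h2]; rewrite (fE m r).
by rewrite integral_cst//= lebesgue_measure_bounds// -EFinM mulrC.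
Qed.

Lemma step_integral (f : R -> R) M (u : nat -> R) t : Defs.partition M u t ->
  (forall i r, (i < M)%N -> u i <= r -> r < u i.+1 -> f r = f (u i)) ->
  (forall r, 0 <= r <= t -> 0 <= f r) ->
  measurable_fun `[0, t] f /\
  (\int[mu]_(r in `[0%R, t]) (f r)%:E)%E = (\sum_(i < M) (u i.+1 - u i) * f (u i))%:E.
Proof.
move=> pu fE f0; have [mf If] := step_integral_aux pu fE f0 (leqnn M).
have [u0 uM _] := pu; rewrite uM in mf If.
have t0 : 0 <= t by have /andP[+ _] := partition_itv pu (leqnn M); rewrite uM.
have mf' : measurable_fun `[0, t] f.
  rewrite -(setUitv1 true) ?bnd_simp//; apply/measurable_funU => //.
  by split => //; exact: measurable_fun_set1.
split => //; rewrite -If integral_itv_bndo_bndc//.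
exact/measurable_EFinP.
Qed.

End StepIntegral.

(** * Inequalities for lower integrals *)

Section LowerIntegral.
Context {R : realType}.
Local Notation mu := (@lebesgue_measure R).

(* No measurability is assumed: the integral of a nonnegative function is its
   lower integral. *)
Lemma ge0_le_lower_integral (D : set R) (f g : R -> R) :
  (forall r, D r -> 0 <= f r) -> (forall r, D r -> f r <= g r) ->
  (\int[mu]_(r in D) (f r)%:E <= \int[mu]_(r in D) (g r)%:E)%E.
Proof.
move=> f0 fg; rewrite !ge0_integralE; last 2 first.
- by move=> r Dr; rewrite lee_fin; apply: le_trans (f0 r Dr) (fg r Dr).
- by move=> r Dr; rewrite lee_fin f0.
apply: ereal_sup_le => _ [h hh <-]; exists h => // r; apply: le_trans (hh r) _.
by rewrite /patch; case: ifPn => //; rewrite inE => Dr; rewrite lee_fin fg.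
Qed.

(** Measurability is asked of the dominating functions alone; [f] will be a distance of processes,
    whose lower integral is bounded by monotonicity. *)
Lemma le_integral_comb3 (D : set R) (f f1 f2 f3 : R -> R) (a b c : R) : measurable D ->
  0 <= a -> 0 <= b -> 0 <= c ->
  measurable_fun D f1 -> measurable_fun D f2 -> measurable_fun D f3 ->
  (forall r, D r -> [/\ 0 <= f r, 0 <= f1 r, 0 <= f2 r & 0 <= f3 r]) ->
  (forall r, D r -> f r <= a * f1 r + b * f2 r + c * f3 r) ->
  (\int[mu]_(r in D) (f r)%:E <= a%:E * \int[mu]_(r in D) (f1 r)%:E +
     b%:E * \int[mu]_(r in D) (f2 r)%:E + c%:E * \int[mu]_(r in D) (f3 r)%:E)%E.
Proof.
move=> mD a0 b0 c0 m1 m2 m3 h0 h.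
have f0 r : D r -> 0 <= f r by move=> /h0[].
apply: le_trans (ge0_le_lower_integral f0 h) _.
have e1 r : D r -> (0 <= (f1 r)%:E)%E by move=> /h0[*]; rewrite lee_fin.
have e2 r : D r -> (0 <= (f2 r)%:E)%E by move=> /h0[*]; rewrite lee_fin.
have e3 r : D r -> (0 <= (f3 r)%:E)%E by move=> /h0[*]; rewrite lee_fin.
have M (f' : R -> R) : measurable_fun D f' -> measurable_fun D (EFin \o f') by move=> ?; exact/measurable_EFinP.
have MZ (k : R) (f' : R -> R) : measurable_fun D f' -> measurable_fun D (fun r => (k%:E * (f' r)%:E)%E).
  by move=> mf; apply/measurable_EFinP; apply: measurable_funM => //; exact: measurable_cst.
rewrite -!ge0_integralZl_EFin//; try exact: M.
have -> : (\int[mu]_(r in D) (a * f1 r + b * f2 r + c * f3 r)%:E =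
  \int[mu]_(r in D) (a%:E * (f1 r)%:E + b%:E * (f2 r)%:E + c%:E * (f3 r)%:E))%E.
  by apply: eq_integral => r _; rewrite !EFinD !EFinM.
rewrite ge0_integralD//; last 4 first.
- by move=> r Dr; rewrite adde_ge0// mule_ge0// ?e1 ?e2.
- by apply: emeasurable_funD; exact: MZ.
- by move=> r Dr; rewrite mule_ge0// e3.
- exact: MZ.
by rewrite ge0_integralD//; try exact: MZ; move=> r Dr; rewrite mule_ge0// ?e1 ?e2.
Qed.

Lemma lte_comb3 (a b c : R) (x y z : \bar R) : 0 <= a -> 0 <= b -> 0 <= c ->
  (x < +oo -> y < +oo -> z < +oo -> a%:E * x + b%:E * y + c%:E * z < +oo)%E.
Proof.
move=> a0 b0 c0 hx hy hz.
by apply: lte_add_pinfty; [apply: lte_add_pinfty|]; apply: lte_mul_pinfty; rewrite ?lee_fin.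
Qed.

Lemma ecvg0_lt I (F : set_system I) {FF : Filter F} (f : I -> \bar R) (e : R) :
  f x @[x --> F] --> 0%E -> 0 < e -> \forall x \near F, (f x < e%:E)%E.
Proof.
move=> /fine_cvgP[h1 h2] e0; near=> x.
rewrite -[f x]fineK; last by near: x.
by rewrite lte_fin; near: x; exact: (cvgr_lt _ h2).
Unshelve. all: by end_near. Qed.

Lemma integral_cst_itv (t c : R) : 0 <= t ->
  (\int[mu]_(r in `[0%R, t]) (c%:E))%E = (c * t)%:E.
Proof.
move=> t0; rewrite integral_cst//= lebesgue_measure_itv/= lte_fin.
case: ltgtP t0 => // [_ _|<- _]; first by rewrite oppr0 adde0.
by rewrite mule0 mulr0.
Qed.

End LowerIntegral.

(** * Distances of processes and their Borel minorants *)

Section Gap.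
Context {R : realType} {d : nat} (Ehat : (cpath R d -> R) -> R).
Hypothesis HE : sublinear_expectation Lip Ehat.
Variables (T : R) (T0 : 0 <= T).
Local Notation mu := (@lebesgue_measure R).
Local Notation pdist := (pdist Ehat).

Section Pdist.
Variables (n p : nat).
Hypothesis p12 : (p == 1)%N || (p == 2)%N.
Implicit Types (a b c : @process R d n).

Lemma LG_p2 (V : vseq R d n) : LG Ehat 2 T V -> LG Ehat p T V.
Proof. by case/orP: p12 => /eqP-> //; exact: LG21. Qed.

Lemma pdistC a b t : pdist p a b t = pdist p b a t.
Proof. by congr EG; apply/funext => k; apply/funext => w; rewrite enormC. Qed.

Lemma pdist_ge0 a b t : LG Ehat p T (a t) -> LG Ehat p T (b t) -> 0 <= pdist p a b t.
Proof. by move=> ha hb; apply: (EG_ge0 HE T0 p12); exact: LG_sub. Qed.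

Lemma pdist_trans a b c t : LG Ehat p T (a t) -> LG Ehat p T (b t) -> LG Ehat p T (c t) ->
  pdist p a c t <= 2 * pdist p a b t + 2 * pdist p b c t.
Proof.
move=> ha hb hc.
have := @EG_le_comb _ _ _ HE T T0 p p p n n n (fun k w => a t k w - c t k w)
  (fun k w => a t k w - b t k w) (fun k w => b t k w - c t k w) 0 2 2 p12 p12 p12.
rewrite add0r; apply; try exact: LG_sub; rewrite ?ler0n//.
move=> k w; rewrite add0r.
have h := enorm_trans (b t k w) (a t k w) (c t k w).
have h1 := enorm_ge0 (a t k w - b t k w); have h2 := enorm_ge0 (b t k w - c t k w).
have h3 := enorm_ge0 (a t k w - c t k w).
case/orP: p12 => /eqP->; first by rewrite !expr1; lra.
have h' : enorm (a t k w - c t k w) ^+ 2 <= (enorm (a t k w - b t k w) + enorm (b t k w - c t k w)) ^+ 2.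
  by rewrite ler_sqr// nnegrE addr_ge0.
apply: le_trans h' _.
by have := sqr_ge0 (enorm (a t k w - b t k w) - enorm (b t k w - c t k w)); lra.
Qed.

(** For p = 1 this is Young's inequality, for p = 2 it is trivial. It allows L^2 approximations on
    [0, T] to be compared with the approximations of exponent p that define an integral. *)
Lemma pdist_le2 a b t theta : 0 < theta -> LG Ehat 2 T (a t) -> LG Ehat 2 T (b t) ->
  pdist p a b t <= theta + (1 + theta^-1) * pdist 2 a b t.
Proof.
move=> th0 ha hb; have hab := LG_sub HE T0 (p := 2) isT ha hb.
have ti : 0 < theta^-1 by rewrite invr_gt0.
have := @EG_le_comb _ _ _ HE T T0 p 2 2 n n n (fun k w => a t k w - b t k w)
  (fun k w => a t k w - b t k w) (fun k w => a t k w - b t k w) theta 1 theta^-1 p12 isT isT.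
rewrite -/(pdist 2 a b t) -/(pdist p a b t) => h.
have -> : theta + (1 + theta^-1) * pdist 2 a b t = theta + 1 * pdist 2 a b t + theta^-1 * pdist 2 a b t by ring.
apply: h => //.
- exact: LG_p2.
- exact: ltW.
- exact: ltW.
move=> k w; set x := enorm _; have x0 : 0 <= x by exact: enorm_ge0.
have x2 := sqr_ge0 x; have tx : 0 <= theta^-1 * x ^+ 2 by rewrite mulr_ge0 ?(ltW ti).
case/orP: p12 => /eqP->; last by rewrite mul1r; lra.
rewrite expr1 mul1r; have := young1 x th0; lra.
Qed.

End Pdist.

Lemma E1_small p : (p == 1)%N || (p == 2)%N -> forall e, 0 < e -> exists2 dl, 0 < dl &
  forall n (V : cpath R d -> 'rV[R]_n), vLip T V -> Ehat (fun w => enorm (V w) ^+ p) < dl ->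
    Ehat (fun w => enorm (V w)) < e.
Proof.
move=> /orP[]/eqP-> e e0.
  by exists e => // n V _; under eq_fun do rewrite expr1.
have e2 : 0 < e / 2 by rewrite divr_gt0.
exists ((e / 2) ^+ 2) => [|n V hV h]; first by rewrite exprn_gt0.
apply: le_lt_trans (E1_le2 HE T0 e2 hV) _.
have : (e / 2)^-1 * Ehat (fun w => enorm (V w) ^+ 2) < e / 2.
  rewrite mulrC ltr_pdivrMr// -expr2//.
lra.
Qed.

Lemma pdist_step n p (s r : @simple_process R d n) S S' t M u :
  (p == 1)%N || (p == 2)%N -> t <= T ->
  is_simple Ehat p S s -> is_simple Ehat p S' r ->
  Defs.partition M u t -> refines M u t s -> refines M u t r ->
  measurable_fun `[0, t] (pdist p (sp_process s) (sp_process r)) /\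
  (\int[mu]_(x in `[0%R, t]) (pdist p (sp_process s) (sp_process r) x)%:E)%E =
    (\sum_(i < M) (u i.+1 - u i) * pdist p (sp_process s) (sp_process r) (u i))%:E.
Proof.
move=> p12 tT hs hr pu rs rr; apply: (step_integral pu).
  move=> i x iM ux xu; rewrite /Defs.pdist.
  by rewrite (sp_process_cell pu rs iM ux xu) (sp_process_cell pu rr iM ux xu).
move=> x /andP[x0 xt]; apply: pdist_ge0 => //.
  exact: LG_mono (le_trans xt tT) (LG_sp_process HE p12 hs x0).
exact: LG_mono (le_trans xt tT) (LG_sp_process HE p12 hr x0).
Qed.

Lemma is_simple_p n p t (s : @simple_process R d n) : (p == 1)%N || (p == 2)%N -> t <= T ->
  is_simple Ehat 2 t s -> is_simple Ehat p t s.
Proof.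
move=> p12 tT [pu h]; split => // i iN; have {}h := h i iN.
have /andP[t0 _] := partition_itv pu (ltnW iN).
by case/orP: p12 => /eqP->//; exact: (LG21 HE t0).
Qed.

Section TwoProcesses.
Variables (n : nat) (eta1 eta2 : @process R d n) (r1 r2 : nat -> @simple_process R d n).
Hypotheses (h1 : forall t, 0 <= t <= T -> LG Ehat 2 T (eta1 t))
  (h2 : forall t, 0 <= t <= T -> LG Ehat 2 T (eta2 t)).
Hypotheses (hr1 : forall l, is_simple Ehat 2 T (r1 l)) (hr2 : forall l, is_simple Ehat 2 T (r2 l)).
Hypotheses (c1 : MG_cvg Ehat 2 T (fun l => sp_process (r1 l)) eta1)
  (c2 : MG_cvg Ehat 2 T (fun l => sp_process (r2 l)) eta2).
Local Notation D l := (pdist 2 (sp_process (r1 l)) (sp_process (r2 l))).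
Local Notation e1 l := (pdist 2 eta1 (sp_process (r1 l))).
Local Notation e2 l := (pdist 2 eta2 (sp_process (r2 l))).

Let LGr1 l t : 0 <= t <= T -> LG Ehat 2 T (sp_process (r1 l) t).
Proof. by move=> /andP[t0 tT]; exact: LG_mono tT (LG_sp_process HE (p := 2) isT (hr1 l) t0). Qed.

Let LGr2 l t : 0 <= t <= T -> LG Ehat 2 T (sp_process (r2 l) t).
Proof. by move=> /andP[t0 tT]; exact: LG_mono tT (LG_sp_process HE (p := 2) isT (hr2 l) t0). Qed.

(* pdist 2 eta1 eta2 need not be Borel; g is a Borel minorant, the supremum of
   the lower bounds given by the triangle inequality, with the same integral up
   to a constant. *)
Lemma gap_exists : exists g : R -> R,
  [/\ measurable_fun `[0, T] g,
      forall t, 0 <= t <= T -> 0 <= g t <= pdist 2 eta1 eta2 t,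
      (\int[mu]_(t in `[0%R, T]) (g t)%:E < +oo)%E &
      forall l t, 0 <= t <= T -> D l t <= 4 * g t + 4 * e1 l t + 4 * e2 l t].
Proof.
have D0 l t : 0 <= t <= T -> 0 <= D l t.
  by move=> tT; apply: pdist_ge0 => //; [exact: LGr1|exact: LGr2].
have e10 l t : 0 <= t <= T -> 0 <= e1 l t.
  by move=> tT; apply: pdist_ge0 => //; [exact: h1|exact: LGr1].
have e20 l t : 0 <= t <= T -> 0 <= e2 l t.
  by move=> tT; apply: pdist_ge0 => //; [exact: h2|exact: LGr2].
have p0 t : 0 <= t <= T -> 0 <= pdist 2 eta1 eta2 t.
  by move=> tT; apply: pdist_ge0 => //; [exact: h1|exact: h2].
have Dle l t : 0 <= t <= T -> D l t <= 4 * pdist 2 eta1 eta2 t + 4 * e1 l t + 4 * e2 l t.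
  move=> tT.
  have k1 := pdist_trans (p := 2) isT (LGr1 l tT) (h1 tT) (LGr2 l tT).
  have k2 := pdist_trans (p := 2) isT (h1 tT) (h2 tT) (LGr2 l tT).
  rewrite [pdist 2 (sp_process (r1 l)) eta1 t]pdistC in k1; move: k1 k2 (e10 l t tT).
  move: (D l t) (e1 l t) (e2 l t) (pdist 2 eta1 eta2 t) (pdist 2 eta1 (sp_process (r2 l)) t).
  by move=> x1 x2 x3 x4 x5; lra.
have ple l t : 0 <= t <= T -> pdist 2 eta1 eta2 t <= 4 * D l t + 4 * e1 l t + 4 * e2 l t.
  move=> tT.
  have k1 := pdist_trans (p := 2) isT (h1 tT) (LGr1 l tT) (h2 tT).
  have k2 := pdist_trans (p := 2) isT (LGr1 l tT) (LGr2 l tT) (h2 tT).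
  rewrite [pdist 2 (sp_process (r2 l)) eta2 t]pdistC in k2; move: k1 k2 (e10 l t tT).
  move: (D l t) (e1 l t) (e2 l t) (pdist 2 eta1 eta2 t) (pdist 2 (sp_process (r1 l)) eta2 t).
  by move=> x1 x2 x3 x4 x5; lra.
pose G l t := Num.max (D l t / 4 - e1 l t - e2 l t) 0.
have Gle l t : 0 <= t <= T -> G l t <= pdist 2 eta1 eta2 t.
  move=> tT; rewrite ge_max p0// andbT; move: (Dle l t tT).
  by move: (D l t) (e1 l t) (e2 l t) (pdist 2 eta1 eta2 t) => x1 x2 x3 x4; lra.
have hub t : 0 <= t <= T -> has_ubound (range (G^~ t)).
  by move=> tT; exists (pdist 2 eta1 eta2 t) => _ [l _ <-]; exact: Gle.
pose g t := sups (fun l => G l t) 0%N.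
have gE t : g t = sup (range (G^~ t)).
  by rewrite /g /sups /sdrop; congr sup; apply/seteqP; split => _ [l _ <-]; exists l.
have Gg l t : 0 <= t <= T -> G l t <= g t.
  by move=> tT; rewrite gE; apply: ub_le_sup; [exact: hub|exists l].
have mD l : measurable_fun `[0, T] (D l) /\ (\int[mu]_(t in `[0%R, T]) (D l t)%:E < +oo)%E.
  have [M [u [pu hu]]] := @common_grid R d _ (r1 l) (r2 l) (r1 l) (r2 l) T T0
    (fun s hs => ltac:(by exists T; case: hs => ->; [exact: (hr1 l).1|exact: (hr2 l).1|exact: (hr1 l).1|exact: (hr2 l).1])).
  have [m ->] := @pdist_step n 2 (r1 l) (r2 l) T T T M u isT (lexx _) (hr1 l) (hr2 l) pu
     (hu _ (Or41 _ _ _ erefl)) (hu _ (Or42 _ _ _ erefl)).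
  by split => //; exact: ltry.
have gp t : 0 <= t <= T -> 0 <= g t <= pdist 2 eta1 eta2 t.
  move=> tT; apply/andP; split.
    by apply: le_trans (Gg 0%N t tT); rewrite le_max lexx orbT.
  by rewrite gE; apply: ge_sup => [|_ [l _ <-]]; [exists (G 0%N t), 0%N|exact: Gle].
exists g; split.
- apply: measurable_fun_sups => [t|m]; first by rewrite /= in_itv/= => tT; exact: hub.
  apply: measurable_maxr => //.
  apply: measurable_funB; last exact: c2.1.
  apply: measurable_funB; last exact: c1.1.
  by apply: measurable_funM => //; exact: (mD m).1.
- exact: gp.
(* One l suffices: [ple] bounds the distance, and with it [g], by the integrable functions belonging
   to this l. *)
- have [l [l1 l2]] : exists l, (\int[mu]_(t in `[0%R, T]) (e1 l t)%:E < 1%:E)%E /\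
      (\int[mu]_(t in `[0%R, T]) (e2 l t)%:E < 1%:E)%E.
    have /= n1 := @ecvg0_lt R nat \oo (@filter_filter _ _ eventually_filter) _ _ c1.2 ltr01.
    have /= n2 := @ecvg0_lt R nat \oo (@filter_filter _ _ eventually_filter) _ _ c2.2 ltr01.
    by have [N _ hN] := filterI n1 n2; exists N; exact: hN (leqnn N).
  apply: le_lt_trans (le_integral_comb3 (f1 := D l) (f2 := e1 l) (f3 := e2 l) _ (ler0n R 4) (ler0n R 4) (ler0n R 4) _ _ _ _ _) _.
  + exact: measurable_itv.
  + exact: (mD l).1.
  + exact: c1.1.
  + exact: c2.1.
  + move=> r; rewrite /= in_itv/= => rT; have /andP[g0 _] := gp r rT.
    by split => //; [exact: D0|exact: e10|exact: e20].
  + move=> r; rewrite /= in_itv/= => rT; have /andP[_ gr] := gp r rT.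
    exact: le_trans gr (ple l r rT).
  + have i1 : (\int[mu]_(t in `[0%R, T]) (e1 l t)%:E < +oo)%E by apply: lt_trans l1 (ltry _).
    have i2 : (\int[mu]_(t in `[0%R, T]) (e2 l t)%:E < +oo)%E by apply: lt_trans l2 (ltry _).
    apply: lte_comb3; [exact: ler0n|exact: ler0n|exact: ler0n|exact: (mD l).2|exact: i1|exact: i2].
- move=> l t tT; move: (Gg l t tT); rewrite /G ge_max => /andP[+ _].
  by move: (D l t) (e1 l t) (e2 l t) (g t) => x1 x2 x3 x4; lra.
Qed.

End TwoProcesses.
End Gap.

(** * Differences of integrals *)

Section IntegralDifference.
Context {R : realType} {d : nat} (Ehat : (cpath R d -> R) -> R).
Hypothesis HE : sublinear_expectation Lip Ehat.
Variables (T : R) (T0 : 0 <= T).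
Local Notation mu := (@lebesgue_measure R).
Local Notation pdist := (pdist Ehat).

Lemma lee_comb3 (a b c x0 y0 z0 : R) (x y z : \bar R) : 0 <= a -> 0 <= b -> 0 <= c ->
  (x <= x0%:E -> y <= y0%:E -> z <= z0%:E ->
   a%:E * x + b%:E * y + c%:E * z <= (a * x0 + b * y0 + c * z0)%:E)%E.
Proof.
move=> a0 b0 c0 hx hy hz; rewrite !EFinD !EFinM.
by apply: leeD; [apply: leeD|]; apply: lee_wpmul2l; rewrite ?lee_fin.
Qed.

Lemma cvgn_lt (f : R^nat) (y z : R) : f k @[k --> \oo] --> y -> y < z ->
  \forall k \near \oo, f k < z.
Proof. by move=> /cvgr_lt; apply. Qed.

Lemma subitv (t : R) : t <= T -> [set` `[0, t]] `<=` [set` `[0, T]].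
Proof. by move=> tT r; rewrite /= !in_itv/= => /andP[-> /le_trans->]. Qed.

Lemma itv_0t t r : t <= T -> [set` `[0, t]] r -> 0 <= r <= T.
Proof. by move=> tT; rewrite /= in_itv/= => /andP[-> /le_trans->]. Qed.

Lemma Rintegral0t_fin (g : R -> R) t : 0 <= t <= T -> measurable_fun `[0, T] g ->
  (forall x, 0 <= x <= T -> 0 <= g x) -> (\int[mu]_(x in `[0%R, T]) (g x)%:E < +oo)%E ->
  (Rintegral mu `[0, t] g)%:E = (\int[mu]_(x in `[0%R, t]) (g x)%:E)%E /\
  (\int[mu]_(x in `[0%R, t]) (g x)%:E <= \int[mu]_(x in `[0%R, T]) (g x)%:E)%E.
Proof.
move=> /andP[t0 tT] mg g0 ig.
have igt : (\int[mu]_(x in `[0%R, t]) (g x)%:E <= \int[mu]_(x in `[0%R, T]) (g x)%:E)%E.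
  apply: ge0_subset_integral; [exact: measurable_itv|exact: measurable_itv| | |exact: subitv].
    exact/measurable_EFinP.
  by move=> x; rewrite /= in_itv/= => xT; rewrite lee_fin g0.
split => //; rewrite /Rintegral fineK// ge0_fin_numE; first exact: le_lt_trans igt ig.
by apply: integral_ge0 => x /(itv_0t tT) xT; rewrite lee_fin g0.
Qed.

Lemma Rintegral0t_mono (g : R -> R) s t : 0 <= s -> s <= t -> t <= T -> measurable_fun `[0, T] g ->
  (forall x, 0 <= x <= T -> 0 <= g x) -> (\int[mu]_(x in `[0%R, T]) (g x)%:E < +oo)%E ->
  0 <= Rintegral mu `[0, s] g <= Rintegral mu `[0, t] g.
Proof.
move=> s0 st tT mg g0 ig.
have sT := le_trans st tT; have t0 := le_trans s0 st.
have [E1 _] := @Rintegral0t_fin g s (introT andP (conj s0 sT)) mg g0 ig.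
have [E2 _] := @Rintegral0t_fin g t (introT andP (conj t0 tT)) mg g0 ig.
rewrite -!lee_fin E1 E2; apply/andP; split.
  by apply: integral_ge0 => x /(itv_0t sT) xT; rewrite lee_fin g0.
apply: ge0_subset_integral; [exact: measurable_itv|exact: measurable_itv| | |].
- by apply/measurable_EFinP; apply: measurable_funS mg; [exact: measurable_itv|exact: subitv].
- by move=> x /(itv_0t tT) xT; rewrite lee_fin g0.
- by move=> r; rewrite /= !in_itv/= => /andP[-> /le_trans->].
Qed.

Lemma LG_sp_T n p (S : R) (s : @simple_process R d n) x : (p == 1)%N || (p == 2)%N ->
  is_simple Ehat p S s -> 0 <= x <= T -> LG Ehat p T (sp_process s x).
Proof. by move=> p12 hs /andP[x0 xT]; exact: LG_mono xT (LG_sp_process HE p12 hs x0). Qed.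

(** Both simple processes are close to the same [eta], one in M_G^p on [0, t], the other in M_G^2 on
    [0, T]. On a common grid the integral of their distance is the Riemann sum in question. *)
Lemma close_integral n p t (eta : @process R d n) (s r : nat -> @simple_process R d n) :
  (p == 1)%N || (p == 2)%N -> 0 <= t <= T ->
  (forall t, 0 <= t <= T -> LG Ehat 2 T (eta t)) ->
  (forall l, is_simple Ehat 2 t (s l)) -> (forall l, is_simple Ehat 2 T (r l)) ->
  MG_cvg Ehat p t (fun l => sp_process (s l)) eta ->
  MG_cvg Ehat 2 T (fun l => sp_process (r l)) eta ->
  forall dl, 0 < dl -> \forall l \near \oo, forall M u, Defs.partition M u t ->
    refines M u t (s l) -> refines M u t (r l) ->
    \sum_(i < M) (u i.+1 - u i) * pdist p (sp_process (s l)) (sp_process (r l)) (u i) <= dl.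
Proof.
move=> p12 /andP[t0 tT] heta hs hr cs cr dl dl0.
(* Three contributions of at most [dl] / 3 each: the first approximation, the free term of
   [pdist_le2] integrated over [0, t], and the second approximation multiplied by [c3]. *)
pose th := dl / 6 / (T + 1).
have T1 : 0 < T + 1 by lra.
have th0 : 0 < th by rewrite !divr_gt0.
have ti0 : 0 < th^-1 by rewrite invr_gt0.
pose c3 := 1 + th^-1; have c30 : 0 < c3 by rewrite addr_gt0.
have d6 : 0 < dl / 6 by rewrite divr_gt0.
have d6' : 0 < dl / 6 / c3 by rewrite divr_gt0.
have n1 := @ecvg0_lt R nat \oo (@filter_filter _ _ eventually_filter) _ _ cs.2 d6.
have n2 := @ecvg0_lt R nat \oo (@filter_filter _ _ eventually_filter) _ _ cr.2 d6'.
have [N _ hN] := filterI n1 n2; exists N => // l Nl M u pu rs rr.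
have {hN} [/= i1 i2] := hN l Nl.
have [_ E] := pdist_step HE T0 p12 tT (is_simple_p HE p12 tT (hs l))
   (is_simple_p HE p12 (lexx T) (hr l)) pu rs rr.
have inT x : [set` `[0, t]] x -> 0 <= x <= T by exact: itv_0t.
have LGe x : 0 <= x <= T -> LG Ehat p T (eta x).
  by move=> xT; apply: (LG_p2 HE T0 p12); exact: heta.
have LGs x : 0 <= x <= T -> LG Ehat p T (sp_process (s l) x).
  by apply: (LG_sp_T p12); exact: (is_simple_p HE p12 tT (hs l)).
have LGr x : 0 <= x <= T -> LG Ehat p T (sp_process (r l) x).
  by apply: (LG_sp_T p12); exact: (is_simple_p HE p12 (lexx T) (hr l)).
have LGr2 x : 0 <= x <= T -> LG Ehat 2 T (sp_process (r l) x).
  by apply: (LG_sp_T (p := 2) isT); exact: hr.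
rewrite -lee_fin -E {E}.
apply: le_trans (_ : _ <= 2%:E * \int[mu]_(x in `[0%R, t]) (pdist p eta (sp_process (s l)) x)%:E
   + (2 * th)%:E * \int[mu]_(x in `[0%R, t]) 1%:E
   + (2 * c3)%:E * \int[mu]_(x in `[0%R, t]) (pdist 2 eta (sp_process (r l)) x)%:E)%E _.
  apply: (le_integral_comb3 (f1 := pdist p eta (sp_process (s l))) (f2 := fun=> 1)
     (f3 := pdist 2 eta (sp_process (r l)))).
  - exact: measurable_itv.
  - exact: ler0n.
  - by rewrite mulr_ge0// ltW.
  - by rewrite mulr_ge0// ltW.
  - exact: cs.1.
  - exact: measurable_cst.
  - by apply: measurable_funS (cr.1 l); [exact: measurable_itv|exact: subitv].
  - move=> x /inT xT; split => //.
    + by apply: (pdist_ge0 HE T0 p12); [exact: LGs|exact: LGr].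
    + by apply: (pdist_ge0 HE T0 p12); [exact: LGe|exact: LGs].
    + by apply: (pdist_ge0 HE T0 (p := 2) isT); [exact: heta|exact: LGr2].
  - move=> x /inT xT.
    have k1 := pdist_trans HE T0 p12 (LGs x xT) (LGe x xT) (LGr x xT).
    have k2 := pdist_le2 HE T0 p12 th0 (heta x xT) (LGr2 x xT).
    rewrite [pdist p (sp_process (s l)) eta x]pdistC in k1.
    move: k1 k2; rewrite -/c3; move: (pdist p (sp_process (s l)) (sp_process (r l)) x)
      (pdist p eta (sp_process (s l)) x) (pdist p eta (sp_process (r l)) x)
      (pdist 2 eta (sp_process (r l)) x) (c3) => x1 x2 x3 x4 c q1 q2.
    have -> : 2 * c * x4 = 2 * (c * x4) by rewrite mulrA.
    by move: q1 q2; move: (c * x4) => y; lra.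
apply: le_trans (lee_comb3 (x0 := dl / 6) (y0 := T) (z0 := dl / 6 / c3) _ _ _ _ _ _) _.
- exact: ler0n.
- by rewrite mulr_ge0// ltW.
- by rewrite mulr_ge0// ltW.
- exact: ltW.
- by rewrite integral_cst_itv// mul1r lee_fin.
- apply: le_trans (ltW i2); apply: ge0_subset_integral; [exact: measurable_itv|exact: measurable_itv| | |exact: subitv].
    by apply/measurable_EFinP; exact: cr.1.
  move=> x; rewrite /= in_itv/= => xT; rewrite lee_fin.
  by apply: (pdist_ge0 HE T0 (p := 2) isT); [exact: heta|exact: LGr2].
rewrite lee_fin.
have h1 : th * T <= dl / 6.
  rewrite /th mulrAC ler_pdivrMr// ler_wpM2l ?(ltW d6)//; lra.
have h2 : c3 * (dl / 6 / c3) = dl / 6 by rewrite mulrC divfK// gt_eqF.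
rewrite -[2 * th * T]mulrA -[2 * c3 * _]mulrA h2; lra.
Qed.

(** The Riemann sum is the integral of the distance of two step processes, which the last hypothesis
    bounds by 4 [g] plus errors that vanish in the limit; each of the two errors is made smaller
    than [dl] / 8 before its factor 4. *)
Lemma gap_integral n t (eta1 eta2 : @process R d n) (r1 r2 : nat -> @simple_process R d n) (g : R -> R) :
  0 <= t <= T ->
  (forall t, 0 <= t <= T -> LG Ehat 2 T (eta1 t)) ->
  (forall t, 0 <= t <= T -> LG Ehat 2 T (eta2 t)) ->
  (forall l, is_simple Ehat 2 T (r1 l)) -> (forall l, is_simple Ehat 2 T (r2 l)) ->
  MG_cvg Ehat 2 T (fun l => sp_process (r1 l)) eta1 ->
  MG_cvg Ehat 2 T (fun l => sp_process (r2 l)) eta2 ->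
  measurable_fun `[0, T] g -> (forall x, 0 <= x <= T -> 0 <= g x) ->
  (\int[mu]_(x in `[0%R, T]) (g x)%:E < +oo)%E ->
  (forall l x, 0 <= x <= T -> pdist 2 (sp_process (r1 l)) (sp_process (r2 l)) x <=
     4 * g x + 4 * pdist 2 eta1 (sp_process (r1 l)) x + 4 * pdist 2 eta2 (sp_process (r2 l)) x) ->
  forall dl, 0 < dl -> \forall l \near \oo, forall M u, Defs.partition M u t ->
    refines M u t (r1 l) -> refines M u t (r2 l) ->
    \sum_(i < M) (u i.+1 - u i) * pdist 2 (sp_process (r1 l)) (sp_process (r2 l)) (u i)
      <= 4 * Rintegral mu `[0, t] g + dl.
Proof.
move=> tI heta1 heta2 hr1 hr2 c1 c2 mg g0 ig hD dl dl0.
have /andP[t0 tT] := tI; have [gE _] := Rintegral0t_fin tI mg g0 ig.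
have d8 : 0 < dl / 8 by rewrite divr_gt0.
have n1 := @ecvg0_lt R nat \oo (@filter_filter _ _ eventually_filter) _ _ c1.2 d8.
have n2 := @ecvg0_lt R nat \oo (@filter_filter _ _ eventually_filter) _ _ c2.2 d8.
have [N _ hN] := filterI n1 n2; exists N => // l Nl M u pu rr1 rr2.
have {hN} [/= i1 i2] := hN l Nl.
have [_ E] := pdist_step HE T0 (p := 2) isT tT (hr1 l) (hr2 l) pu rr1 rr2.
have inT x : [set` `[0, t]] x -> 0 <= x <= T by exact: itv_0t.
have LGr1 x : 0 <= x <= T -> LG Ehat 2 T (sp_process (r1 l) x).
  by apply: (LG_sp_T (p := 2) isT); exact: hr1.
have LGr2 x : 0 <= x <= T -> LG Ehat 2 T (sp_process (r2 l) x).
  by apply: (LG_sp_T (p := 2) isT); exact: hr2.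
have sub (a : @process R d n) (r : nat -> @simple_process R d n) :
    (forall x, 0 <= x <= T -> LG Ehat 2 T (a x)) ->
    (forall x, 0 <= x <= T -> LG Ehat 2 T (sp_process (r l) x)) ->
    measurable_fun `[0, T] (pdist 2 a (sp_process (r l))) ->
    (\int[mu]_(x in `[0%R, t]) (pdist 2 a (sp_process (r l)) x)%:E <=
     \int[mu]_(x in `[0%R, T]) (pdist 2 a (sp_process (r l)) x)%:E)%E.
  move=> ha hr m; apply: ge0_subset_integral; [exact: measurable_itv|exact: measurable_itv| | |exact: subitv].
    exact/measurable_EFinP.
  move=> x; rewrite /= in_itv/= => xT; rewrite lee_fin.
  by apply: (pdist_ge0 HE T0 (p := 2) isT); [exact: ha|exact: hr].
rewrite -lee_fin -E {E}.
apply: le_trans (_ : _ <= 4%:E * \int[mu]_(x in `[0%R, t]) (g x)%:E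
   + 4%:E * \int[mu]_(x in `[0%R, t]) (pdist 2 eta1 (sp_process (r1 l)) x)%:E
   + 4%:E * \int[mu]_(x in `[0%R, t]) (pdist 2 eta2 (sp_process (r2 l)) x)%:E)%E _.
  apply: (le_integral_comb3 (f1 := g) (f2 := pdist 2 eta1 (sp_process (r1 l)))
     (f3 := pdist 2 eta2 (sp_process (r2 l)))).
  - exact: measurable_itv.
  - exact: ler0n.
  - exact: ler0n.
  - exact: ler0n.
  - by apply: measurable_funS mg; [exact: measurable_itv|exact: subitv].
  - by apply: measurable_funS (c1.1 l); [exact: measurable_itv|exact: subitv].
  - by apply: measurable_funS (c2.1 l); [exact: measurable_itv|exact: subitv].
  - move=> x /inT xT; split; last 3 first.
    + exact: g0.
    + by apply: (pdist_ge0 HE T0 (p := 2) isT); [exact: heta1|exact: LGr1].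
    + by apply: (pdist_ge0 HE T0 (p := 2) isT); [exact: heta2|exact: LGr2].
    + by apply: (pdist_ge0 HE T0 (p := 2) isT); [exact: LGr1|exact: LGr2].
  - by move=> x /inT xT; exact: hD.
apply: le_trans (lee_comb3 (x0 := Rintegral mu `[0, t] g) (y0 := dl / 8) (z0 := dl / 8) _ _ _ _ _ _) _.
- exact: ler0n.
- exact: ler0n.
- exact: ler0n.
- by rewrite gE.
- by apply: le_trans (ltW i1); apply: sub heta1 LGr1 (c1.1 l).
- by apply: le_trans (ltW i2); apply: sub heta2 LGr2 (c2.1 l).
rewrite lee_fin; move: (Rintegral _ _ _) => I; lra.
Qed.

Lemma rsum_near n q M u t (zeta : nat -> vseq R d n) : (q == 1)%N || (q == 2)%N -> 0 <= t <= T ->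
  Defs.partition M u t -> (forall i, (i < M)%N -> LG Ehat 2 T (zeta i)) ->
  forall dl, 0 < dl -> \forall k \near \oo, rsum Ehat q M u zeta k <=
    \sum_(i < M) (u i.+1 - u i) * EG Ehat (fun k w => enorm (zeta i k w) ^+ q) + dl.
Proof.
move=> q12 /andP[t0 tT] pu hz dl dl0.
have T1 : 0 < T + 1 by lra.
have d1 : 0 < dl / (T + 1) by rewrite divr_gt0.
have /near_forall_fin h (i : 'I_M) : \forall k \near \oo, Ehat (fun w => enorm (zeta i k w) ^+ q)
   < EG Ehat (fun k w => enorm (zeta i k w) ^+ q) + dl / (T + 1).
  by apply: (EG_lt_near HE T0 q12); [exact: (LG_p2 HE T0 q12 (hz i (ltn_ord i)))|rewrite ltrDl].
case: h => N _ hN; exists N => // k Nk; have {}hN := hN k Nk.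
have [u0 uM ult] := pu.
apply: (@le_trans _ _ (\sum_(i < M) ((u i.+1 - u i) * EG Ehat (fun k w => enorm (zeta i k w) ^+ q)
   + (u i.+1 - u i) * (dl / (T + 1))))).
  apply: ler_sum => i _; rewrite -mulrDr ler_wpM2l ?(ltW (hN i))// subr_ge0.
  by exact/ltW/ult.
rewrite big_split/= lerD2l -mulr_suml -(big_mkord xpredT (fun i => u i.+1 - u i)) telescope_sumr//.
rewrite u0 uM subr0 mulrC mulrAC ler_pdivrMr// ler_wpM2l ?(ltW dl0)//; lra.
Qed.

Lemma isumB n A M u (z1 z2 : nat -> vseq R d n) k w :
  isum A M u z1 k w - isum A M u z2 k w = isum A M u (fun i k w => z1 i k w - z2 i k w) k w.
Proof. by rewrite /isum -sumrB; apply: eq_bigr => i _; rewrite scalerBr. Qed.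

(** With s1, s2 the simple processes of the two integrals, Z1 - Z2 is the sum of the errors of these
    integrals, of the integrals of s1 - r1 and r2 - s2, and of the integral of r1 - r2. All but the
    last are small in L^1; the last is close to some [P] whose L^2 norm is governed by [g]. First l
    is fixed, together with a grid, and then k is sent to infinity. *)
Lemma is_integral_wclos n p A C t (eta1 eta2 : @process R d n) (r1 r2 : nat -> @simple_process R d n) (g : R -> R) Z1 Z2 :
  integrator Ehat T p A C -> 0 <= t <= T ->
  (forall t, 0 <= t <= T -> LG Ehat 2 T (eta1 t)) ->
  (forall t, 0 <= t <= T -> LG Ehat 2 T (eta2 t)) ->
  (forall l, is_simple Ehat 2 T (r1 l)) -> (forall l, is_simple Ehat 2 T (r2 l)) ->
  MG_cvg Ehat 2 T (fun l => sp_process (r1 l)) eta1 ->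
  MG_cvg Ehat 2 T (fun l => sp_process (r2 l)) eta2 ->
  measurable_fun `[0, T] g -> (forall x, 0 <= x <= T -> 0 <= g x) ->
  (\int[mu]_(x in `[0%R, T]) (g x)%:E < +oo)%E ->
  (forall l x, 0 <= x <= T -> pdist 2 (sp_process (r1 l)) (sp_process (r2 l)) x <=
     4 * g x + 4 * pdist 2 eta1 (sp_process (r1 l)) x + 4 * pdist 2 eta2 (sp_process (r2 l)) x) ->
  is_integral Ehat p A t eta1 Z1 -> is_integral Ehat p A t eta2 Z2 ->
  wclos Ehat T (fun k w => Z1 k w - Z2 k w) (C * (4 * Rintegral mu `[0, t] g)).
Proof.
move=> [p12 C0 hA] tT heta1 heta2 hr1 hr2 c1 c2 mg g0 ig hD [LZ1 [s1 [hs1 cs1 Z1E]]] [LZ2 [s2 [hs2 cs2 Z2E]]].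
have /andP[t0 tT'] := tT.
have hZ1 : LG Ehat p T Z1 by exact: LG_mono tT' LZ1.
have hZ2 : LG Ehat p T Z2 by exact: LG_mono tT' LZ2.
(* One fifth for each of the five terms in the decomposition of Z1 - Z2 - P. *)
move=> e e0; have e5 : 0 < e / 5 by rewrite divr_gt0.
have C1 : 0 < C + 1 by lra.
have [dl dl0 hdl] := E1_small HE T0 p12 e5.
pose dz := dl / 4 / (C + 1); have dz0 : 0 < dz by rewrite !divr_gt0.
pose dq := e / 4 / (C + 1); have dq0 : 0 < dq by rewrite !divr_gt0.
have Cdz : C * dz <= dl / 4.
  by rewrite /dz mulrC mulrAC ler_pdivrMr// ler_wpM2l ?divr_ge0 ?(ltW dl0)//; lra.
have Cdq : C * dq <= e / 4.
  by rewrite /dq mulrC mulrAC ler_pdivrMr// ler_wpM2l ?divr_ge0 ?(ltW e0)//; lra.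
have n1 := close_integral p12 tT heta1 hs1 hr1 cs1 c1 dz0.
have n2 := close_integral p12 tT heta2 hs2 hr2 cs2 c2 dz0.
have n3 := gap_integral tT heta1 heta2 hr1 hr2 c1 c2 mg g0 ig hD dq0.
have n4 := cvgn_lt Z1E dl0; have n5 := cvgn_lt Z2E dl0.
have [N _ hN] := filterI (filterI n1 n2) (filterI n3 (filterI n4 n5)).
have [[/= k1 k2] [/= k3 [/= k4 k5]]] := hN N (leqnn N).
set l := N in k1 k2 k3 k4 k5; clear hN n1 n2 n3 n4 n5.
have [M [u [pu hu]]] : exists M u, Defs.partition M u t /\
    forall s, [\/ s = s1 l, s = s2 l, s = r1 l | s = r2 l] -> refines M u t s.
  apply: common_grid => // s; case=> ->.
  - by exists t; exact: (hs1 l).1.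
  - by exists t; exact: (hs2 l).1.
  - by exists T; exact: (hr1 l).1.
  - by exists T; exact: (hr2 l).1.
have rs1 := hu _ (Or41 _ _ _ erefl); have rs2 := hu _ (Or42 _ _ _ erefl).
have rr1 := hu _ (Or43 _ _ _ erefl); have rr2 := hu _ (Or44 _ _ _ erefl).
have {}k1 := k1 M u pu rs1 rr1; have {}k2 := k2 M u pu rs2 rr2; have {}k3 := k3 M u pu rr1 rr2.
have ui i : (i < M)%N -> 0 <= u i by move=> /ltnW /(partition_itv pu)/andP[].
have uiT i : (i < M)%N -> u i <= T.
  by move=> /ltnW /(partition_itv pu)/andP[_ h]; exact: le_trans h tT'.
have LGu S (s : @simple_process R d n) i : is_simple Ehat 2 S s -> (i < M)%N -> LG Ehat 2 (u i) (sp_process s (u i)).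
  by move=> hs iM; apply: (LG_sp_process HE (p := 2) isT hs); exact: ui.
pose z0 i : vseq R d n := fun k w => sp_process (r1 l) (u i) k w - sp_process (r2 l) (u i) k w.
pose z1 i : vseq R d n := fun k w => sp_process (s1 l) (u i) k w - sp_process (r1 l) (u i) k w.
pose z2 i : vseq R d n := fun k w => sp_process (s2 l) (u i) k w - sp_process (r2 l) (u i) k w.
have hz0 i : (i < M)%N -> LG Ehat 2 (u i) (z0 i).
  by move=> iM; apply: (LG_sub HE (ui i iM) (p := 2) isT); [exact: LGu (hr1 l) iM|exact: LGu (hr2 l) iM].
have hz1 i : (i < M)%N -> LG Ehat 2 (u i) (z1 i).
  by move=> iM; apply: (LG_sub HE (ui i iM) (p := 2) isT); [exact: LGu (hs1 l) iM|exact: LGu (hr1 l) iM].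
have hz2 i : (i < M)%N -> LG Ehat 2 (u i) (z2 i).
  by move=> iM; apply: (LG_sub HE (ui i iM) (p := 2) isT); [exact: LGu (hs2 l) iM|exact: LGu (hr2 l) iM].
have [LI0 _ [P [hP hPk]]] := hA n M u t z0 tT pu hz0.
have [LI1 hI1 _] := hA n M u t z1 tT pu hz1.
have [LI2 hI2 _] := hA n M u t z2 tT pu hz2.
have [LS1 _ _] := hA n M u t (fun i => sp_process (s1 l) (u i)) tT pu (fun i iM => LGu _ _ _ (hs1 l) iM).
have [LS2 _ _] := hA n M u t (fun i => sp_process (s2 l) (u i)) tT pu (fun i iM => LGu _ _ _ (hs2 l) iM).
rewrite (sp_integral_isum (hs1 l) pu rs1 _ erefl) in k4.
rewrite (sp_integral_isum (hs2 l) pu rs2 _ erefl) in k5.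
have hzT i z : (i < M)%N -> LG Ehat 2 (u i) (z i) -> LG Ehat 2 T (z i : vseq R d n).
  by move=> iM; apply: LG_mono; exact: uiT.
have a1 := hI1 _ (divr_gt0 dl0 (ltr0n R 4)).
have a2 := hI2 _ (divr_gt0 dl0 (ltr0n R 4)).
have a0 := hPk _ (divr_gt0 e0 (ltr0n R 5)).
have b1 := rsum_near p12 tT pu (fun i iM => hzT i z1 iM (hz1 i iM)) dz0.
have b2 := rsum_near p12 tT pu (fun i iM => hzT i z2 iM (hz2 i iM)) dz0.
have b0 := rsum_near (q := 2) isT tT pu (fun i iM => hzT i z0 iM (hz0 i iM)) dq0.
have d1 := EG_lt_near HE T0 p12 (LG_sub HE T0 p12 LS1 hZ1) k4.
have d2 := EG_lt_near HE T0 p12 (LG_sub HE T0 p12 LS2 hZ2) k5.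
exists P; split => //.
have [N' _ hN'] := filterI (filterI a0 (filterI a1 a2)) (filterI (filterI b0 (filterI b1 b2)) (filterI d1 d2)).
exists N' => // k N'k.
have {hN'} [[/= [f1 f2] [/= f3 f4]] [[/= f5 [/= f6 f7]] [/= f8 f9]]] := hN' k N'k.
have hPk' := hP k.
have vI1 := LG_Lv LI1 k; have vI2 := LG_Lv LI2 k; have vI0 := LG_Lv LI0 k.
have vS1 := LG_Lv LS1 k; have vS2 := LG_Lv LS2 k; have vZ1 := LG_Lv hZ1 k; have vZ2 := LG_Lv hZ2 k.
have g1 : Ehat (fun w => enorm (isum A M u z1 k w)) < e / 5.
  apply: hdl => //; apply: le_lt_trans f3 _.
  have h : C * rsum Ehat p M u z1 k <= C * (dz + dz).
    by rewrite ler_wpM2l//; apply: le_trans f6 _; rewrite lerD2r; exact: k1.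
  move: h Cdz dl0; clear; move: (rsum _ _ _ _ _ _) => x; lra.
have g2 : Ehat (fun w => enorm (isum A M u z2 k w)) < e / 5.
  apply: hdl => //; apply: le_lt_trans f4 _.
  have h : C * rsum Ehat p M u z2 k <= C * (dz + dz).
    by rewrite ler_wpM2l//; apply: le_trans f7 _; rewrite lerD2r; exact: k2.
  move: h Cdz dl0; clear; move: (rsum _ _ _ _ _ _) => x; lra.
have g3 : Ehat (fun w => enorm (isum A M u (fun i => sp_process (s1 l) (u i)) k w - Z1 k w)) < e / 5.
  by apply: hdl => //; exact: vLipB.
have g4 : Ehat (fun w => enorm (isum A M u (fun i => sp_process (s2 l) (u i)) k w - Z2 k w)) < e / 5.
  by apply: hdl => //; exact: vLipB.
split; last first.
  apply: le_lt_trans f2 _.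
  have h : C * rsum Ehat 2 M u z0 k <= C * (4 * Rintegral mu `[0, t] g + dq + dq).
    by rewrite ler_wpM2l//; apply: le_trans f5 _; rewrite lerD2r.
  move: h Cdq e0; clear; move: (rsum _ _ _ _ _ _) (Rintegral _ _ _) => x y; lra.
pose sq : seq (R * (cpath R d -> R)) := [::
  (1, fun w => enorm (isum A M u (fun i => sp_process (s1 l) (u i)) k w - Z1 k w));
  (1, fun w => enorm (isum A M u (fun i => sp_process (s2 l) (u i)) k w - Z2 k w));
  (1, fun w => enorm (isum A M u z1 k w)); (1, fun w => enorm (isum A M u z2 k w));
  (1, fun w => enorm (isum A M u z0 k w - P k w))].
have main : Ehat (fun w => enorm (Z1 k w - Z2 k w - P k w)) <= \sum_(x <- sq) x.1 * Ehat x.2.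
  apply: (E_comb HE T0).
  - lip.
  - by rewrite /=; repeat split => //; lip.
  move=> w; rewrite !big_cons big_nil/= !mul1r addr0.
  set S1 := isum _ _ _ _ k w; set S2 := isum _ _ _ (fun i => sp_process (s2 l) _) k w.
  set I1 := isum _ _ _ z1 k w; set I2 := isum _ _ _ z2 k w; set I0 := isum _ _ _ z0 k w.
  have -> : Z1 k w - Z2 k w - P k w = - (S1 - Z1 k w) + ((S2 - Z2 k w) + (I1 + (- I2 + (I0 - P k w)))).
    have e12 : S1 - S2 = I1 - I2 + I0.
      rewrite /I1 /I2 /I0 /S1 /S2 /z1 /z2 /z0 -!isumB.
      by move: (isum _ _ _ _ k w) (isum _ _ _ _ k w) (isum _ _ _ _ k w) (isum _ _ _ _ k w) => x y x' y';
        apply/rowP => j; rewrite !mxE; ring.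
    have -> : S1 = S2 + (I1 - I2 + I0) by rewrite -e12 addrC subrK.
    by move: S2 I1 I2 I0 (Z1 k w) (Z2 k w) (P k w) {e12 S1} => y1 y2 y3 y4 y5 y6 y7;
      apply/rowP => j; rewrite !mxE; ring.
  apply: le_trans (enormD _ _) _; rewrite enormN lerD2l.
  apply: le_trans (enormD _ _) _; rewrite lerD2l.
  apply: le_trans (enormD _ _) _; rewrite lerD2l.
  by apply: le_trans (enormD _ _) _; rewrite enormN lerD2l.
apply: le_lt_trans main _; rewrite !big_cons big_nil/= !mul1r addr0.
move: g1 g2 g3 g4 f1; clear; move: (Ehat _) (Ehat _) (Ehat _) (Ehat _) (Ehat _) => x1 x2 x3 x4 x5; lra.
Qed.

End IntegralDifference.

(** * Random fields at random points *)

(** A cubic grid of side h / (n + 1), on which each coordinate is rounded down; the l^1 distance to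
    the rounded point bounds the Euclidean one. *)
Lemma finite_net (R : realType) n (M h : R) : 0 < M -> 0 < h ->
  exists N (y : 'I_N -> 'rV[R]_n), forall x, enorm x <= M -> exists i, enorm (x - y i) <= h.
Proof.
move=> M0 h0; pose q := h / n.+1%:R; have q0 : 0 < q by rewrite divr_gt0.
pose K := (Num.bound (M / q)).
have KM : M <= K%:R * q.
  by rewrite -ler_pdivrMr//; apply/ltW/archi_boundP; rewrite divr_ge0 ?ltW.
pose I : finType := {ffun 'I_n -> 'I_(2 * K).+1}.
pose y (i : I) : 'rV[R]_n := \row_j ((i j)%:R * q - K%:R * q).
exists #|I|, (fun i => y (enum_val i)) => x xM.
pose a j := (x ord0 j + K%:R * q) / q.
have xj j : `|x ord0 j| <= K%:R * q by apply: le_trans KM; apply: le_trans (normr_le_enorm _ _ _) xM.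
have a0 j : 0 <= a j.
  by rewrite divr_ge0 ?(ltW q0)//; have := xj j; rewrite ler_norml => /andP[]; lra.
have aK j : a j <= (2 * K)%:R.
  rewrite ler_pdivrMr// natrM -mulrA; have := xj j; rewrite ler_norml => /andP[]; lra.
have tr j : (Num.truncn (a j) < (2 * K).+1)%N.
  by rewrite ltnS -(ler_nat R); apply: le_trans (aK j); have /andP[] := truncn_itv (a0 j).
exists (enum_rank [ffun j => Ordinal (tr j)]); rewrite enum_rankK.
apply: le_trans (enorm_le_sum _) _; rewrite big_ord1.
apply: (@le_trans _ _ (\sum_(j < n) q)).
  apply: ler_sum => j _; rewrite !mxE ffunE/=.
  have /andP[t1 t2] := truncn_itv (a0 j).
  have -> : x ord0 j = a j * q - K%:R * q by rewrite /a divfK ?gt_eqF// addrK.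
  have -> : a j * q - K%:R * q - ((Num.truncn (a j))%:R * q - K%:R * q) =
     (a j - (Num.truncn (a j))%:R) * q by ring.
  rewrite normrM (gtr0_norm q0) ger_pMl// ler_norml.
  by move: t2; rewrite -natr1 => t2; apply/andP; split; lra.
rewrite sumr_const card_ord -(mulr_natl q n) /q mulrCA ger_pMr// ler_pdivrMr// mul1r.
by rewrite ler_nat.
Qed.

Section Composite.
Context {R : realType} {d : nat} (Ehat : (cpath R d -> R) -> R).
Hypothesis HE : sublinear_expectation Lip Ehat.
Variables (T : R) (T0 : 0 <= T).

Lemma LG_enorm n (V : vseq R d n) : LG Ehat 2 T V ->
  LG Ehat 2 T (fun k w => (enorm (V k w))%:M : 'rV[R]_1).
Proof.
move=> hV; have hL := LG_Lv hV; split=> [k i|e e0].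
  have hk := hL k; have -> : (fun w => ((enorm (V k w))%:M : 'rV[R]_1) ord0 i) = (fun w => enorm (V k w)).
    by apply/funext => w; rewrite (ord1 i) mxE eqxx mulr1n.
  lip.
have [N hN] := LG_cauchy hV e0; apply/near2P; exists N => k l hk hl.
have hLk := hL k; have hLl := hL l.
apply: le_lt_trans (hN k l hk hl).
have -> : (fun w => enorm ((enorm (V k w))%:M - (enorm (V l w))%:M : 'rV[R]_1) ^+ 2) =
  (fun w => `|enorm (V k w) - enorm (V l w)| ^+ 2).
  by apply/funext => w; rewrite -raddfB enorm_scalar.
apply: (E_le HE (T := T)); [lip|lip|] => w.
by rewrite ler_sqr ?nnegrE ?enorm_ge0// enorm_dist.
Qed.

(** A substitute for sqrt (q^2 + c) <= q + sqrt c that is linear in c: only the expectation of c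
    will be known to be small. *)
Lemma sqr_le_add (x q c e : R) : 0 <= x -> 0 <= q -> 0 < e -> x ^+ 2 - q ^+ 2 <= c -> 0 <= c ->
  x <= q + e + e^-1 * c.
Proof.
move=> x0 q0 e0 h c0; have ec : 0 <= e^-1 * c by rewrite mulr_ge0// invr_ge0 ltW.
rewrite -ler_sqr ?nnegrE ?addr_ge0 ?(ltW e0)//.
have : e * (e^-1 * c) = c by rewrite mulrA divff ?gt_eqF// mul1r.
move: ec; move: (e^-1 * c) => b b0 eb.
have -> : (q + e + b) ^+ 2 = q ^+ 2 + e ^+ 2 + b ^+ 2 + 2 * (q * e) + 2 * (q * b) + 2 * (e * b) by ring.
have h1 := sqr_ge0 e; have h2 := sqr_ge0 b.
have h3 : 0 <= q * e by rewrite mulr_ge0// ltW.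
have h4 : 0 <= q * b by rewrite mulr_ge0.
lra.
Qed.

(* Where |xi1| and |xi2| are at most M, both points are replaced by points of a
   finite net; [eval_at] at these points and the LGle hypothesis for pairs of them
   bound |eta - zeta| by Bd up to terms with small expectation. The part of D
   below Bd is the element m of the L^2-ball. *)
Lemma composite_dist n (f : 'rV[R]_n -> vseq R d n) (xi1 xi2 eta zeta : vseq R d n)
    (phi : R -> R) (A K : R) :
  0 <= A -> 0 <= K -> (forall x, Lv T (f x)) ->
  LG Ehat 2 T xi1 -> LG Ehat 2 T xi2 -> LG Ehat 2 T eta -> LG Ehat 2 T zeta ->
  eval_at Ehat f xi1 eta -> eval_at Ehat f xi2 zeta ->
  (forall x1 x2, LGle Ehat (fun k w => enorm (f x1 k w - f x2 k w) ^+ 2)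
     (fun _ _ => phi (enorm (x1 - x2)))) ->
  (forall r, 0 <= r -> phi r <= (A + K * r) ^+ 2) ->
  EG Ehat (fun k w => enorm (eta k w - zeta k w) ^+ 2) <=
    3 * (A ^+ 2 + K ^+ 2 * EG Ehat (fun k w => enorm (xi1 k w - xi2 k w) ^+ 2)).
Proof.
move=> A0 K0 hf hxi1 hxi2 heta hzeta ev1 ev2 hLG hphi.
have hD := LG_sub HE T0 (p := 2) isT heta hzeta.
have hxi := LG_sub HE T0 (p := 2) isT hxi1 hxi2.
pose U : vseq R d 1 := fun k w => (enorm (eta k w - zeta k w))%:M.
have hU : LG Ehat 2 T U by exact: LG_enorm.
have <- : EG Ehat (fun k w => enorm (U k w) ^+ 2) = EG Ehat (fun k w => enorm (eta k w - zeta k w) ^+ 2).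
  by congr EG; apply/funext => k; apply/funext => w; rewrite enorm_scalar ger0_norm ?enorm_ge0.
set u := EG Ehat (fun k w => enorm (xi1 k w - xi2 k w) ^+ 2).
have u0 : 0 <= u by apply: (EG_ge0 HE T0 (p := 2) isT hxi).
have KA0 : 0 <= 3 * (A ^+ 2 + K ^+ 2 * u).
  by rewrite mulr_ge0// addr_ge0 ?sqr_ge0// mulr_ge0// sqr_ge0.
apply: (wclos_EG HE T0 KA0 hU) => e e0.
pose e' := Num.min 1 (e / 100).
have e'0 : 0 < e' by rewrite lt_min ltr01 divr_gt0.
have e'1 : e' <= 1 by rewrite ge_min lexx.
have e'e : e' <= e / 100 by rewrite ge_min lexx orbT.
have e'2 : e' ^+ 2 <= e / 100.
  by apply: le_trans e'e; rewrite expr2 ler_piMl// ltW.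
have [dl1 dl10 hd1] := ev1 _ e'0; have [dl2 dl20 hd2] := ev2 _ e'0.
have [B1 [B10 hB1]] := E2_bound HE T0 hxi1.
have [B2 [B20 hB2]] := E2_bound HE T0 hxi2.
have [B3 [B30 hB3]] := E2_bound HE T0 hD.
(* The part where a point leaves the ball of radius M costs at most (B1 + B2 + B3) / M, which this
   choice makes at most e / 4. *)
pose M := (B1 + B2 + B3 + 1) * (4 / e).
have M0 : 0 < M by rewrite mulr_gt0 ?divr_gt0//; lra.
have Mi : 0 < M^-1 by rewrite invr_gt0.
(* A net point within h of the random point has cutoff at least half of dl1 or dl2, and replacing
   both points by net points changes K times their distance by at most e'. *)
pose h := Num.min (dl1 / 2) (Num.min (dl2 / 2) (e' / (2 * K + 1))).
have h0 : 0 < h.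
  by rewrite !lt_min !divr_gt0//; lra.
have hh1 : h <= dl1 / 2 by rewrite ge_min lexx.
have hh2 : h <= dl2 / 2 by rewrite !ge_min lexx orbT.
have hhK : 2 * K * h <= e'.
  have : h <= e' / (2 * K + 1) by rewrite !ge_min lexx !orbT.
  have K1 : 0 < 2 * K + 1 by lra.
  rewrite ler_pdivlMr// => hK; apply: le_trans hK; rewrite mulrC ler_wpM2l ?(ltW h0)//; lra.
have [N [y hy]] := @finite_net R n M h M0 h0.
have hL1 := LG_Lv hxi1; have hL2 := LG_Lv hxi2; have hLe := LG_Lv heta; have hLz := LG_Lv hzeta.
pose a1 i k w := Num.max (dl1 - enorm (xi1 k w - y i)) 0 * Num.max (enorm (eta k w - f (y i) k w) - e') 0.
pose a2 i k w := Num.max (dl2 - enorm (xi2 k w - y i)) 0 * Num.max (enorm (zeta k w - f (y i) k w) - e') 0.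
pose a3 i j k w := Num.max (enorm (f (y i) k w - f (y j) k w) ^+ 2 - phi (enorm (y i - y j))) 0.
have La1 i k : Lip_upto T (a1 i k).
  have q1 := hL1 k; have q2 := hLe k; have q3 := hf (y i) k; rewrite /a1; lip.
have La2 i k : Lip_upto T (a2 i k).
  have q1 := hL2 k; have q2 := hLz k; have q3 := hf (y i) k; rewrite /a2; lip.
have La3 i j k : Lip_upto T (a3 i j k).
  have q1 := hf (y i) k; have q3 := hf (y j) k; rewrite /a3; lip.
have a10 i k w : 0 <= a1 i k w by rewrite mulr_ge0// le_max lexx orbT.
have a20 i k w : 0 <= a2 i k w by rewrite mulr_ge0// le_max lexx orbT.
have a30 i j k w : 0 <= a3 i j k w by rewrite le_max lexx orbT.
pose c1 := 2 / dl1; pose c2 := 2 / dl2; pose c3 := e'^-1.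
have c10 : 0 <= c1 by rewrite /c1 divr_ge0// ltW.
have c20 : 0 <= c2 by rewrite /c2 divr_ge0// ltW.
have c30 : 0 <= c3 by rewrite invr_ge0 ltW.
pose S := c1 * N%:R + c2 * N%:R + c3 * (N%:R * N%:R) + 1.
have S0 : 0 < S.
  by rewrite /S ltr_wpDl//; apply: addr_ge0; [apply: addr_ge0|]; rewrite mulr_ge0// mulr_ge0.
pose ee := e / 4 / S; have ee0 : 0 < ee by apply: divr_gt0 => //; apply: divr_gt0.
have n1 : \forall k \near \oo, forall i, Ehat (a1 i k) < ee.
  by apply: near_forall_fin => i; exact: cvgn_lt (hd1 (y i)) ee0.
have n2 : \forall k \near \oo, forall i, Ehat (a2 i k) < ee.
  by apply: near_forall_fin => i; exact: cvgn_lt (hd2 (y i)) ee0.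
have n3 : \forall k \near \oo, forall i j, Ehat (a3 i j k) < ee.
  apply: near_forall_fin => i; apply: near_forall_fin => j.
  exact: cvgn_lt (hLG (y i) (y j)) ee0.
(* The four e' are the two evaluation errors at net points, the loss in [sqr_le_add], and the
   rounding error 2 K h. *)
pose Bd k w := 4 * e' + A + K * enorm (xi1 k w - xi2 k w).
have Bd0 k w : 0 <= Bd k w.
  by rewrite !addr_ge0// ?mulr_ge0 ?enorm_ge0// ltW.
have LBd k : Lip_upto T (Bd k).
  have q1 := hL1 k; have q2 := hL2 k; rewrite /Bd; lip.
have LD k : Lip_upto T (fun w => enorm (eta k w - zeta k w)).
  have q1 := hLe k; have q2 := hLz k; lip.
(* The minimum of the distance and [Bd], expressed by [Num.max] so that it stays in L_ip. *)
pose m k w := - Num.max (- enorm (eta k w - zeta k w)) (- Bd k w).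
have mE k w : 0 <= m k w /\ m k w <= Bd k w.
  rewrite /m; move: (Bd0 k w) (enorm_ge0 (eta k w - zeta k w)); clear.
  move: (enorm _) (Bd k w) => x z; case: (leP (- x) (- z)) => q1 q2 q3; split; lra.
have mD k w : enorm (eta k w - zeta k w) - m k w = Num.max (enorm (eta k w - zeta k w) - Bd k w) 0.
  rewrite /m; move: (enorm _) (Bd k w) => x z; clear.
  case: (leP (- x) (- z)) => q1; case: (leP (x - z) 0) => q2; lra.
exists (fun k w => (m k w)%:M); split.
  move=> k i; have -> : (fun w => ((m k w)%:M : 'rV[R]_1) ord0 i) = m k.
    by apply/funext => w; rewrite (ord1 i) mxE eqxx mulr1n.
  have q1 := LD k; have q2 := LBd k; rewrite /m; lip.
have n4 : \forall k \near \oo, Ehat (fun w => enorm (xi1 k w - xi2 k w) ^+ 2) < u + e / 4 / (3 * K ^+ 2 + 1).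
  apply: (EG_lt_near HE T0 (p := 2) isT hxi); rewrite ltrDl !divr_gt0//.
  by rewrite ltr_wpDl// mulr_ge0// sqr_ge0.
have [N' _ hN'] := filterI (filterI (filterI n1 n2) (filterI n3 n4)) (filterI hB1 (filterI hB2 hB3)).
exists N' => // k N'k.
have {hN' n1 n2 n3 n4 hB1 hB2 hB3} [[[/= f1 f2] [/= f3 f4]] [/= f5 [/= f6 f7]]] := hN' k N'k.
have q1 := hL1 k; have q2 := hL2 k; have q3 := LD k; have q4 := LBd k; have q5 := hLe k; have q6 := hLz k.
split; last first.
  have -> : (fun w => enorm ((m k w)%:M : 'rV[R]_1) ^+ 2) = (fun w => m k w ^+ 2).
    by apply/funext => w; rewrite enorm_scalar ger0_norm// (mE k w).1.
  pose sq : seq (R * (cpath R d -> R)) := [:: (3 * (4 * e') ^+ 2 + 3 * A ^+ 2, fun=> 1);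
     (3 * K ^+ 2, fun w => enorm (xi1 k w - xi2 k w) ^+ 2)].
  have K2 : 0 <= 3 * K ^+ 2 by rewrite mulr_ge0// sqr_ge0.
  have main : Ehat (fun w => m k w ^+ 2) <= \sum_(x <- sq) x.1 * Ehat x.2.
    apply: (E_comb HE T0).
    - rewrite /m; lip.
    - rewrite /=; repeat split => //; try solve [lip].
      by rewrite addr_ge0// mulr_ge0// sqr_ge0.
    move=> w; rewrite !big_cons big_nil/= addr0 mulr1.
    have [m1 m2] := mE k w.
    apply: (@le_trans _ _ (Bd k w ^+ 2)); first by rewrite ler_sqr// nnegrE.
    rewrite /Bd; move: (enorm (xi1 k w - xi2 k w)) => x {sq}.
    have s1 := sqr_ge0 (4 * e' - A); have s2 := sqr_ge0 (4 * e' - K * x); have s3 := sqr_ge0 (A - K * x).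
    have -> : 3 * (4 * e') ^+ 2 + 3 * A ^+ 2 + 3 * K ^+ 2 * x ^+ 2 =
      (4 * e' + A + K * x) ^+ 2 + (4 * e' - A) ^+ 2 + (4 * e' - K * x) ^+ 2 + (A - K * x) ^+ 2 by ring.
    by rewrite -!addrA lerDl !addr_ge0.
  apply: le_lt_trans main _; rewrite !big_cons big_nil/= addr0 (E_cst HE) mulr1.
  have g1 : 3 * K ^+ 2 * Ehat (fun w => enorm (xi1 k w - xi2 k w) ^+ 2) <= 3 * K ^+ 2 * u + e / 4.
    apply: (@le_trans _ _ (3 * K ^+ 2 * (u + e / 4 / (3 * K ^+ 2 + 1)))).
      by rewrite ler_wpM2l// ltW.
    rewrite mulrDr lerD2l mulrA ler_pdivrMr ?ltr_wpDl//.
    by rewrite mulrC ler_wpM2l ?divr_ge0 ?(ltW e0)// lerDl.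
  move: g1; move: (Ehat _) => E1; move: e'2 e0; clear; move=> e'2 e0 g1; nra.
have -> : (fun w => enorm (U k w - (m k w)%:M)) = (fun w => Num.max (enorm (eta k w - zeta k w) - Bd k w) 0).
  apply/funext => w; rewrite -raddfB enorm_scalar mD ger0_norm// le_max lexx orbT//.
pose sq : seq (R * (cpath R d -> R)) := [:: (c1, fun w => \sum_i a1 i k w); (c2, fun w => \sum_i a2 i k w);
   (c3, fun w => \sum_i \sum_j a3 i j k w); (M^-1, fun w => enorm (xi1 k w) ^+ 2);
   (M^-1, fun w => enorm (xi2 k w) ^+ 2); (M^-1, fun w => enorm (eta k w - zeta k w) ^+ 2)].
have Ls1 : Lip_upto T (fun w => \sum_i a1 i k w) by exact: Lip_sum.
have Ls2 : Lip_upto T (fun w => \sum_i a2 i k w) by exact: Lip_sum.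
have Ls3 : Lip_upto T (fun w => \sum_i \sum_j a3 i j k w).
  by apply: Lip_sum => // i; exact: Lip_sum.
have main : Ehat (fun w => Num.max (enorm (eta k w - zeta k w) - Bd k w) 0) <= \sum_(x <- sq) x.1 * Ehat x.2.
  apply: (E_comb HE T0).
  - lip.
  - by rewrite /=; repeat split => //; try solve [lip]; exact: ltW.
  move=> w; rewrite !big_cons big_nil/= addr0.
  set D := enorm (eta k w - zeta k w); have D0 : 0 <= D by exact: enorm_ge0.
  have t1 : 0 <= c1 * \sum_i a1 i k w by rewrite mulr_ge0// sumr_ge0.
  have t2 : 0 <= c2 * \sum_i a2 i k w by rewrite mulr_ge0// sumr_ge0.
  have t3 : 0 <= c3 * \sum_i \sum_j a3 i j k w.
    by rewrite mulr_ge0// sumr_ge0// => i _; rewrite sumr_ge0.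
  have t4 : 0 <= M^-1 * enorm (xi1 k w) ^+ 2 by rewrite mulr_ge0 ?sqr_ge0// ltW.
  have t5 : 0 <= M^-1 * enorm (xi2 k w) ^+ 2 by rewrite mulr_ge0 ?sqr_ge0// ltW.
  have t6 : 0 <= M^-1 * D ^+ 2 by rewrite mulr_ge0 ?sqr_ge0// ltW.
  (* Chebyshev's inequality in pointwise form: for x > M one has M D <= x D <= x^2 + D^2. *)
  have big x : M < x -> D <= M^-1 * x ^+ 2 + M^-1 * D ^+ 2.
    move=> Mx; rewrite -mulrDr mulrC ler_pdivlMr//.
    move: M0 Mx D0 (sqr_ge0 (x - D)) (ltW (lt_trans M0 Mx)); clear; move: (D) (M) => z y; nra.
  have Y0 : Num.max (D - Bd k w) 0 <= D.
    by rewrite ge_max D0 andbT gerBl.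
  have [x1M|x1M] := ltP M (enorm (xi1 k w)).
    apply: le_trans Y0 _; have := big _ x1M; move: t1 t2 t3 t4 t5 t6; clear.
    move: (c1 * _) (c2 * _) (c3 * _) (M^-1 * _) (M^-1 * _) (M^-1 * _) => z1 z2 z3 z4 z5 z6; lra.
  have [x2M|x2M] := ltP M (enorm (xi2 k w)).
    apply: le_trans Y0 _; have := big _ x2M; move: t1 t2 t3 t4 t5 t6; clear.
    move: (c1 * _) (c2 * _) (c3 * _) (M^-1 * _) (M^-1 * _) (M^-1 * _) => z1 z2 z3 z4 z5 z6; lra.
  have [i hi] := hy _ x1M; have [j hj] := hy _ x2M.
  have s1 : c1 * a1 i k w <= c1 * \sum_i a1 i k w.
    by rewrite ler_wpM2l// (bigD1 i)//= lerDl sumr_ge0.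
  have s2 : c2 * a2 j k w <= c2 * \sum_i a2 i k w.
    by rewrite ler_wpM2l// (bigD1 j)//= lerDl sumr_ge0.
  have s3 : c3 * a3 i j k w <= c3 * \sum_i \sum_j a3 i j k w.
    rewrite ler_wpM2l// (bigD1 i)//= (bigD1 j)//= -addrA lerDl addr_ge0//; first by rewrite sumr_ge0.
    by rewrite sumr_ge0// => i' _; rewrite sumr_ge0.
  (* Where the cutoff is at least dl / 2, dividing by it recovers the excess of z over e' from the
     product in [eval_at]. *)
  have tile (dl x z : R) : 0 < dl -> x <= h -> h <= dl / 2 ->
      z <= e' + 2 / dl * (Num.max (dl - x) 0 * Num.max (z - e') 0).
    move=> dl0 xh hdl.
    have m1 : dl / 2 <= Num.max (dl - x) 0 by rewrite le_max; apply/orP; left; rewrite lerBrDr -lerBrDl {1}(splitr dl) addrK (le_trans xh).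
    have m2 : 0 <= Num.max (z - e') 0 by rewrite le_max lexx orbT.
    have m3 : z - e' <= Num.max (z - e') 0 by rewrite le_max lexx.
    have m4 : Num.max (z - e') 0 <= 2 / dl * (Num.max (dl - x) 0 * Num.max (z - e') 0).
      rewrite mulrA -[leLHS]mul1r ler_wpM2r//.
      apply: (@le_trans _ _ (2 / dl * (dl / 2))); last by rewrite ler_wpM2l// divr_ge0// ltW.
      by have -> : 2 / dl * (dl / 2) = 1; [field; rewrite gt_eqF|].
    by rewrite -lerBlDl; exact: le_trans m3 m4.
  have b1 : enorm (eta k w - f (y i) k w) <= e' + c1 * a1 i k w by exact: tile.
  have b2 : enorm (zeta k w - f (y j) k w) <= e' + c2 * a2 j k w by exact: tile.
  have b3 : enorm (f (y i) k w - f (y j) k w) <= (A + K * enorm (y i - y j)) + e' + c3 * a3 i j k w.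
    apply: sqr_le_add => //; first exact: enorm_ge0.
      by rewrite addr_ge0// mulr_ge0// enorm_ge0.
    apply: le_trans (_ : _ <= enorm (f (y i) k w - f (y j) k w) ^+ 2 - phi (enorm (y i - y j))) _.
      by rewrite lerB// hphi// enorm_ge0.
    by rewrite le_max lexx.
  have b4 : K * enorm (y i - y j) <= K * enorm (xi1 k w - xi2 k w) + e'.
    have b5 : enorm (y i - y j) <= h + enorm (xi1 k w - xi2 k w) + h.
      apply: le_trans (enorm_trans (xi2 k w) _ _) _; apply: lerD => //.
      apply: le_trans (enorm_trans (xi1 k w) _ _) _; rewrite lerD2r enormC//.
    apply: (@le_trans _ _ (K * (h + enorm (xi1 k w - xi2 k w) + h))); first by rewrite ler_wpM2l.
    move: hhK; clear; move: (enorm _) => x; lra.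
  have b6 : D <= enorm (eta k w - f (y i) k w) + enorm (f (y i) k w - f (y j) k w) + enorm (zeta k w - f (y j) k w).
    apply: le_trans (enorm_trans (f (y j) k w) _ _) _; rewrite [enorm (f (y j) k w - _)]enormC lerD2r.
    exact: enorm_trans.
  rewrite ge_max; apply/andP; split; last by rewrite !addr_ge0.
  rewrite /Bd; move: b1 b2 b3 b4 b6 s1 s2 s3 t4 t5 t6; clear.
  move: (c1 * a1 _ _ _) (c2 * a2 _ _ _) (c3 * a3 _ _ _ _) => z1 z2 z3.
  move: (c1 * _) (c2 * _) (c3 * _) (M^-1 * _) (M^-1 * _) (M^-1 * _) => z4 z5 z6 z7 z8 z9.
  move: (enorm _) (enorm _) (enorm _) (K * _) (K * _) => y1 y2 y3 y4 y5; lra.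
apply: le_lt_trans main _; rewrite !big_cons big_nil/= addr0.
have g1 : c1 * Ehat (fun w => \sum_i a1 i k w) <= c1 * (N%:R * ee).
  rewrite ler_wpM2l//; apply: le_trans (E_sum HE T0 (fun i => La1 i k)) _.
  apply: (@le_trans _ _ (\sum_(i < N) ee)); first by apply: ler_sum => i _; exact: ltW.
  by rewrite sumr_const card_ord -(mulr_natl ee N).
have g2 : c2 * Ehat (fun w => \sum_i a2 i k w) <= c2 * (N%:R * ee).
  rewrite ler_wpM2l//; apply: le_trans (E_sum HE T0 (fun i => La2 i k)) _.
  apply: (@le_trans _ _ (\sum_(i < N) ee)); first by apply: ler_sum => i _; exact: ltW.
  by rewrite sumr_const card_ord -(mulr_natl ee N).
have g3 : c3 * Ehat (fun w => \sum_i \sum_j a3 i j k w) <= c3 * (N%:R * (N%:R * ee)).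
  rewrite ler_wpM2l//; apply: le_trans (E_sum HE T0 (fun i => Lip_sum _ T0 (fun j => La3 i j k))) _.
  apply: (@le_trans _ _ (\sum_(i < N) (N%:R * ee))).
    apply: ler_sum => i _; apply: le_trans (E_sum HE T0 (fun j => La3 i j k)) _.
    apply: (@le_trans _ _ (\sum_(i < N) ee)); first by apply: ler_sum => j _; exact: ltW.
    by rewrite sumr_const card_ord -(mulr_natl ee N).
  by rewrite sumr_const card_ord -(mulr_natl (N%:R * ee) N).
have g4 : c1 * (N%:R * ee) + c2 * (N%:R * ee) + c3 * (N%:R * (N%:R * ee)) <= e / 4.
  have -> : c1 * (N%:R * ee) + c2 * (N%:R * ee) + c3 * (N%:R * (N%:R * ee)) = (S - 1) * ee by rewrite /S; ring.
  rewrite /ee mulrCA ger_pMr ?divr_gt0// ler_pdivrMr// mul1r; lra.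
have g5 : M^-1 * Ehat (fun w => enorm (xi1 k w) ^+ 2) + (M^-1 * Ehat (fun w => enorm (xi2 k w) ^+ 2)
    + M^-1 * Ehat (fun w => enorm (eta k w - zeta k w) ^+ 2)) <= e / 4.
  rewrite -!mulrDr mulrC ler_pdivrMr//.
  have -> : e / 4 * M = B1 + B2 + B3 + 1 by rewrite /M; field; rewrite gt_eqF.
  move: f5 f6 f7; clear; move: (Ehat _) (Ehat _) (Ehat _) => z1 z2 z3; lra.
move: g1 g2 g3 g4 g5 e0; clear.
move: (c1 * Ehat _) (c2 * Ehat _) (c3 * Ehat _) (M^-1 * _) (M^-1 * _) (M^-1 * _) => z1 z2 z3 z4 z5 z6.
move: (c1 * _) (c2 * _) (c3 * _) => z7 z8 z9; lra.
Qed.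

End Composite.

(** * Osgood's lemma *)

Lemma integrable_mul_nondecreasing (R : realType) (T : R) (a f : R -> R) :
  (forall t, 0 <= t <= T -> 0 <= a t) ->
  (@lebesgue_measure R).-integrable `[0, T] (EFin \o a) ->
  {homo f : s t / s <= t} -> (forall s, 0 <= f s) ->
  (@lebesgue_measure R).-integrable `[0, T] (EFin \o (fun s => a s * f s)).
Proof.
move=> a0 ia fmono f0.
apply: (@le_integrable _ _ _ lebesgue_measure _ _ _ (fun r => (f T)%:E * (a r)%:E)%E) => //.
- apply/measurable_EFinP; apply: measurable_funM.
    by move/integrableP : ia => [/measurable_EFinP].
  by apply: nondecreasing_measurable => //; exact: measurable_itv.
- move=> r /= rT; have ar : 0 <= a r by apply: a0; move: rT; rewrite in_itv.
  rewrite ?lee_fin !normrM (ger0_norm ar) !ger0_norm// mulrC ler_wpM2r//.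
  by apply: fmono; move: rT; rewrite in_itv/= => /andP[].
- exact: integrableZl.
Qed.

Section Osgood.
Context {R : realType}.
Variable rho : R -> R.
Local Notation mu := (@lebesgue_measure R).
Hypothesis rho_gt0 : forall r, 0 < r -> 0 < rho r.
Hypothesis rho_cont : {in `]0, +oo[, continuous rho}.
Hypothesis rho_mono : forall r s, 0 < r -> r <= s -> rho r <= rho s.
Hypothesis rho_concave : forall r s l, 0 < r -> 0 < s -> 0 <= l <= 1 ->
    l * rho r + (1 - l) * rho s <= rho (l * r + (1 - l) * s).
Hypothesis rho_div : (\int[mu]_(r in `]0%R, 1%R[) ((rho r)^-1)%:E = +oo)%E.

(* Concavity with the auxiliary point u/2, whence the factor 2. *)
Lemma concave_affine_bound u r : 0 < u -> 0 < r -> rho r <= rho u * (1 + 2 * (r / u)).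
Proof.
move=> u0 r0; have ru := rho_gt0 u0; have rr := rho_gt0 r0.
have q0 : 0 < r / u by rewrite divr_gt0.
have [ur|ur] := leP r u.
  by apply: le_trans (rho_mono r0 ur) _; rewrite ler_peMr ?(ltW ru)//; lra.
have u2 : 0 < u / 2 by rewrite divr_gt0.
have den : 0 < r - u / 2 by lra.
(* The weight for which u = l r + (1 - l) u / 2; it is at least u / (2 r). *)
pose l := (u / 2) / (r - u / 2).
have l0 : 0 < l by rewrite divr_gt0.
have l1 : l <= 1 by rewrite ler_pdivrMr// mul1r; lra.
have := rho_concave r0 u2 (l := l); rewrite l1 (ltW l0) => /(_ isT).
have -> : l * r + (1 - l) * (u / 2) = u by rewrite /l; field; rewrite !gt_eqF//; lra.
have h1 : 0 <= (1 - l) * rho (u / 2) by rewrite mulr_ge0 ?subr_ge0// ltW// rho_gt0.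
move=> h2; have h3 : l * rho r <= rho u by lra.
have h4 : (u / (2 * r)) * rho r <= rho u.
  apply: le_trans h3; rewrite ler_wpM2r ?(ltW rr)// /l.
  have -> : u / (2 * r) = (u / 2) / r by field; rewrite gt_eqF.
  rewrite ler_wpM2l ?(ltW u2)// lef_pV2 ?posrE//; lra.
have h5 : rho r <= rho u * (2 * (r / u)).
  rewrite -(ler_pM2l (x := u / (2 * r))); last by rewrite divr_gt0// mulr_gt0.
  apply: le_trans h4 _; rewrite le_eqVlt; apply/orP; left; apply/eqP.
  by field; rewrite !gt_eqF.
rewrite mulrDr mulr1; lra.
Qed.

(** * Divergence of 1 / rho along dyadic levels *)

Section DyadicLevels.
Variables (eta : R) (eta0 : 0 < eta) (eta1 : eta < 1).

Definition level (j : nat) : R := eta / 2 ^+ j.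

Lemma level_gt0 j : 0 < level j.
Proof. by rewrite divr_gt0// exprn_gt0. Qed.

Lemma levelS j : level j = 2 * level j.+1.
Proof. by rewrite /level exprS; field; rewrite expf_neq0. Qed.

Definition level_sum J : R := \sum_(j < J) level j.+1 / rho (level j).

Lemma measurable_rhoV (D : set R) : measurable D -> D `<=` `]0, +oo[ ->
  measurable_fun D (EFin \o (fun r => (rho r)^-1)).
Proof.
move=> mD DI; apply/measurable_EFinP.
have m0 : measurable_fun (`]0, +oo[%classic : set R) (fun r => (rho r)^-1).
  apply: open_continuous_measurable_fun; first exact: interval_open.
  move=> r; rewrite inE/= in_itv/= andbT => r0; apply: cvgV.
    by apply: lt0r_neq0; apply: rho_gt0.
  by apply: rho_cont; rewrite in_itv/= andbT.
by apply: measurable_funS m0 => //; exact: measurable_itv.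
Qed.

(** On each dyadic interval 1 / rho is largest at the left end, and [concave_affine_bound] with
    ratio 2 gives rho (2 r) <= 5 rho r, whence the factor 5. *)
Lemma integral_rhoV_levels J :
  (\int[mu]_(r in `]level J, eta]) ((rho r)^-1)%:E <= (5 * level_sum J)%:E)%E.
Proof.
elim: J => [|J IH].
  by rewrite /level expr0 divr1 set_itvoc0 integral_set0 /level_sum big_ord0 mulr0.
have lJ := level_gt0 J; have lJ1 := level_gt0 J.+1; have lE := levelS J.
have lJeta : level J <= eta.
  by rewrite /level ler_pdivrMr ?exprn_gt0// ler_peMr ?(ltW eta0)// exprn_ege1// ler1n.
have -> : [set` `]level J.+1, eta]] = [set` `]level J.+1, level J]] `|` [set` `]level J, eta]].
  by rewrite -itv_bndbnd_setU// bnd_simp//; lra.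
rewrite ge0_integral_setU//=; last 3 first.
- apply: measurable_rhoV; first exact: measurableU.
  by move=> r []/=; rewrite !in_itv/= andbT => /andP[h _]; apply: lt_trans h.
- move=> r h; rewrite lee_fin invr_ge0 ltW// rho_gt0//.
  by case: h => /=; rewrite !in_itv/= => /andP[h _]; apply: lt_trans h.
- apply/disj_setPS => r [/=]; rewrite !in_itv/= => /andP[_ h1] /andP[h2 _].
  by have := le_lt_trans h1 h2; rewrite ltxx.
rewrite /level_sum big_ord_recr/= mulrDr EFinD addeC; apply: leeD; last exact: IH.
have r1 := rho_gt0 lJ1; have r0 := rho_gt0 lJ.
apply: (@le_trans _ _ (\int[mu]_(r in `]level J.+1, level J]) ((rho (level J.+1))^-1)%:E)%E).
  apply: (@ge0_le_lower_integral R _ (fun r => (rho r)^-1) (fun=> (rho (level J.+1))^-1)).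
    by move=> r /=; rewrite in_itv/= => /andP[h _]; rewrite invr_ge0 ltW// rho_gt0// (lt_trans _ h).
  move=> r /=; rewrite in_itv/= => /andP[h _].
  by rewrite lef_pV2 ?posrE// ?rho_gt0 ?(lt_trans lJ1)//; apply: rho_mono => //; exact: ltW.
rewrite integral_cst//= lebesgue_measure_itv/= lte_fin.
have -> : level J.+1 < level J by lra.
rewrite -EFinB -EFinM lee_fin.
have -> : level J - level J.+1 = level J.+1 by lra.
have h := concave_affine_bound lJ1 lJ.
have e2 : level J / level J.+1 = 2 by rewrite lE mulfK// gt_eqF.
have h5 : rho (level J) <= 5 * rho (level J.+1) by rewrite e2 in h; lra.
have h6 : (rho (level J.+1))^-1 <= 5 / rho (level J).
  by rewrite ler_pdivlMr// mulrC -ler_pdivlMr ?invr_gt0// invrK.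
apply: (@le_trans _ _ (5 / rho (level J) * level J.+1)); first by rewrite ler_wpM2r// ltW.
by rewrite le_eqVlt; apply/orP; left; apply/eqP; ring.
Qed.

(** Bounded sums would make 1 / rho integrable on ]0, eta] by monotone convergence; on ]eta, 1[ it
    is at most 1 / rho(eta), so its integral over ]0, 1[ would be finite. *)
Lemma level_sum_unbounded B : exists J, B < level_sum J.
Proof.
apply/not_existsP => /= hB.
have {}hB J : level_sum J <= B by rewrite leNgt; apply/negP/hB.
have pos (r : R) : 0 < r -> (0 <= ((rho r)^-1)%:E)%E.
  by move=> r0; rewrite lee_fin invr_ge0 ltW// rho_gt0.
have sub0 J : [set` `]level J, eta]] `<=` [set` `]0, +oo[].
  by move=> r; rewrite /= !in_itv/= andbT => /andP[h _]; apply: lt_trans h; exact: level_gt0.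
have cov : \bigcup_J [set` `]level J, eta]] = [set` `]0, eta]].
  apply/seteqP; split => r /=.
    by move=> [J _]; rewrite /= !in_itv/= => /andP[h ->]; rewrite (lt_trans _ h)// level_gt0.
  rewrite in_itv/= => /andP[r0 re]; exists (Num.bound (eta / r)) => //=.
  rewrite in_itv/= re andbT /level ltr_pdivrMr ?exprn_gt0// mulrC -ltr_pdivrMr//.
  apply: lt_trans (archi_boundP _) _; first by rewrite divr_ge0// ltW.
  by rewrite -natrX ltr_nat ltn_expl.
have lim : (\int[mu]_(r in `]level J, eta]) ((rho r)^-1)%:E)%E @[J --> \oo] -->
   (\int[mu]_(r in `]0%R, eta]) ((rho r)^-1)%:E)%E.
  rewrite -cov; apply: ge0_nondecreasing_set_cvg_integral.
  - move=> i j ij; apply/subsetPset => r; rewrite /= !in_itv/= => /andP[h ->]; rewrite andbT.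
    apply: le_lt_trans h; rewrite /level ler_wpM2l ?(ltW eta0)// lef_pV2 ?posrE ?exprn_gt0//.
    by rewrite ler_weXn2l// ler1n.
  - by move=> i; exact: measurable_itv.
  - by move=> i; apply: measurable_rhoV => //; exact: measurable_itv.
  - by move=> i r /sub0; rewrite /= in_itv/= andbT => /pos.
have le1 : (\int[mu]_(r in `]0%R, eta]) ((rho r)^-1)%:E <= (5 * B)%:E)%E.
  rewrite -(cvg_lim _ lim)//; apply: lime_le; first by apply/cvg_ex; eexists; exact: lim.
  apply: nearW => J; apply: le_trans (integral_rhoV_levels J) _.
  by rewrite lee_fin ler_wpM2l.
have le2 : (\int[mu]_(r in `]eta, 1%R[) ((rho r)^-1)%:E <= ((rho eta)^-1 * (1 - eta))%:E)%E.
  apply: (@le_trans _ _ (\int[mu]_(r in `]eta, 1%R[) ((rho eta)^-1)%:E)%E).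
    apply: (@ge0_le_lower_integral R _ (fun r => (rho r)^-1) (fun=> (rho eta)^-1)) => r /=;
      rewrite in_itv/= => /andP[h _].
      by rewrite invr_ge0 ltW// rho_gt0// (lt_trans _ h).
    have r0 := lt_trans eta0 h; rewrite lef_pV2 ?posrE ?rho_gt0//.
    by apply: rho_mono => //; exact: ltW.
  by rewrite integral_cst//= lebesgue_measure_itv/= lte_fin eta1 -EFinB -EFinM.
have : (\int[mu]_(r in `]0%R, 1%R[) ((rho r)^-1)%:E < +oo)%E; last by rewrite rho_div ltxx.
have -> : [set` `]0%R, 1%R[] = [set` `]0%R, eta]] `|` [set` `]eta, 1%R[].
  by rewrite -itv_bndbnd_setU// bnd_simp// ltW.
rewrite ge0_integral_setU//=; last 3 first.
- apply: measurable_rhoV; first exact: measurableU.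
  by move=> x []/=; rewrite !in_itv/= andbT => /andP[h _] //; apply: lt_trans h.
- move=> r h; apply: pos.
  by case: h => /=; rewrite !in_itv/= => /andP[h _] //; apply: lt_trans h.
- apply/disj_setPS => r [/=]; rewrite !in_itv/= => /andP[_ h1] /andP[h2 _].
  by have := le_lt_trans h1 h2; rewrite ltxx.
by apply: lte_add_pinfty; [exact: le_lt_trans le1 (ltry _)|exact: le_lt_trans le2 (ltry _)].
Qed.

End DyadicLevels.

(* To pass from level j.+1 to level j, the majorant V = c + K \int a rho(v) needs
   an increase of K \int a of at least level j.+1 / rho (level j). These costs have
   a divergent sum, so from a small enough c it does not reach eta by time T. *)
Lemma osgood (T K : R) (a : R -> R) : 0 <= T -> 0 <= K ->
  (forall t, 0 <= t <= T -> 0 <= a t) -> mu.-integrable `[0, T] (EFin \o a) ->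
  forall eta, 0 < eta -> exists2 c0, 0 < c0 & forall (c : R) (v : R -> R), 0 < c -> c <= c0 ->
    {homo v : s t / s <= t} -> (forall s, 0 < v s) ->
    (forall t, 0 <= t <= T -> v t <= c + K * Rintegral mu `[0, t] (fun s => a s * rho (v s))) ->
    v T <= eta.
Proof.
move=> T0 K0 a0 ia eta'.
(* The divergence is stated on ]0, 1[, so the levels have to start below 1. *)
wlog: eta' / eta' < 1 => [wl|eta1 eta0].
  move=> e0; pose e := Num.min eta' (1 / 2).
  have [||c0 c00 h] := wl e; first by rewrite gt_min; apply/orP; right; lra.
    by rewrite lt_min e0; lra.
  exists c0 => // c v h1 h2 h3 h4 h5; apply: le_trans (h c v h1 h2 h3 h4 h5) _.
  by rewrite ge_min lexx.
set eta := eta' in eta0 eta1 *.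
pose m t := K * Rintegral mu `[0, t] a.
(* Descending J levels costs more than the total mass [m T]; the threshold for c is the level
   reached after J steps. *)
have [J hJ] := level_sum_unbounded eta0 eta1 (m T).
exists (level eta J) => [|c v c0 cJ vmono v0 hv]; first exact: level_gt0.
rewrite leNgt; apply/negP => vT.
pose F s := a s * rho (v s).
have inT t r : 0 <= t <= T -> [set` `[0, t]] r -> 0 <= r <= T.
  by move=> /andP[_ tT]; rewrite /= in_itv/= => /andP[-> /le_trans->].
have rv s : 0 < rho (v s) by exact: rho_gt0.
have rvmono s t : s <= t -> rho (v s) <= rho (v t).
  by move=> st; apply: rho_mono => //; exact: vmono.
have iF : mu.-integrable `[0, T] (EFin \o F).
  by apply: (@integrable_mul_nondecreasing R T a (fun s => rho (v s))) => // s; exact: ltW.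
have sub t : 0 <= t <= T -> [set` `[0, t]] `<=` [set` `[0, T]].
  by move=> tT r /(inT t r tT); rewrite /= in_itv.
(* Unlike v, this majorant is continuous, so the intermediate value theorem finds times at which it
   equals a given level; no chain rule is needed. *)
pose V t := c + K * Rintegral mu `[0, t] F.
have Vcont t : 0 <= t <= T -> {within `[0, t], continuous V}.
  move=> tT; have h : {within `[0, T], continuous V}.
    have hc := parameterized_integral_continuous T0 iF.
    move=> x; apply: cvgD; first exact: cvg_cst.
    by apply: cvgM; [exact: cvg_cst|exact: hc].
  exact: continuous_subspaceW (sub t tT) h.
have diff (G : R -> R) s t : mu.-integrable `[0, T] (EFin \o G) -> 0 <= s -> s <= t -> t <= T ->
    Rintegral mu `[0, t] G - Rintegral mu `[0, s] G = Rintegral mu `]s, t] G.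
  move=> iG s0 st tT; apply: Rintegral_itvB; rewrite ?bnd_simp//.
  by apply: integrableS iG => //; apply: sub; rewrite tT (le_trans s0).
have subst s t : 0 <= s -> t <= T -> [set` `]s, t]] `<=` [set` `[0, T]].
  by move=> s0 tT r; rewrite /= !in_itv/= => /andP[/ltW/(le_trans s0)-> /le_trans->].
(* On ]s, t] one has v <= v(t) <= V(t), so rho (V t) comes out of the integral. *)
have Vm s t : 0 <= s -> s <= t -> t <= T -> V t - V s <= rho (V t) * (m t - m s).
  move=> s0 st tT; have tT' : 0 <= t <= T by rewrite tT (le_trans s0).
  have -> : V t - V s = K * (Rintegral mu `[0, t] F - Rintegral mu `[0, s] F) by rewrite /V; ring.
  rewrite /m -mulrBr !diff// mulrCA ler_wpM2l//.
  have isa : mu.-integrable `]s, t] (EFin \o a) by apply: integrableS ia => //; exact: subst.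
  have isF : mu.-integrable `]s, t] (EFin \o F) by apply: integrableS iF => //; exact: subst.
  rewrite -RintegralZl//; apply: le_Rintegral => //.
    have -> : EFin \o (fun x => rho (V t) * a x) = (fun x => (rho (V t))%:E * (EFin \o a) x)%E.
      by apply/funext => x /=; rewrite EFinM.
    exact: integrableZl.
  move=> r rst; have /= := subst s t s0 tT r rst; rewrite in_itv/= => rT.
  rewrite /F mulrC ler_wpM2r ?a0//; apply: rho_mono => //.
  apply: le_trans (hv t tT'); apply: vmono.
  by move: rst; rewrite /= in_itv/= => /andP[].
have mmono s t : 0 <= s -> s <= t -> t <= T -> m s <= m t.
  move=> s0 st tT; rewrite /m -subr_ge0 -mulrBr diff// mulr_ge0// Rintegral_ge0// => r.
  by move=> /(subst s t s0 tT)/=; rewrite in_itv/= => /a0.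
have m0 : m 0 = 0 by rewrite /m set_itv1 Rintegral_set1 mulr0.
have V0 : V 0 = c by rewrite /V set_itv1 Rintegral_set1 mulr0 addr0.
(* Going back in time from T, where V exceeds eta, V meets the levels one after another, each
   descent consuming its cost in m. After J levels the consumed mass would exceed [m T]. *)
suff /(_ J (leqnn J)) [t [tT _ hS]] : forall j, (j <= J)%N -> exists t,
    [/\ 0 <= t <= T, V t = level eta j & level_sum eta j <= m T - m t].
  have /andP[t0 tT'] := tT; have := mmono 0 t (lexx 0) t0 tT'; rewrite m0 => mt.
  by have := lt_le_trans hJ hS; rewrite ltNge gerBl mt.
have lJ j : (j <= J)%N -> c <= level eta j.
  move=> jJ; apply: le_trans cJ _.
  by rewrite /level ler_wpM2l ?(ltW eta0)// lef_pV2 ?posrE ?exprn_gt0// ler_weXn2l// ler1n.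
have ivt t r : 0 <= t <= T -> c <= r -> r <= V t -> exists2 s, 0 <= s <= t & V s = r.
  move=> tT cr rV; have /andP[t0 _] := tT.
  have [|s sI sE] := @IVT R V 0 t r t0 (Vcont t tT).
    by rewrite V0 ge_min cr/= le_max rV orbT.
  by exists s => //; move: sI; rewrite in_itv.
elim=> [|j IH] jJ.
  have TT : 0 <= T <= T by rewrite T0 lexx.
  have [|s sI sE] := ivt T (level eta 0) TT (lJ 0%N (leq0n J)).
    rewrite /level expr0 divr1; apply: ltW; apply: lt_le_trans vT _.
    by apply: hv; rewrite T0 lexx.
  exists s; split => //; rewrite /level_sum big_ord0 subr_ge0.
  by have /andP[s0 sT] := sI; apply: mmono.
have [t [tT Vt hS]] := IH (ltnW jJ).
have le_l : level eta j.+1 <= V t.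
  by rewrite Vt (levelS eta j); have := level_gt0 eta0 j.+1; lra.
have [s sI sE] := ivt t (level eta j.+1) tT (lJ _ jJ) le_l.
have /andP[s0 st] := sI; have /andP[t0 tT'] := tT.
exists s; split => //; first by rewrite s0 (le_trans st).
rewrite /level_sum big_ord_recr/=.
have h := Vm s t s0 st tT'.
have e1 : V t - V s = level eta j.+1 by rewrite Vt sE (levelS eta j); lra.
rewrite e1 Vt in h.
have h2 : level eta j.+1 / rho (level eta j) <= m t - m s.
  by rewrite ler_pdivrMr ?rho_gt0 ?level_gt0// mulrC.
rewrite /level_sum in hS; lra.
Qed.

End Osgood.

(** * Distance of two solutions *)

Section MainEstimates.
Context {R : realType} {d : nat} (Ehat : (cpath R d -> R) -> R).
Hypothesis HE : sublinear_expectation Lip Ehat.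
Variables (T : R) (T0 : 0 <= T).
Local Notation mu := (@lebesgue_measure R).
Local Notation pdist := (pdist Ehat).

(** [pd2] is controlled through its lower integral only. The positive part of (g - C m) / D is a
    measurable function below [pd2], and the inequality is integrated with it instead. *)
Lemma gap_bound (g m pd1 pd2 : R -> R) (C D dl : R) : 0 <= C -> 0 < D ->
  measurable_fun `[0, T] g -> (\int[mu]_(x in `[0%R, T]) (g x)%:E < +oo)%E ->
  mu.-integrable `[0, T] (EFin \o m) ->
  (forall x, 0 <= x <= T -> [/\ 0 <= g x, g x <= pd1 x, 0 <= m x, 0 <= pd2 x &
     pd1 x <= C * m x + D * pd2 x]) ->
  (\int[mu]_(x in `[0%R, T]) (pd2 x)%:E <= dl%:E)%E ->
  forall t, 0 <= t <= T ->
    Rintegral mu `[0, t] g <= C * Rintegral mu `[0, t] m + D * dl.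
Proof.
move=> C0 D0 mg ig im h hd t tT; have /andP[t0 tT'] := tT.
have mm : measurable_fun `[0, T] m by move/integrableP : im => [/measurable_EFinP].
have g0 x : 0 <= x <= T -> 0 <= g x by move=> /h[].
have m0 x : 0 <= x <= T -> 0 <= m x by move=> /h[].
have imf : (\int[mu]_(x in `[0%R, T]) (m x)%:E < +oo)%E.
  move/integrableP : im => [_]; apply: le_lt_trans; rewrite le_eqVlt; apply/orP; left; apply/eqP.
  apply: eq_integral => x; rewrite inE => /(itv_0t (lexx T)) xT /=.
  by rewrite ger0_norm// m0.
pose q x := Num.max (D^-1 * (g x - C * m x)) 0.
have q0 x : 0 <= q x by rewrite le_max lexx orbT.
have mq : measurable_fun `[0, T] q.
  apply: measurable_maxr => //; apply: measurable_funM => //.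
  by apply: measurable_funB => //; apply: measurable_funM.
have qpd x : 0 <= x <= T -> q x <= pd2 x.
  move=> /h[h1 h2 h3 h4 h5]; rewrite ge_max h4 andbT mulrC ler_pdivrMr//; lra.
have iqT : (\int[mu]_(x in `[0%R, T]) (q x)%:E <= dl%:E)%E.
  apply: le_trans hd; apply: ge0_le_lower_integral => x /(itv_0t (lexx T)) xT //.
  exact: qpd.
have iqf : (\int[mu]_(x in `[0%R, T]) (q x)%:E < +oo)%E by apply: le_lt_trans iqT (ltry _).
have [Eg _] := Rintegral0t_fin tT mg g0 ig.
have [Em _] := Rintegral0t_fin tT mm m0 imf.
have [Eq lq] := Rintegral0t_fin tT mq (fun x _ => q0 x) iqf.
rewrite -lee_fin Eg.
apply: le_trans (_ : _ <= C%:E * \int[mu]_(x in `[0%R, t]) (m x)%:E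
   + D%:E * \int[mu]_(x in `[0%R, t]) (q x)%:E + 0%:E * \int[mu]_(x in `[0%R, t]) (q x)%:E)%E _.
  apply: (le_integral_comb3 (f1 := m) (f2 := q) (f3 := q)).
  - exact: measurable_itv.
  - exact: C0.
  - exact: ltW.
  - exact: lexx.
  - by apply: measurable_funS mm; [exact: measurable_itv|exact: subitv].
  - by apply: measurable_funS mq; [exact: measurable_itv|exact: subitv].
  - by apply: measurable_funS mq; [exact: measurable_itv|exact: subitv].
  - by move=> x /(itv_0t tT') xT; split => //; [exact: g0|exact: m0].
  - move=> x /(itv_0t tT') xT; rewrite mul0r addr0.
    have : D^-1 * (g x - C * m x) <= q x by rewrite le_max lexx.
    by rewrite mulrC ler_pdivrMr//; lra.
rewrite mul0e adde0 -Em -Eq -!EFinM -EFinD lee_fin lerD2l ler_wpM2l ?(ltW D0)//.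
by rewrite -lee_fin Eq; exact: le_trans lq iqT.
Qed.

(** The order of quantifiers matters: one [g] serves for every t and every integrator, so that the
    bounds are integrals of one function over growing intervals. *)
Lemma coef_gap n (eta1 eta2 : @process R d n) : MG Ehat 2 T eta1 -> MG Ehat 2 T eta2 ->
  exists g : R -> R, [/\ measurable_fun `[0, T] g,
    forall t, 0 <= t <= T -> 0 <= g t <= pdist 2 eta1 eta2 t,
    (\int[mu]_(t in `[0%R, T]) (g t)%:E < +oo)%E &
    forall p A C t Z1 Z2, integrator Ehat T p A C -> 0 <= t <= T ->
      is_integral Ehat p A t eta1 Z1 -> is_integral Ehat p A t eta2 Z2 ->
      wclos Ehat T (fun k w => Z1 k w - Z2 k w) (C * (4 * Rintegral mu `[0, t] g))].
Proof.
move=> [h1 [r1 [hr1 c1]]] [h2 [r2 [hr2 c2]]].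
have [g [mg gp ig hD]] := gap_exists HE T0 h1 h2 hr1 hr2 c1 c2.
have g0 x : 0 <= x <= T -> 0 <= g x by move=> /gp /andP[].
exists g; split => // p A C t Z1 Z2 hA tT.
exact: (is_integral_wclos HE T0 hA tT h1 h2 hr1 hr2 c1 c2 mg g0 ig hD).
Qed.

Lemma LGle_trans (U U' : rseq R d) (c : cpath R d -> R) :
  (forall k, Lip_upto T (U k)) -> (forall k, Lip_upto T (U' k)) -> Lip_upto T c ->
  (forall k w, U' k w <= U k w) -> LGle Ehat U (fun=> c) -> LGle Ehat U' (fun=> c).
Proof.
move=> hU hU' hc h hLG.
apply: (@squeeze_cvgr _ _ _ _ (fun=> 0) (fun k => Ehat (fun w => Num.max (U k w - c w) 0))).
- apply: nearW => k; have q1 := hU k; have q2 := hU' k; apply/andP; split.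
    by apply: (E_ge0 HE (T := T)); [lip|move=> w; rewrite le_max lexx orbT].
  apply: (E_le HE (T := T)); [lip|lip|] => w.
  rewrite ge_max; apply/andP; split; last by rewrite le_max lexx orbT.
  by rewrite le_max lerD2r h.
- exact: cvg_cst.
- exact: hLG.
Qed.

Section Coefficient.
Variable rho : R -> R.
Hypothesis rho_gt0 : forall r, 0 < r -> 0 < rho r.
Hypothesis rho_mono : forall r s, 0 < r -> r <= s -> rho r <= rho s.
Hypothesis rho_concave : forall r s l, 0 < r -> 0 < s -> 0 <= l <= 1 ->
    l * rho r + (1 - l) * rho s <= rho (l * r + (1 - l) * s).
Hypothesis rho0 : rho 0 = 0.

(** With A and K as chosen, [concave_affine_bound] at u gives alpha^2 rho(r^2) <= A^2 + K^2 r^2 <=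
    (A + K r)^2, as [composite_dist] requires. Its conclusion 3 (A^2 + K^2 u) is then 3 (1 + 2)
    alpha^2 rho(u). *)
Lemma coef_pdist n (alpha u s : R) (f : 'rV[R]_n -> vseq R d n) (X1 X2 eta zeta : @process R d n) :
  0 < u -> 0 <= alpha -> (forall x, Lv T (f x)) ->
  LG Ehat 2 T (X1 s) -> LG Ehat 2 T (X2 s) -> LG Ehat 2 T (eta s) -> LG Ehat 2 T (zeta s) ->
  eval_at Ehat f (X1 s) (eta s) -> eval_at Ehat f (X2 s) (zeta s) ->
  (forall x1 x2, LGle Ehat (fun k w => enorm (f x1 k w - f x2 k w) ^+ 2)
     (fun _ _ => alpha ^+ 2 * rho (enorm (x1 - x2) ^+ 2))) ->
  pdist 2 X1 X2 s <= u -> pdist 2 eta zeta s <= 9 * (alpha ^+ 2 * rho u).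
Proof.
move=> u0 al0 hf hX1 hX2 heta hzeta ev1 ev2 hLG hu.
have ru := rho_gt0 u0.
pose A := alpha * Num.sqrt (rho u); pose K := alpha * Num.sqrt (2 * (rho u / u)).
have A0 : 0 <= A by rewrite mulr_ge0// sqrtr_ge0.
have K0 : 0 <= K by rewrite mulr_ge0// sqrtr_ge0.
have A2 : A ^+ 2 = alpha ^+ 2 * rho u by rewrite exprMn sqr_sqrtr// ltW.
have K2 : K ^+ 2 = alpha ^+ 2 * (2 * (rho u / u)).
  by rewrite exprMn sqr_sqrtr// mulr_ge0// divr_ge0// ltW.
have := @composite_dist R d Ehat HE T T0 n f (X1 s) (X2 s) (eta s) (zeta s)
  (fun r => alpha ^+ 2 * rho (r ^+ 2)) A K A0 K0 hf hX1 hX2 heta hzeta ev1 ev2 hLG.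
move=> H; apply: le_trans (H _) _.
  move=> r; rewrite le_eqVlt => /orP[/eqP<-|r0].
    by rewrite expr0n/= rho0 !mulr0 addr0 sqr_ge0.
  have r20 : 0 < r ^+ 2 by rewrite exprn_gt0.
  have h := concave_affine_bound rho_gt0 rho_mono rho_concave u0 r20.
  apply: (@le_trans _ _ (A ^+ 2 + (K * r) ^+ 2)).
    apply: (@le_trans _ _ (alpha ^+ 2 * (rho u * (1 + 2 * (r ^+ 2 / u))))).
      by rewrite ler_wpM2l ?sqr_ge0.
    by rewrite [(K * r) ^+ 2]exprMn A2 K2 le_eqVlt; apply/orP; left; apply/eqP; ring.
  have : 0 <= A * (K * r) by rewrite mulr_ge0// mulr_ge0// ltW.
  rewrite sqrrD; move: (A * (K * r)) (A ^+ 2) ((K * r) ^+ 2) => x y z; rewrite mulr2n; lra.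
rewrite -/(pdist 2 X1 X2 s) A2 K2.
have h : 2 * (rho u / u) * pdist 2 X1 X2 s <= 2 * rho u.
  rewrite -mulrA ler_wpM2l// mulrAC -mulrA ler_piMr ?(ltW ru)// ler_pdivrMr// mul1r//.
rewrite -mulrA -mulrDr mulrCA [9 * _]mulrCA ler_wpM2l ?sqr_ge0//.
move: h; move: (2 * (rho u / u) * _) => x; lra.
Qed.

End Coefficient.

Lemma EG_zero_near n (V : vseq R d n) e : LG Ehat 1 T V ->
  EG Ehat (fun k w => enorm (V k w)) = 0 -> 0 < e ->
  \forall k \near \oo, Ehat (fun w => enorm (V k w)) < e.
Proof.
move=> hV hE e0; apply: (EG_lt_near HE T0 (p := 1) isT hV).
by rewrite -[X in X < _]/(EG Ehat (fun k w => enorm (V k w))) hE.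
Qed.

End MainEstimates.

(** * Two solutions at a fixed time *)

Section SolutionDistance.
Context {R : realType} {d : nat} (Ehat : (cpath R d -> R) -> R).
Hypothesis HE : sublinear_expectation Lip Ehat.
Variables (T : R) (T0 : 0 <= T).

(** The equations hold in L^1, so the bounds of the terms are added inside [wclos] and become an L^2
    bound at the end. Each binary sum contributes a factor 2, each sum over an index a factor d. *)
Lemma solution_distance n (x1 x2 : 'rV[R]_n) (Y1 Y2 Ib1 Ib2 : vseq R d n)
    (Ih1 Ih2 : 'I_d -> 'I_d -> vseq R d n) (Is1 Is2 : 'I_d -> vseq R d n)
    (Kb : R) (Kh : 'I_d -> 'I_d -> R) (Ks : 'I_d -> R) :
  LG Ehat 2 T Y1 -> LG Ehat 2 T Y2 -> LG Ehat 1 T Ib1 -> LG Ehat 1 T Ib2 ->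
  (forall i j, LG Ehat 1 T (Ih1 i j)) -> (forall i j, LG Ehat 1 T (Ih2 i j)) ->
  (forall j, LG Ehat 1 T (Is1 j)) -> (forall j, LG Ehat 1 T (Is2 j)) ->
  EG Ehat (fun k w => enorm (Y1 k w -
    (x1 + Ib1 k w + \sum_i \sum_j Ih1 i j k w + \sum_j Is1 j k w))) = 0 ->
  EG Ehat (fun k w => enorm (Y2 k w -
    (x2 + Ib2 k w + \sum_i \sum_j Ih2 i j k w + \sum_j Is2 j k w))) = 0 ->
  0 <= Kb -> (forall i j, 0 <= Kh i j) -> (forall j, 0 <= Ks j) ->
  wclos Ehat T (fun k w => Ib1 k w - Ib2 k w) Kb ->
  (forall i j, wclos Ehat T (fun k w => Ih1 i j k w - Ih2 i j k w) (Kh i j)) ->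
  (forall j, wclos Ehat T (fun k w => Is1 j k w - Is2 j k w) (Ks j)) ->
  EG Ehat (fun k w => enorm (Y1 k w - Y2 k w) ^+ 2) <=
    2 * (2 * (2 * (enorm (x1 - x2) ^+ 2 + Kb) + d%:R * \sum_i (d%:R * \sum_j Kh i j))
         + d%:R * \sum_j Ks j).
Proof.
move=> hY1 hY2 hb1 hb2 hh1 hh2 hs1 hs2 E1 E2 Kb0 Kh0 Ks0 wb wh ws.
have LYs := LG_Lv (LG_sub HE T0 (p := 2) isT hY1 hY2).
have Lb : Lv T (fun k w => Ib1 k w - Ib2 k w) by exact: LG_Lv (LG_sub HE T0 (p := 1) isT hb1 hb2).
have Lh i j : Lv T (fun k w => Ih1 i j k w - Ih2 i j k w).
  exact: LG_Lv (LG_sub HE T0 (p := 1) isT (hh1 i j) (hh2 i j)).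
have Ls j : Lv T (fun k w => Is1 j k w - Is2 j k w).
  exact: LG_Lv (LG_sub HE T0 (p := 1) isT (hs1 j) (hs2 j)).
have Lhi i : Lv T (fun k w => \sum_j (Ih1 i j k w - Ih2 i j k w)).
  by move=> k; apply: vLip_sum => // j; exact: Lh.
have Lhs : Lv T (fun k w => \sum_i \sum_j (Ih1 i j k w - Ih2 i j k w)).
  by move=> k; apply: vLip_sum => // i; exact: Lhi.
have Lss : Lv T (fun k w => \sum_j (Is1 j k w - Is2 j k w)).
  by move=> k; apply: vLip_sum => // j; exact: Ls.
have Lc : Lv T (fun (_ : nat) (_ : cpath R d) => x1 - x2) by move=> k; exact: vLip_cst.
have w1 := wclosD HE T0 Lc Lb (wclos_cst HE T0 (x1 - x2)) wb.
have w2 := wclos_sum HE T0 Lhi (fun i => wclos_sum HE T0 (Lh i) (wh i)).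
have w3 := wclos_sum HE T0 Ls ws.
have L1 : Lv T (fun k w => x1 - x2 + (Ib1 k w - Ib2 k w)).
  by move=> k; apply: vLipD; [exact: vLip_cst|exact: Lb].
have L2 : Lv T (fun k w => x1 - x2 + (Ib1 k w - Ib2 k w) +
    \sum_i \sum_j (Ih1 i j k w - Ih2 i j k w)) by move=> k; apply: vLipD; [exact: L1|exact: Lhs].
have w12 := wclosD HE T0 L1 Lhs w1 w2.
have w123 := wclosD HE T0 L2 Lss w12 w3.
apply: (wclos_EG HE T0 _ (LG_sub HE T0 (p := 2) isT hY1 hY2)).
  apply: mulr_ge0 => //; apply: addr_ge0; last first.
    by apply: mulr_ge0 => //; apply: sumr_ge0 => j _.
  apply: mulr_ge0 => //; apply: addr_ge0.
    by apply: mulr_ge0 => //; rewrite addr_ge0// sqr_ge0.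
  apply: mulr_ge0 => //; apply: sumr_ge0 => i _; apply: mulr_ge0 => //.
  by apply: sumr_ge0 => j _.
have LD : Lv T (fun k w => x1 - x2 + (Ib1 k w - Ib2 k w) +
    \sum_i \sum_j (Ih1 i j k w - Ih2 i j k w) + \sum_j (Is1 j k w - Is2 j k w)).
  by move=> k; apply: vLipD; [exact: L2|exact: Lss].
apply: (wclos_trans HE T0 LD LYs _ w123) => e e0.
have p1 : (1 == 1)%N || (1 == 2)%N by [].
have LV (x : 'rV[R]_n) Y Ib (Ih : 'I_d -> 'I_d -> vseq R d n) (Is : 'I_d -> vseq R d n) :
    LG Ehat 2 T Y -> LG Ehat 1 T Ib -> (forall i j, LG Ehat 1 T (Ih i j)) -> (forall j, LG Ehat 1 T (Is j)) ->
    LG Ehat 1 T (fun k w => Y k w - (x + Ib k w + \sum_i \sum_j Ih i j k w + \sum_j Is j k w)).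
  move=> hY hIb hIh hIs; apply: (LG_sub HE T0 p1); first exact: (LG21 HE T0 hY).
  apply: (LG_add HE T0 p1); last exact: (@LG_sum _ _ _ HE T T0 1 n _ _ Is p1 hIs).
  apply: (LG_add HE T0 p1); last first.
    apply: (@LG_sum _ _ _ HE T T0 1 n _ _ (fun i k w => \sum_j Ih i j k w) p1) => i.
    exact: (@LG_sum _ _ _ HE T T0 1 n _ _ (Ih i) p1 (hIh i)).
  by apply: (LG_add HE T0 p1) => //; exact: (LG_cst HE T0).
have e2 : 0 < e / 2 by rewrite divr_gt0.
have LV1 := LV x1 _ _ _ _ hY1 hb1 hh1 hs1; have LV2 := LV x2 _ _ _ _ hY2 hb2 hh2 hs2.
have n1 := EG_zero_near HE T0 LV1 E1 e2; have n2 := EG_zero_near HE T0 LV2 E2 e2.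
have [N _ hN] := filterI n1 n2; exists N => // k Nk; have {hN} [/= k1 k2] := hN k Nk.
have q1 := LG_Lv LV1 k; have q2 := LG_Lv LV2 k; have q3 := LYs k; have q4 := LD k.
apply: (@le_lt_trans _ _ (Ehat (fun w => enorm (Y1 k w -
    (x1 + Ib1 k w + \sum_i \sum_j Ih1 i j k w + \sum_j Is1 j k w))) + Ehat (fun w => enorm (Y2 k w -
    (x2 + Ib2 k w + \sum_i \sum_j Ih2 i j k w + \sum_j Is2 j k w))))); last first.
  by move: k1 k2; move: (Ehat _) (Ehat _) => a b; lra.
apply: (E_le_D HE (T := T)).
- by apply: Lip_enorm => //; exact: vLipB.
- exact: Lip_enorm.
- exact: Lip_enorm.
move=> w; rewrite -[enorm (Y2 _ _ - _)]enormN; apply: le_trans (enormD _ _).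
rewrite le_eqVlt; apply/orP; left; apply/eqP; congr enorm.
have -> : \sum_i \sum_j (Ih1 i j k w - Ih2 i j k w) =
    \sum_i \sum_j Ih1 i j k w - \sum_i \sum_j Ih2 i j k w.
  by rewrite -sumrB; apply: eq_bigr => i _; rewrite sumrB.
rewrite sumrB.
move: (\sum_i \sum_j Ih1 i j k w) (\sum_i \sum_j Ih2 i j k w) (\sum_j Is1 j k w) (\sum_j Is2 j k w)
  (Y1 k w) (Y2 k w) (Ib1 k w) (Ib2 k w) => a1 a2 a3 a4 a5 a6 a7 a8.
by apply/rowP => j; rewrite !mxE; ring.
Qed.

End SolutionDistance.

(** * Convergence of the solutions *)

Lemma cvg_enorm (R : realType) m n (F : set_system R) {FF : ProperFilter F}
    (f : R -> 'M[R]_(m, n)) (x : 'M[R]_(m, n)) : f y @[y --> F] --> x ->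
  forall e, 0 < e -> \forall y \near F, enorm (f y - x) <= e.
Proof.
move=> fx e e0; pose N := (m * n).+1.
have N0 : 0 < N%:R :> R by rewrite ltr0n.
have d0 : 0 < e / N%:R by rewrite divr_gt0.
have /cvg_ballP/(_ _ d0) := fx; apply: filterS => y [_ h].
apply: le_trans (enorm_le_sum _) _.
apply: (@le_trans _ _ (\sum_(i < m) \sum_(j < n) e / N%:R)).
  apply: ler_sum => i _; apply: ler_sum => j _; rewrite !mxE.
  have := h i j; rewrite /ball/= => hij; rewrite distrC; exact: ltW.
under eq_bigr do rewrite sumr_const card_ord.
rewrite sumr_const card_ord -mulrnA -(mulr_natl (e / _)) mulrCA ger_pMr// ler_pdivrMr// mul1r ler_nat.
by rewrite mulnC ltnW.
Qed.

Theorem theorem3p1 (R : realType) (d n : nat) (T : R)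
  (Ehat : (cpath R d -> R) -> R)
  (QV : 'I_d -> 'I_d -> R -> rseq R d)
  (X0 : R -> 'rV[R]_n)
  (b : R -> @rfield R d n)
  (h : R -> 'I_d -> 'I_d -> @rfield R d n)
  (sigma : R -> 'I_d -> @rfield R d n)
  (alpha1 : @process R d 1) (alpha2 alpha rho : R -> R)
  (X : R -> @process R d n) :
  (0 < d)%N -> (0 < n)%N -> 0 < T ->
  G_expectation Ehat ->
  (forall i j t, 0 <= t -> is_bracket Ehat i j t (QV i j t)) ->
  (forall eps x, 0 <= eps ->
    [/\ MG Ehat 2 T (fun t => b eps t x),
        forall i j, MG Ehat 2 T (fun t => h eps i j t x) &
        forall j, MG Ehat 2 T (fun t => sigma eps j t x)]) ->
  (forall eps t x, 0 <= eps -> 0 <= t <= T ->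
    LGle Ehat
      (fun k w => enorm (b eps t x k w) ^+ 2
                  + \sum_i \sum_j enorm (h eps i j t x k w) ^+ 2
                  + \sum_j enorm (sigma eps j t x k w) ^+ 2)
      (fun k w => enorm (alpha1 t k w) ^+ 2 + alpha2 t ^+ 2 * enorm x ^+ 2)) ->
  (forall eps t x1 x2, 0 <= eps -> 0 <= t <= T ->
    LGle Ehat
      (fun k w => enorm (b eps t x1 k w - b eps t x2 k w) ^+ 2
        + \sum_i \sum_j enorm (h eps i j t x1 k w - h eps i j t x2 k w) ^+ 2
        + \sum_j enorm (sigma eps j t x1 k w - sigma eps j t x2 k w) ^+ 2)
      (fun k w => alpha t ^+ 2 * rho (enorm (x1 - x2) ^+ 2))) ->
  MG Ehat 2 T alpha1 ->
  (forall t, 0 <= t <= T -> 0 <= alpha2 t /\ 0 <= alpha t) ->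
  lebesgue_measure.-integrable `[0, T] (EFin \o alpha2) ->
  lebesgue_measure.-integrable `[0, T] (EFin \o alpha) ->
  (* needed: without it, alpha(t) = t^(-1/2), rho(r) = r, d = 1, n = 2 and
     sigma(t, x) = J x / max(sqrt t, |x|), J a quarter turn, X0(eps) = (eps, 0),
     give |X(eps)_t|^2 = eps^2 + t although X(0) = 0 *)
  lebesgue_measure.-integrable `[0, T] (EFin \o (fun t => alpha t ^+ 2)) ->
  (forall r, 0 < r -> 0 < rho r) ->
  {in `]0, +oo[, continuous rho} ->
  (forall r s, 0 < r -> r <= s -> rho r <= rho s) ->
  (forall r s l, 0 < r -> 0 < s -> 0 <= l <= 1 ->
    l * rho r + (1 - l) * rho s <= rho (l * r + (1 - l) * s)) ->
  rho r @[r --> 0^'+] --> (0 : R) ->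
  rho 0 = 0 ->
  (\int[lebesgue_measure]_(r in `]0%R, 1%R[) ((rho r)^-1)%:E = +oo)%E ->
  (forall eps, 0 <= eps ->
    is_solution Ehat QV T (X0 eps) (b eps) (h eps) (sigma eps) (X eps)) ->
  X0 eps @[eps --> 0^'+] --> X0 0 ->
  coef_cvg Ehat T b (X 0) ->
  (forall i j, coef_cvg Ehat T (fun eps => h eps i j) (X 0)) ->
  (forall j, coef_cvg Ehat T (fun eps => sigma eps j) (X 0)) ->
  forall t, 0 <= t <= T ->
    EG Ehat (fun k w => enorm (X eps t k w - X 0 t k w) ^+ 2)
      @[eps --> 0^'+] --> (0 : R).
Proof.
move=> d0 n0 Tgt0 HG hQ hcoef hgrow hlip halpha1 halpha ia2 ia iaa rgt0 rcont rmono rconc rlim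
  rho0 rdiv hsol hX0 cb ch cs t tT.
have T0 := ltW Tgt0; have HE := HG.1; have [s2 [kap Hinc]] := G_increments HG.
have Atime := Lip_integrator_integrator HE T0 (time_Lip_integrator HE T0).
have AQ i j := Lip_integrator_integrator HE T0 (bracket_Lip_integrator HE T0 Hinc (hQ i j)).
have AB j := brownian_integrator HE T0 Hinc j.
move: Atime AQ; set Ct := (1 + 1 ^+ 2 * T); set Cq := (s2 + s2 ^+ 2 * T) => Atime AQ.
have Ct0 : 0 <= Ct by have [] := Atime.
have s20 : 0 <= s2 by have [[]] := Hinc.
have Cq0 : 0 <= Cq by rewrite addr_ge0// mulr_ge0// sqr_ge0.
have [phb [phb1 phb2]] := cb.
have /choice[phh hphh] (ij : 'I_d * 'I_d) := ch ij.1 ij.2.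
have /choice[phs hphs] := cs.
have MGL m (eta : @process R d m) s : MG Ehat 2 T eta -> 0 <= s <= T -> LG Ehat 2 T (eta s).
  by move=> [hE _]; exact: hE.
have coefL (eps x : _) s : 0 <= eps -> 0 <= s <= T ->
    [/\ forall k, vLip T (b eps s x k), forall i j k, vLip T (h eps i j s x k) &
        forall j k, vLip T (sigma eps j s x k)].
  move=> eps0 sT; have [hb hh hs] := hcoef eps x eps0; split => [k|i j k|j k].
  - exact: LG_Lv (MGL _ _ s hb sT) k.
  - exact: LG_Lv (MGL _ _ s (hh i j) sT) k.
  - exact: LG_Lv (MGL _ _ s (hs j) sT) k.
have lipc (eps s : R) : 0 <= eps -> 0 <= s <= T -> forall x1 x2,
  let c := fun _ : cpath R d => alpha s ^+ 2 * rho (enorm (x1 - x2) ^+ 2) in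
  [/\ LGle Ehat (fun k w => enorm (b eps s x1 k w - b eps s x2 k w) ^+ 2) (fun=> c),
      forall i j, LGle Ehat (fun k w => enorm (h eps i j s x1 k w - h eps i j s x2 k w) ^+ 2) (fun=> c) &
      forall j, LGle Ehat (fun k w => enorm (sigma eps j s x1 k w - sigma eps j s x2 k w) ^+ 2) (fun=> c)].
  move=> eps0 sT x1 x2 c; have [b1 h1 g1] := coefL eps x1 s eps0 sT; have [b2 h2 g2] := coefL eps x2 s eps0 sT.
  have Lb k : Lip_upto T (fun w => enorm (b eps s x1 k w - b eps s x2 k w) ^+ 2).
    by apply: LipX; apply: Lip_enorm => //; exact: vLipB.
  have Lh i j k : Lip_upto T (fun w => enorm (h eps i j s x1 k w - h eps i j s x2 k w) ^+ 2).
    by apply: LipX; apply: Lip_enorm => //; exact: vLipB.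
  have Ls j k : Lip_upto T (fun w => enorm (sigma eps j s x1 k w - sigma eps j s x2 k w) ^+ 2).
    by apply: LipX; apply: Lip_enorm => //; exact: vLipB.
  have Lsum k : Lip_upto T (fun w => enorm (b eps s x1 k w - b eps s x2 k w) ^+ 2
        + \sum_i \sum_j enorm (h eps i j s x1 k w - h eps i j s x2 k w) ^+ 2
        + \sum_j enorm (sigma eps j s x1 k w - sigma eps j s x2 k w) ^+ 2).
    apply: LipD; last by apply: Lip_sum => // j; exact: Ls.
    apply: LipD; first exact: Lb.
    by apply: Lip_sum => // i; apply: Lip_sum => // j; exact: Lh.
  have Lc : Lip_upto T c by exact: Lip_cst.
  have sh k w : 0 <= \sum_i \sum_j enorm (h eps i j s x1 k w - h eps i j s x2 k w) ^+ 2.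
    by apply: sumr_ge0 => i _; apply: sumr_ge0 => j _; exact: sqr_ge0.
  have ss k w : 0 <= \sum_j enorm (sigma eps j s x1 k w - sigma eps j s x2 k w) ^+ 2.
    by apply: sumr_ge0 => j _; exact: sqr_ge0.
  have := hlip eps s x1 x2 eps0 sT => hl; split => [|i j|j].
  - by apply: (LGle_trans HE T0 Lsum Lb Lc _ hl) => k w; rewrite -addrA lerDl addr_ge0.
  - apply: (LGle_trans HE T0 Lsum (Lh i j) Lc _ hl) => k w.
    rewrite (bigD1 i)//= (bigD1 j)//= -!addrA addrCA lerDl !addr_ge0 ?sqr_ge0//.
    + by apply: sumr_ge0 => j' _; exact: sqr_ge0.
    + by apply: sumr_ge0 => i' _; apply: sumr_ge0 => j' _; exact: sqr_ge0.
  - apply: (LGle_trans HE T0 Lsum (Ls j) Lc _ hl) => k w.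
    apply: (@le_trans _ _ (\sum_j enorm (sigma eps j s x1 k w - sigma eps j s x2 k w) ^+ 2)).
      by rewrite (bigD1 j)//= lerDl; apply: sumr_ge0 => j' _; exact: sqr_ge0.
    by rewrite lerDr addr_ge0 ?sqr_ge0.
(* The factors of [solution_distance] multiplied out: the inner 4 is the one in front of the
   integral of [g], and in the fourth power of d two factors come from the squares of sums and two
   from the numbers of terms. *)
pose CC := 8 * (Ct * 4) + 4 * (d%:R * (d%:R * (d%:R * (d%:R * (Cq * 4))))) + 2 * (d%:R * (d%:R * (s2 * 4))).
have CC0 : 0 <= CC by rewrite /CC !addr_ge0// !mulr_ge0.
apply/cvgrPdist_le => e e0.
have a20 s : 0 <= s <= T -> 0 <= alpha s ^+ 2 by move=> _; exact: sqr_ge0.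
(* 18 is twice the constant of [coef_pdist], the 2 being that of [pdist_trans]. *)
have K0 : 0 <= CC * 18 by rewrite mulr_ge0.
have [c0 c00 hosg] := osgood rgt0 rcont rmono rconc rdiv T0 K0 a20 iaa e0.
(* The budget [c0] is shared by a constant [c0] / 4 that keeps the majorant positive, the initial
   values, and the convergence of the coefficients, each taking at most a quarter. *)
pose dl := c0 / 4 / (4 * CC + 1).
have CC1 : 0 < 4 * CC + 1 by lra.
have dl0 : 0 < dl by rewrite !divr_gt0.
have CCdl : CC * (4 * dl) <= c0 / 4.
  have -> : CC * (4 * dl) = c0 / 4 * (4 * CC / (4 * CC + 1)) by rewrite /dl; ring.
  by rewrite ler_piMr ?divr_ge0 ?(ltW c00)// ler_pdivrMr// mul1r lerDl.
have TT : 0 <= T <= T by rewrite T0 lexx.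
pose dx := Num.min 1 (c0 / 32); have dx0 : 0 < dx by rewrite lt_min ltr01 divr_gt0.
have nX := cvg_enorm hX0 dx0.
have nb : \forall eps \near 0^'+, (\int[lebesgue_measure]_(s in `[0%R, T])
   (pdist Ehat 2 (phb eps) (phb 0%R) s)%:E < dl%:E)%E by apply: ecvg0_lt dl0; exact: phb2.
have nh : \forall eps \near 0^'+, forall ij, (\int[lebesgue_measure]_(s in `[0%R, T])
   (pdist Ehat 2 (phh ij eps) (phh ij 0%R) s)%:E < dl%:E)%E.
  by apply: filter_forall => ij; apply: ecvg0_lt dl0; exact: (hphh ij).2.
have ns : \forall eps \near 0^'+, forall j, (\int[lebesgue_measure]_(s in `[0%R, T])
   (pdist Ehat 2 (phs j eps) (phs j 0%R) s)%:E < dl%:E)%E.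
  by apply: filter_forall => j; apply: ecvg0_lt dl0; exact: (hphs j).2.
have n0' : \forall eps \near 0^'+, 0 < eps :> R by exact: nbhs_right_gt.
near=> eps.
have eps_gt0 : 0 < eps by near: eps; exact: n0'.
have kX : enorm (X0 eps - X0 0) <= dx by near: eps; exact: nX.
have kb : (\int[lebesgue_measure]_(s in `[0%R, T])
   (pdist Ehat 2 (phb eps) (phb 0%R) s)%:E < dl%:E)%E by near: eps; exact: nb.
have kh : forall ij, (\int[lebesgue_measure]_(s in `[0%R, T])
   (pdist Ehat 2 (phh ij eps) (phh ij 0%R) s)%:E < dl%:E)%E by near: eps; exact: nh.
have ks : forall j, (\int[lebesgue_measure]_(s in `[0%R, T])
   (pdist Ehat 2 (phs j eps) (phs j 0%R) s)%:E < dl%:E)%E by near: eps; exact: ns.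
have eps0 := ltW eps_gt0.
have [MX1 [b1 [h1 [g1 [cb1 ch1 cg1 eq1]]]]] := hsol eps eps0.
have [MX0 [b0 [h0 [g0 [cb0 ch0 cg0 eq0]]]]] := hsol 0 (lexx 0).
have [gb [mgb gbp igb wgb]] := coef_gap HE T0 cb1.1 cb0.1.
have /choice[gh hgh] (ij : 'I_d * 'I_d) := coef_gap HE T0 (ch1 ij.1 ij.2).1 (ch0 ij.1 ij.2).1.
have /choice[gs hgs] j := coef_gap HE T0 (cg1 j).1 (cg0 j).1.
pose c2 := enorm (X0 eps - X0 0) ^+ 2.
have c20 : 0 <= c2 by exact: sqr_ge0.
have c2le : 8 * c2 <= c0 / 4.
  have dx1 : dx <= 1 by rewrite ge_min lexx.
  have dx2 : dx <= c0 / 32 by rewrite ge_min lexx orbT.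
  have : c2 <= dx * 1.
    rewrite /c2 expr2; apply: ler_pM => //; first exact: enorm_ge0; first exact: enorm_ge0.
    exact: le_trans kX dx1.
  by rewrite mulr1 => /le_trans/(_ dx2); clear; move: (c2) => x; lra.
pose clamp s := Num.min (Num.max s 0) T.
have clampT s : 0 <= clamp s <= T.
  by rewrite /clamp le_min ge_min T0 lexx orbT le_max lexx orbT.
have clampE s : 0 <= s <= T -> clamp s = s.
  by move=> /andP[s0 sT]; rewrite /clamp max_l// min_l.
have clamp_mono s s' : s <= s' -> clamp s <= clamp s'.
  move=> ss; rewrite /clamp le_min !ge_min ge_max !le_max lexx ss/= !lexx !orbT /= ?orbT//.
pose G (g : R -> R) (s : R) := Rintegral lebesgue_measure `[0, clamp s] g.
have Gmono (g : R -> R) : measurable_fun `[0, T] g -> (forall x, 0 <= x <= T -> 0 <= g x) ->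
    (\int[lebesgue_measure]_(x in `[0%R, T]) (g x)%:E < +oo)%E ->
    forall s s', s <= s' -> 0 <= G g s <= G g s'.
  move=> mg g0' ig s s' ss; apply: (Rintegral0t_mono _ _ _ mg g0' ig).
  - by have /andP[] := clampT s.
  - exact: clamp_mono.
  - by have /andP[] := clampT s'.
have gb0 x : 0 <= x <= T -> 0 <= gb x by move=> /gbp /andP[].
have gh0 ij x : 0 <= x <= T -> 0 <= gh ij x by have [_ hp _ _] := hgh ij; move=> /hp /andP[].
have gs0 j x : 0 <= x <= T -> 0 <= gs j x by have [_ hp _ _] := hgs j; move=> /hp /andP[].
have Gb := Gmono gb mgb gb0 igb.
have Gh ij : forall s s', s <= s' -> 0 <= G (gh ij) s <= G (gh ij) s'.
  by have [mh _ ih _] := hgh ij; exact: Gmono mh (gh0 ij) ih.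
have Gs j : forall s s', s <= s' -> 0 <= G (gs j) s <= G (gs j) s'.
  by have [ms _ igs _] := hgs j; exact: Gmono ms (gs0 j) igs.
pose Kb s := Ct * (4 * G gb s).
pose Kh s i j := Cq * (4 * G (gh (i, j)) s).
pose Ks s j := s2 * (4 * G (gs j) s).
pose vv s := c0 / 4 + 2 * (2 * (2 * (c2 + Kb s) + d%:R * \sum_i (d%:R * \sum_j Kh s i j))
   + d%:R * \sum_j Ks s j).
have Kb0 s : 0 <= Kb s by rewrite /Kb !mulr_ge0//; have /andP[] := Gb s s (lexx s).
have Kh0 s i j : 0 <= Kh s i j by rewrite /Kh !mulr_ge0//; have /andP[] := Gh (i, j) s s (lexx s).
have Ks0 s j : 0 <= Ks s j by rewrite /Ks !mulr_ge0//; have /andP[] := Gs j s s (lexx s).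
have vv0 s : 0 < vv s.
  rewrite /vv ltr_wpDr ?divr_gt0//; apply: mulr_ge0 => //; apply: addr_ge0; last first.
    by apply: mulr_ge0 => //; apply: sumr_ge0.
  apply: mulr_ge0 => //; apply: addr_ge0; first by rewrite mulr_ge0// addr_ge0.
  apply: mulr_ge0 => //; apply: sumr_ge0 => i _; apply: mulr_ge0 => //.
  by apply: sumr_ge0.
have vvmono s s' : s <= s' -> vv s <= vv s'.
  move=> ss; rewrite /vv lerD2l ler_wpM2l//; apply: lerD.
    rewrite ler_wpM2l//; apply: lerD.
      by rewrite ler_wpM2l// lerD2l ler_wpM2l// ler_wpM2l//; have /andP[] := Gb s s' ss.
    rewrite ler_wpM2l//; apply: ler_sum => i _; rewrite ler_wpM2l//; apply: ler_sum => j _.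
    by rewrite ler_wpM2l// ler_wpM2l//; have /andP[] := Gh (i, j) s s' ss.
  rewrite ler_wpM2l//; apply: ler_sum => j _.
  by rewrite ler_wpM2l// ler_wpM2l//; have /andP[] := Gs j s s' ss.
have ub s : 0 <= s <= T -> pdist Ehat 2 (X eps) (X 0) s <= vv s.
  move=> sT; have sT' : s <= T by have /andP[] := sT.
  have [Ib1 [Ih1 [Is1 [eb1 eh1 es1 E1]]]] := eq1 s sT.
  have [Ib0 [Ih0 [Is0 [eb0 eh0 es0 E0]]]] := eq0 s sT.
  have L1 m (Z : vseq R d m) : LG Ehat 2 s Z -> LG Ehat 1 T Z.
    by move=> hZ; apply: (LG21 HE T0); exact: LG_mono sT' hZ.
  apply: le_trans (_ : _ <= 2 * (2 * (2 * (c2 + Kb s) + d%:R * \sum_i (d%:R * \sum_j Kh s i j))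
   + d%:R * \sum_j Ks s j)) _; last by rewrite /vv lerDr divr_ge0// ltW.
  apply: (solution_distance HE T0 _ _ _ _ _ _ _ _ E1 E0).
  - exact: MGL MX1 sT.
  - exact: MGL MX0 sT.
  - exact: LG_mono sT' eb1.1.
  - exact: LG_mono sT' eb0.1.
  - by move=> i j; exact: LG_mono sT' (eh1 i j).1.
  - by move=> i j; exact: LG_mono sT' (eh0 i j).1.
  - by move=> j; exact: L1 (es1 j).1.
  - by move=> j; exact: L1 (es0 j).1.
  - exact: Kb0.
  - exact: Kh0.
  - exact: Ks0.
  - by rewrite /Kb /G clampE//; exact: wgb Atime sT eb1 eb0.
  - move=> i j; rewrite /Kh /G clampE//; have [_ _ _ w] := hgh (i, j).
    exact: w (AQ i j) sT (eh1 i j) (eh0 i j).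
  - move=> j; rewrite /Ks /G clampE//; have [_ _ _ w] := hgs j.
    exact: w (AB j) sT (es1 j) (es0 j).
pose mm s := alpha s ^+ 2 * rho (vv s).
have rho_vv s : 0 < rho (vv s) by exact: rgt0.
have imm : lebesgue_measure.-integrable `[0, T] (EFin \o mm).
  apply: (@integrable_mul_nondecreasing R T (fun s => alpha s ^+ 2) (fun s => rho (vv s))) => //.
    by move=> s s' ss; apply: rmono => //; exact: vvmono.
  by move=> s; exact: ltW.
have mm0 x : 0 <= mm x by rewrite mulr_ge0 ?sqr_ge0// ltW.
have coefbound (f : R -> @rfield R d n) (fX : R -> @process R d n) (eta1 eta0 : @process R d n) :
    (forall eps, 0 <= eps -> is_composite Ehat T (f eps) (X 0) (fX eps)) ->
    is_composite Ehat T (f eps) (X eps) eta1 -> is_composite Ehat T (f 0) (X 0) eta0 ->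
    (forall eps s x k, 0 <= eps -> 0 <= s <= T -> vLip T (f eps s x k)) ->
    (forall eps s x1 x2, 0 <= eps -> 0 <= s <= T ->
      LGle Ehat (fun k w => enorm (f eps s x1 k w - f eps s x2 k w) ^+ 2)
        (fun _ _ => alpha s ^+ 2 * rho (enorm (x1 - x2) ^+ 2))) ->
    forall x, 0 <= x <= T ->
      pdist Ehat 2 eta1 eta0 x <= 18 * mm x + 4 * pdist Ehat 2 (fX eps) (fX 0) x.
  move=> hfX [M1 ev1] [M0 ev0] hL hlf x xT.
  have [MP evP] := hfX eps eps0; have [MP0 evP0] := hfX 0 (lexx 0).
  have al0 : 0 <= alpha x by have [] := halpha x xT.
  have l1 := MGL _ _ x M1 xT; have l0 := MGL _ _ x M0 xT.
  have lP := MGL _ _ x MP xT; have lP0 := MGL _ _ x MP0 xT.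
  have lX1 := MGL _ _ x MX1 xT; have lX0 := MGL _ _ x MX0 xT.
  have k1 : pdist Ehat 2 eta1 (fX eps) x <= 9 * mm x.
    apply: (coef_pdist HE T0 rgt0 rmono rconc rho0 (vv0 x) al0 _ lX1 lX0 l1 lP (ev1 x xT) (evP x xT)).
    - by move=> y k; exact: hL.
    - by move=> x1 x2; exact: hlf.
    - exact: ub.
  have k2 : pdist Ehat 2 (fX 0) eta0 x <= 0.
    apply/ler_addgt0Pr => e1 e10; rewrite add0r.
    have A1 : 0 < 9 * alpha x ^+ 2 + 1 by rewrite ltr_wpDl// mulr_ge0// sqr_ge0.
    have [u u0 hu] : exists2 u, 0 < u & rho u <= e1 / (9 * alpha x ^+ 2 + 1).
      have hr : \forall r \near 0^'+, 0 < r /\ rho r <= e1 / (9 * alpha x ^+ 2 + 1).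
        near=> r; split; first by near: r; exact: nbhs_right_gt.
        near: r; apply: cvgr_le rlim _ _; rewrite divr_gt0//.
      by have [u [u0 hu]] := filter_ex hr; exists u.
    apply: le_trans (_ : _ <= 9 * (alpha x ^+ 2 * rho u)) _; last first.
      apply: (@le_trans _ _ (9 * alpha x ^+ 2 * (e1 / (9 * alpha x ^+ 2 + 1)))).
        by rewrite mulrA ler_wpM2l// mulr_ge0// sqr_ge0.
      by rewrite mulrCA ler_piMr ?(ltW e10)// ler_pdivrMr// mul1r lerDl.
    apply: (coef_pdist HE T0 rgt0 rmono rconc rho0 u0 al0 _ lX0 lX0 lP0 l0 (evP0 x xT) (ev0 x xT)).
    - by move=> y k; exact: hL.
    - by move=> x1 x2; exact: hlf.
    - apply: (EG_le_near HE T0 (p := 2) isT (LG_sub HE T0 (p := 2) isT lX0 lX0)).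
      by apply: nearW => k; under eq_fun do rewrite subrr enorm0 expr0n; rewrite (E_cst HE) ltW.
  have k3 := pdist_trans HE T0 (p := 2) isT l1 lP l0.
  have k4 := pdist_trans HE T0 (p := 2) isT lP lP0 l0.
  move: k1 k2 k3 k4.
  move: (pdist Ehat 2 eta1 (fX eps) x) (pdist Ehat 2 (fX 0) eta0 x) (pdist Ehat 2 eta1 eta0 x)
    (pdist Ehat 2 (fX eps) eta0 x) (pdist Ehat 2 (fX eps) (fX 0) x) (mm x).
  clear; move=> y1 y2 y3 y4 y5 y6; lra.
pose Bd s := 18 * Rintegral lebesgue_measure `[0, s] mm + 4 * dl.
have gapB (g : R -> R) (eta1 eta0 : @process R d n) (fX : R -> @process R d n) :
    measurable_fun `[0, T] g -> (forall x, 0 <= x <= T -> 0 <= g x <= pdist Ehat 2 eta1 eta0 x) ->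
    (\int[lebesgue_measure]_(x in `[0%R, T]) (g x)%:E < +oo)%E ->
    MG Ehat 2 T (fX eps) -> MG Ehat 2 T (fX 0) ->
    (forall x, 0 <= x <= T -> pdist Ehat 2 eta1 eta0 x <= 18 * mm x + 4 * pdist Ehat 2 (fX eps) (fX 0) x) ->
    (\int[lebesgue_measure]_(s in `[0%R, T]) (pdist Ehat 2 (fX eps) (fX 0%R) s)%:E < dl%:E)%E ->
    forall s, 0 <= s <= T -> G g s <= Bd s.
  move=> mg gp ig MP MP0 hpd hdl s sT; rewrite /G clampE//.
  have h18 : 0 <= 18 :> R by []. have h4 : 0 < 4 :> R by [].
  have hp x : 0 <= x <= T -> [/\ 0 <= g x, g x <= pdist Ehat 2 eta1 eta0 x, 0 <= mm x,
      0 <= pdist Ehat 2 (fX eps) (fX 0) x &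
      pdist Ehat 2 eta1 eta0 x <= 18 * mm x + 4 * pdist Ehat 2 (fX eps) (fX 0) x].
    move=> xT; have /andP[p1 p2] := gp x xT.
    split; [exact: p1|exact: p2|exact: mm0| |exact: hpd].
    by apply: (pdist_ge0 HE T0 (p := 2) isT); [exact: MGL MP xT|exact: MGL MP0 xT].
  exact: (@gap_bound R T g mm _ _ 18 4 dl h18 h4 mg ig imm hp (ltW hdl) s sT).
have Gb_le s : 0 <= s <= T -> G gb s <= Bd s.
  have M1 := (phb1 eps eps0).1; have M0 := (phb1 0 (lexx 0)).1.
  apply: (gapB gb b1 b0 phb mgb gbp igb M1 M0 _ kb).
  apply: (coefbound b phb b1 b0 phb1 cb1 cb0).
  - by move=> e1 s1 x k p1 p2; have [+ _ _] := coefL e1 x s1 p1 p2; apply.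
  - by move=> e1 s1 x1 x2 p1 p2; have [+ _ _] := lipc e1 s1 p1 p2 x1 x2.
have Gh_le i j s : 0 <= s <= T -> G (gh (i, j)) s <= Bd s.
  have hf := (hphh (i, j)).1; have M1 := (hf eps eps0).1; have M0 := (hf 0 (lexx 0)).1.
  have [mg gp ig _] := hgh (i, j).
  apply: (gapB (gh (i, j)) (h1 i j) (h0 i j) (phh (i, j)) mg gp ig M1 M0 _ (kh (i, j))).
  apply: (coefbound (fun e => h e i j) (phh (i, j)) (h1 i j) (h0 i j) hf (ch1 i j) (ch0 i j)).
  - by move=> e1 s1 x k p1 p2; have [_ + _] := coefL e1 x s1 p1 p2; apply.
  - by move=> e1 s1 x1 x2 p1 p2; have [_ + _] := lipc e1 s1 p1 p2 x1 x2; apply.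
have Gs_le j s : 0 <= s <= T -> G (gs j) s <= Bd s.
  have hf := (hphs j).1; have M1 := (hf eps eps0).1; have M0 := (hf 0 (lexx 0)).1.
  have [mg gp ig _] := hgs j.
  apply: (gapB (gs j) (g1 j) (g0 j) (phs j) mg gp ig M1 M0 _ (ks j)).
  apply: (coefbound (fun e => sigma e j) (phs j) (g1 j) (g0 j) hf (cg1 j) (cg0 j)).
  - by move=> e1 s1 x k p1 p2; have [_ _ +] := coefL e1 x s1 p1 p2; apply.
  - by move=> e1 s1 x1 x2 p1 p2; have [_ _ +] := lipc e1 s1 p1 p2 x1 x2; apply.
have vvle s : 0 <= s <= T -> vv s <= c0 + CC * 18 * Rintegral lebesgue_measure `[0, s] mm.
  move=> sT.
  have S1 : \sum_i (d%:R * \sum_j Kh s i j) <= d%:R * (d%:R * (d%:R * (Cq * (4 * Bd s)))).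
    apply: (@le_trans _ _ (\sum_(i < d) (d%:R * (d%:R * (Cq * (4 * Bd s)))))).
      apply: ler_sum => i _; rewrite ler_wpM2l//.
      apply: (@le_trans _ _ (\sum_(j < d) (Cq * (4 * Bd s)))).
        by apply: ler_sum => j _; rewrite ler_wpM2l// ler_wpM2l//; exact: Gh_le.
      by rewrite sumr_const card_ord -[X in X <= _]mulr_natl.
    by rewrite sumr_const card_ord -[X in X <= _]mulr_natl.
  have S2 : \sum_j Ks s j <= d%:R * (s2 * (4 * Bd s)).
    apply: (@le_trans _ _ (\sum_(j < d) (s2 * (4 * Bd s)))).
      by apply: ler_sum => j _; rewrite ler_wpM2l// ler_wpM2l//; exact: Gs_le.
    by rewrite sumr_const card_ord -[X in X <= _]mulr_natl.
  have S3 : Kb s <= Ct * (4 * Bd s) by rewrite ler_wpM2l// ler_wpM2l//; exact: Gb_le.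
  apply: (@le_trans _ _ (c0 / 4 + 2 * (2 * (2 * (c2 + Ct * (4 * Bd s)) +
      d%:R * (d%:R * (d%:R * (d%:R * (Cq * (4 * Bd s)))))) + d%:R * (d%:R * (s2 * (4 * Bd s)))))).
    rewrite /vv lerD2l ler_wpM2l//; apply: lerD; last by rewrite ler_wpM2l.
    by rewrite ler_wpM2l//; apply: lerD; rewrite ler_wpM2l// lerD2l.
  have -> : c0 / 4 + 2 * (2 * (2 * (c2 + Ct * (4 * Bd s)) +
      d%:R * (d%:R * (d%:R * (d%:R * (Cq * (4 * Bd s)))))) + d%:R * (d%:R * (s2 * (4 * Bd s))))
    = c0 / 4 + 8 * c2 + CC * (4 * dl) + CC * 18 * Rintegral lebesgue_measure `[0, s] mm.
    by rewrite /CC /Bd; ring.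
  rewrite lerD2r; move: c2le CCdl c00; move: (8 * c2) (CC * (4 * dl)); clear; move=> x y; lra.
have vT := hosg c0 vv c00 (lexx c0) vvmono vv0 vvle.
rewrite sub0r normrN ger0_norm.
  have /andP[_ t'] := tT; exact: le_trans (ub t tT) (le_trans (vvmono t T t') vT).
by apply: (EG_ge0 HE T0 (p := 2) isT); apply: LG_sub => //; [exact: MGL MX1 tT|exact: MGL MX0 tT].
Unshelve. all: by end_near. Qed.
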